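(* If $A, B \in \mathsf{FLCAb}$, then $\mathrm{Hom}(A, B) \in \mathsf{FLCAb}$, i.e. the group of continuous homomorphisms $A \to B$ with the compact-open topology is a locally compact abelian group having finite ranks.
   Context: LCA group means locally compact (Hausdorff) abelian group. A morphism (continuous homomorphism) $f: A\to B$ of LCA groups is strict if the induced map $A/\ker(f) \to B$ is a closed embedding. An LCA group $A$ has finite ranks if the real vector spaces $\mathrm{Hom}(A, \mathbb{R})$ and $\mathrm{Hom}(\mathbb{R}, A)$ are finite-dimensional and, for every prime $p$, multiplication $p: A \to A$ is strict with finite kernel and cokernel. $\mathsf{FLCAb}$ is the category of LCA groups having finite ranks and continuous homomorphisms. *)

(* Defs.v *)
From HB Require Import structures.
From mathcomp Require Import all_boot all_order all_algebra.
From mathcomp Require Import all_classical all_reals all_analysis.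

Set Implicit Arguments.
Unset Strict Implicit.
Unset Printing Implicit Defensive.

Import GRing.Theory numFieldNormedType.Exports.
Local Open Scope classical_set_scope.
Local Open Scope ring_scope.
Local Open Scope quotient_scope.

#[short(type="chom")]
HB.structure Definition ContinuousAdditive (A B : topologicalZmodType) :=
  {f of isContinuous A B f & @GRing.Additive A B f}.

HB.instance Definition _ (A B : topologicalZmodType) := gen_eqMixin (chom A B).
HB.instance Definition _ (A B : topologicalZmodType) :=
  gen_choiceMixin (chom A B).

Section build.
Context {A B : topologicalZmodType} (f : A -> B).
Hypotheses (fB : zmod_morphism f) (cf : continuous f).

Definition chom_fun : A -> B := let _ := fB in let _ := cf in f.
HB.instance Definition _ := isContinuous.Build A B chom_fun cf.
HB.instance Definition _ := GRing.isZmodMorphism.Build A B chom_fun fB.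
Definition mk_chom : chom A B := chom_fun.

End build.

Lemma chomP (A B : topologicalZmodType) (f g : chom A B) : f = g <-> f =1 g.
Proof.
split=> [->//|]; move: f g => [f [[cf] [hf]]] [g [[cg] [hg]]] /= /funext fg.
case: _ / fg in cg hg *.
by rewrite (Prop_irrelevance cf cg) (Prop_irrelevance hf hg).
Qed.

Section chom_zmod.
Context {A B : topologicalZmodType}.
Implicit Types f g h : chom A B.

Let zeroB : zmod_morphism (fun _ : A => 0 : B).
Proof. by move=> x y; rewrite subr0. Qed.

Let addB f g : zmod_morphism (fun x => f x + g x).
Proof. by move=> x y; rewrite !raddfB opprD addrACA. Qed.

Let oppB f : zmod_morphism (fun x => - f x).
Proof. by move=> x y; rewrite raddfB opprD. Qed.

Let zero_cts : continuous (fun _ : A => 0 : B).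
Proof. by move=> x; exact: cvg_cst. Qed.

Let add_cts f g : continuous (fun x => f x + g x).
Proof.
move=> x; apply: (@continuous_comp _ _ _ (fun x => (f x, g x))
  (fun x : B * B => x.1 + x.2)); last exact: add_continuous.
by apply: cvg_pair; exact: cts_fun.
Qed.

Let opp_cts f : continuous (fun x => - f x).
Proof.
by move=> x; apply: continuous_comp; [exact: cts_fun|exact: opp_continuous].
Qed.

Definition chom_zero := mk_chom zeroB zero_cts.
Definition chom_add f g := mk_chom (addB f g) (@add_cts f g).
Definition chom_opp f := mk_chom (oppB f) (@opp_cts f).

Let addA : associative chom_add.
Proof. by move=> f g h; apply/chomP => x; exact: addrA. Qed.
Let addC : commutative chom_add.
Proof. by move=> f g; apply/chomP => x; exact: addrC. Qed.
Let add0 : left_id chom_zero chom_add.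
Proof. by move=> f; apply/chomP => x; exact: add0r. Qed.
Let addN : left_inverse chom_zero chom_opp chom_add.
Proof. by move=> f; apply/chomP => x; exact: addNr. Qed.

HB.instance Definition _ :=
  GRing.isZmodule.Build (chom A B) addA addC add0 addN.

Lemma chom_addE f g x : (f + g) x = f x + g x. Proof. by []. Qed.
Lemma chom_oppE f x : (- f) x = - f x. Proof. by []. Qed.
Lemma chom_0E x : (0 : chom A B) x = 0. Proof. by []. Qed.

End chom_zmod.

Definition compact_open_of_chom {A B : topologicalZmodType} (f : chom A B) :
  {compact-open, A -> B} := f.

HB.instance Definition _ (A B : topologicalZmodType) :=
  Topological.copy (chom A B) (initial_topology (@compact_open_of_chom A B)).

Lemma topologicalZmod_regular (B : topologicalZmodType) : regular_space B.
Proof.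
move=> a U Ua.
have [[P N] /= [Pa N0] PNU] : nbhs (a, 0) (fun x : B * B => U (x.1 + x.2)).
  by apply: (add_continuous (a, 0)); rewrite /= addr0.
exists P => // z clPz.
have /clPz[w [Pw Nzw]] : nbhs z (fun w => N (z - w)).
  have cz : {for z, continuous (fun w => z - w)}.
    apply: (@continuous_comp _ _ _ (fun w => (z, w)) (fun x : B * B => x.1 - x.2)).
      by apply: cvg_pair; [exact: cvg_cst|exact: cvg_id].
    exact: sub_continuous.
  by apply: cz; rewrite subrr.
by rewrite -[z](subrK w) addrC; exact: (PNU (w, z - w)).
Qed.

Section chom_topology.
Context {A B : topologicalZmodType}.

Let sub_cts : continuous (fun fg : chom A B * chom A B => fg.1 - fg.2).
Proof.
apply: (@continuous_comp_initial _ _ _ (@compact_open_of_chom A B)).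
case=> f g; apply/compact_open_cvgP => K O cptK oO fgKO.
pose E (h : chom A B * chom A B) := forall x, K x -> O (h.1 x - h.2 x).
suff : \forall h \near nbhs ((f, g) : (chom A B * chom A B)%type), E h.
  by apply: filterS => h hO _ [x Kx <-]; exact: hO.
rewrite /E; move/compact_near_coveringP/near_covering_withinP: (cptK); apply=> u Ku.
have : nbhs (f u - g u) O.
  by apply: open_nbhs_nbhs; split => //; apply: fgKO; exists u.
move=> /(@sub_continuous B (f u, g u))[[P Q] /= [Pf Qg] PQO].
have cl (h : chom A B) V : nbhs (h u) V -> exists C, [/\ nbhs u C, compact (K `&` C) &
    nbhs h [set h' : chom A B | h' @` (K `&` C) `<=` V]].
  move=> hV; have [V1 hV1 V1V] := topologicalZmod_regular (nbhs_interior hV).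
  have ch : continuous h by exact: cts_fun.
  exists (h @^-1` closure V1).
  have cptC : compact (K `&` h @^-1` closure V1).
    apply: compact_closedI => //.
    by move/continuous_closedP: ch; apply; exact: closed_closure.
  split => //.
    by apply: ch; apply: filterS hV1; exact: subset_closure.
  have hK : open_nbhs (compact_open_of_chom h)
      [set k | k @` (K `&` h @^-1` closure V1) `<=` V°].
    split; first by apply: compact_open_open => //; exact: open_interior.
    by move=> _ [w [_ Cw] <-]; exact: V1V.
  apply: (@filterS _ (nbhs h) _ (@compact_open_of_chom A B @^-1` _)); last first.
    exact: (@initial_continuous _ _ (@compact_open_of_chom A B) h _
      (open_nbhs_nbhs hK)).
  by move=> k kV w /kV /interior_subset.
have [C [uC _ fC]] := cl f P Pf; have [D [uD _ gD]] := cl g Q Qg.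
exists (C `&` D, [set h : (chom A B * chom A B)%type |
    h.1 @` (K `&` C) `<=` P /\ h.2 @` (K `&` D) `<=` Q]).
  split; first exact: filterI.
  by exists ([set h : chom A B | h @` (K `&` C) `<=` P],
             [set h : chom A B | h @` (K `&` D) `<=` Q]).
case=> w [h k] [/= [Cw Dw] [hP kQ]] Kw.
by apply: (PQO (h w, k w)); split => /=; [apply: hP|apply: kQ]; exists w.
Unshelve. all: by end_near. Qed.

HB.instance Definition _ :=
  PreTopologicalNmodule_isTopologicalZmodule.Build (chom A B) sub_cts.

End chom_topology.

Section chom_lmod.
Context {R : numDomainType} {A : topologicalZmodType}
  {V : topologicalLmodType R}.
Implicit Types (a b : R) (f g : chom A V).

Let scaleB a f : zmod_morphism (fun x => a *: f x).
Proof. by move=> x y; rewrite raddfB scalerBr. Qed.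

Let scale_cts a f : continuous (fun x => a *: f x).
Proof.
move=> x; apply: (@continuous_comp _ _ _ (fun x => (a : R^o, f x))
  (fun x : R^o * V => x.1 *: x.2)); last exact: scale_continuous.
by apply: (@cvg_pair _ _ _ _ (nbhs (a : R^o))); [exact: cvg_cst|exact: cts_fun].
Qed.

Definition chom_scale a f : chom A V := mk_chom (scaleB a f) (@scale_cts a f).

Let scaleA a b f : chom_scale a (chom_scale b f) = chom_scale (a * b) f.
Proof. by apply/chomP => x; exact: scalerA. Qed.
Let scale1 : left_id 1 chom_scale.
Proof. by move=> f; apply/chomP => x; exact: scale1r. Qed.
Let scaleDr : right_distributive chom_scale +%R.
Proof. by move=> a f g; apply/chomP => x; exact: scalerDr. Qed.
Let scaleDl f : {morph chom_scale^~ f : a b / a + b}.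
Proof. by move=> a b; apply/chomP => x; exact: scalerDl. Qed.

HB.instance Definition _ := GRing.Zmodule_isLmodule.Build R (chom A V)
  scaleA scale1 scaleDr scaleDl.

End chom_lmod.

(* Hom(R, A) is a type of its own: R acts on it through the source, which on
   Hom(R, R) would compete with the action through the target. *)
Definition one_param (R : realType) (A : topologicalZmodType) : Type :=
  chom R A.

HB.instance Definition _ (R : realType) (A : topologicalZmodType) :=
  GRing.Zmodule.copy (one_param R A) (chom R A).

Section one_param_lmod.
Context {R : realType} {A : topologicalZmodType}.
Implicit Types (a b : R) (f g : one_param R A).

Let scaleB a (f : chom R A) : zmod_morphism (fun t : R => f (a * t)).
Proof. by move=> x y; rewrite mulrBr raddfB. Qed.

Let scale_cts a (f : chom R A) : continuous (fun t : R => f (a * t)).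
Proof.
move=> t; apply: (@continuous_comp _ _ _ (fun t => a * t) f).
  exact: mulrl_continuous.
exact: cts_fun.
Qed.

Definition one_param_scale a f : one_param R A :=
  mk_chom (scaleB a f) (@scale_cts a f).

Let scaleA a b f :
  one_param_scale a (one_param_scale b f) = one_param_scale (a * b) f.
Proof.
by apply/chomP => t /=; rewrite /chom_fun/= /chom_fun mulrCA mulrA.
Qed.
Let scale1 : left_id 1 one_param_scale.
Proof. by move=> f; apply/chomP => t /=; rewrite /chom_fun mul1r. Qed.
Let scaleDr : right_distributive one_param_scale +%R.
Proof. by move=> a f g; apply/chomP. Qed.
Let scaleDl f : {morph one_param_scale^~ f : a b / a + b}.
Proof.
by move=> a b; apply/chomP => t; rewrite /= /chom_fun mulrDl raddfD.
Qed.

HB.instance Definition _ := GRing.Zmodule_isLmodule.Build R (one_param R A)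
  scaleA scale1 scaleDr scaleDl.

End one_param_lmod.

Section ker_coker.
Context {A B : topologicalZmodType} (f : chom A B).

Definition chom_ker : {pred A} := fun x => f x == 0.
Definition chom_im : {pred B} := fun y => `[< range f y >].

Let ker_closed : zmod_closed chom_ker.
Proof.
split=> [|x y]; first by apply/eqP; exact: raddf0.
by move=> /eqP fx /eqP fy; apply/eqP; rewrite raddfB /= fx fy subrr.
Qed.
HB.instance Definition _ := GRing.isZmodClosed.Build A chom_ker ker_closed.

Let im_closed : zmod_closed chom_im.
Proof.
split=> [|x y]; first by apply/asboolP; exists 0 => //; rewrite raddf0.
move=> /asboolP[u _ <-] /asboolP[v _ <-]; apply/asboolP.
by exists (u - v) => //; rewrite raddfB.
Qed.
HB.instance Definition _ := GRing.isZmodClosed.Build B chom_im im_closed.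

Definition coimage := quotient_topology (Quotient.quot chom_ker).

(* The abstract cokernel; it is the cokernel among Hausdorff groups as soon as
   the image of f is closed, in particular when f is strict. *)
Definition cokernel := Quotient.quot chom_im.

Definition coimage_map : coimage -> B := f \o repr.

Lemma coimage_mapE x : coimage_map (\pi_coimage x) = f x.
Proof.
apply/eqP; rewrite /coimage_map /= -subr_eq0 -raddfB.
have : chom_ker (repr (\pi_coimage x) - x).
  by rewrite -[chom_ker _]/(_ \in chom_ker) Quotient.idealrBE reprK.
by [].
Qed.

End ker_coker.
Arguments coimage_map {A B} f _.

(* The topology of X is the one induced by f, i.e. f is a homeomorphism onto
   its image, and that image is closed. *)
Definition closed_embedding {X Y : topologicalType} (f : X -> Y) :=
  [/\ injective f,
      forall U : set X, open U <-> exists2 V : set Y, open V & f @^-1` V = U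
    & closed (range f)].

Definition strict {A B : topologicalZmodType} (f : chom A B) :=
  closed_embedding (coimage_map f).

Section mulrn.
Context (A : topologicalZmodType) (n : nat).

Let mulrnB : zmod_morphism (fun x : A => x *+ n).
Proof. by move=> x y; exact: mulrnBl. Qed.

Let mulrn_cts : continuous (fun x : A => x *+ n).
Proof.
elim: n => [|m IH] x.
  rewrite /continuous_at mulr0n; under eq_fun do rewrite mulr0n.
  exact: cvg_cst.
rewrite /continuous_at mulrS; under eq_fun do rewrite mulrS.
apply: (@continuous_comp _ _ _ (fun x => (x, x *+ m))
  (fun x : A * A => x.1 + x.2)); last exact: add_continuous.
by apply: cvg_pair; [exact: cvg_id|exact: IH].
Qed.

Definition chom_mulrn : chom A A := mk_chom mulrnB mulrn_cts.

End mulrn.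

Definition LCA (A : topologicalZmodType) :=
  hausdorff_space A /\ locally_compact [set: A].

Definition finite_dimensional (R : realType) (V : lmodType R) :=
  exists n, $| Vector.axiom n V |.

Definition finite_ranks (R : realType) (A : topologicalZmodType) :=
  [/\ finite_dimensional (chom A R^o),
      finite_dimensional (one_param R A)
    & forall p, prime p ->
        [/\ strict (chom_mulrn A p),
            finite_set [set` chom_ker (chom_mulrn A p)]
          & finite_set [set: cokernel (chom_mulrn A p)]]].

Definition FLCAb (R : realType) (A : topologicalZmodType) :=
  LCA A /\ finite_ranks R A.

(* Main.v *)
From HB Require Import structures.
Require Import Defs.
From mathcomp Require Import all_boot all_order all_algebra.
From mathcomp Require Import all_classical all_reals all_analysis.
From mathcomp Require Import ring lra zify.
From mathcomp Require complex.

(** Write [H] for the group of homomorphisms [A -> B].  Duality and the structure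
    theorem for locally compact abelian groups are replaced by an elementary
    description of such a group [G] near [0], available as soon as [Hom(R, G)] has
    finite dimension.  All one-parameter subgroups are [t |-> P (t *: x)] for a
    continuous homomorphism [P] from some [R ^ d], and [exists_local_structure]
    finds a compact neighbourhood [W] of [0] in which there is neither a line nor
    the image of a nonzero homomorphism from the rational numbers, such that every
    element close to [0] is [P v + l] with [v] bounded and all the multiples of [l]
    in [W].  Such a splitting is obtained by subtracting from an element the [P v]
    that keeps the largest number of multiples of the difference in [W]: a
    difference with finitely many multiples there would give rise, after
    rescaling, to one more one-parameter subgroup.

    The rational numbers enter for two reasons.  First, a compact set that
    receives a nonzero homomorphism [phi] from them contains a line
    ([exists_one_parameter_subgroup]).  Indeed [phi] is continuous for the topology
    defined by the characters of the rational numbers, by Bogolyubov's theorem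
    ([bohr_coloring]), so it extends to their Bohr compactification, where
    one-parameter subgroups abound by Kronecker's theorem ([kronecker]).  Second,
    if [W] receives no such homomorphism then the elements with sufficiently many
    multiples in [W] have uniformly small factorial multiples
    ([factorial_multiples_small]): a counterexample would have, as an ultralimit of
    its multiples, a homomorphism from the rational numbers.

    Local compactness.  As [Hom(A, R)] has finite dimension, the quotients of [A]
    by open subgroups have finite rank, since independent elements are separated
    by real characters; hence [A] has a compact neighbourhood [V] of [0] that
    generates it up to torsion.  The homomorphisms that send [V] to the [W] of [B]
    form a neighbourhood of [0] in [H].  It is compact ([chom_compact]): pointwise
    because multiplication by an integer is proper on [B], and equicontinuous by
    the smallness of factorial multiples, because multiplication by [n!] is open
    on [A].

    Prime numbers.  A homomorphism is [p] times another one as soon as it kills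
    the [p]-torsion and its values are divisible by [p] ([chom_divide]).  This
    amounts to finitely many open conditions of finite index, whence a finite
    cokernel; multiplication by [p] is open on [H] by compactness
    ([chom_mulrn_open]), hence strict.

    Ranks.  [Hom(R, H)] is [Hom(A, Hom(R, B))], that is [Hom(A, R) ^ d].  As for
    [Hom(H, R)], a real character of [H] that vanishes on a suitable finite set
    vanishes on a compact neighbourhood [C] of [0] ([finitely_many_detect]), so the
    point is that [H] has finite rank modulo [C].  Up to finite rank the
    homomorphisms send the generators of [A] to the subgroup of [B] that splits;
    they are then described, up to errors killed by a well chosen integer
    multiple, by finitely many real coordinates, and Dirichlet's approximation
    theorem makes the coordinates of an integer combination small
    ([finite_rank_hom_into]). *)

Set Implicit Arguments.
Unset Strict Implicit.
Unset Printing Implicit Defensive.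

Import Order.TTheory GRing.Theory Num.Theory numFieldNormedType.Exports.
Local Open Scope classical_set_scope.
Local Open Scope ring_scope.

(** * Sums of cosines *)

Section Trigonometry.
Context {R : realType}.
Implicit Types (x y : R).

Lemma cos_shift_int x y : x \is a Num.int -> cos (2 * pi * (y + x)) = cos (2 * pi * y).
Proof.
have nat_case (n : nat) (z : R) : cos (2 * pi * (z + n%:R)) = cos (2 * pi * z).
  elim: n z => [|n IH] z; first by rewrite addr0.
  rewrite -(natr1 n) addrA -(IH z) (_ : 2 * pi * (z + n%:R + 1) =
    2 * pi * (z + n%:R) + pi *+ 2) ?cosD2pi //; ring.
move=> /intrP[[n|n] ->]; first exact: nat_case.
by rewrite -[in LHS](nat_case n.+1) NegzE mulrNz addrNK.
Qed.

Lemma sin_pi_eq0 x : sin (pi * x) = 0 -> x \is a Num.int.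
Proof.
have shift (n : nat) (z : R) : `|sin (pi * (z + n%:R))| = `|sin (pi * z)|.
  elim: n z => [|n IH] z; first by rewrite addr0.
  rewrite -(natr1 n) addrA -(IH z) (_ : pi * (z + n%:R + 1) =
    pi * (z + n%:R) + pi); last ring.
  by rewrite sinDpi normrN.
have shiftz (m : int) (z : R) : `|sin (pi * (z + m%:~R))| = `|sin (pi * z)|.
  case: m => n; first exact: shift.
  by rewrite -[in LHS](shift n.+1) NegzE mulrNz addrNK.
move=> sx; have t0 : 0 <= x - (Num.floor x)%:~R by rewrite subr_ge0 floor_le.
have t1 : x - (Num.floor x)%:~R < 1 by rewrite ltrBlDl -intrD1 floorD1_gt.
have [t_eq0|tn0] := eqVneq (x - (Num.floor x)%:~R) 0.
  by rewrite -(subrK (Num.floor x)%:~R x) t_eq0 add0r intr_int.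
have : 0 < sin (pi * (x - (Num.floor x)%:~R)).
  have tp : 0 < x - (Num.floor x)%:~R by rewrite lt_neqAle eq_sym tn0.
  by apply: sin_gt0_pi; rewrite mulr_gt0 ?pi_gt0 //= gtr_pMr ?pi_gt0.
by move=> /lt0r_neq0; rewrite -normr_eq0 -(shiftz (Num.floor x)) subrK sx normr0 eqxx.
Qed.

(** Multiplying by [2 sin (a / 2)] makes a sum of equally spaced cosines
    telescope. *)
Lemma sum_cos_telescope (a b : R) (M : nat) :
  2 * sin (a / 2) * \sum_(k < M) cos (k%:R * a + b) =
  sin (M%:R * a + b - a / 2) - sin (b - a / 2).
Proof.
elim: M => [|M IH]; first by rewrite big_ord0 mulr0 mul0r add0r subrr.
rewrite big_ord_recr /= mulrDr IH.
have -> : M.+1%:R * a + b - a / 2 = (M%:R * a + b) + a / 2.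
  by rewrite -(natr1 M); field.
rewrite (sinD _ (a / 2)) (sinB (_ + _)); ring.
Qed.

Lemma sum_cos_bounded (a b : R) (M : nat) : sin (a / 2) != 0 ->
  `|\sum_(k < M) cos (k%:R * a + b)| <= `|sin (a / 2)|^-1.
Proof.
move=> sa; have := sum_cos_telescope a b M.
move=> /(congr1 (fun z => `|z|)); rewrite !normrM ger0_norm // => E.
rewrite -(ler_pM2l (_ : 0 < 2 * `|sin (a / 2)|)) ?mulr_gt0 ?normr_gt0 // E.
rewrite -mulrA divff ?normr_eq0 // mulr1 (le_trans (ler_normB _ _)) //.
by rewrite -[2](_ : 1 + 1 = 2 :> R) // lerD // sin_max.
Qed.

End Trigonometry.

Section ExponentialSums.
Import mathcomp.real_closed.complex.
Context {R : realType}.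

(* The squared modulus turns the expansion of a product of sums of exponentials
   into a double sum of cosines. *)
Let e (x : R) : R[i] := (cos x +i* sin x)%C.
Let sqmod (z : R[i]) : R := complex.Re z ^+ 2 + complex.Im z ^+ 2.

Lemma prod_cos_expand (J : finType) (x : J -> R) :
  \prod_j (2 + 2 * cos (x j)) =
  \sum_(A : {set J}) \sum_(B : {set J})
    cos (\sum_(j in A) x j - \sum_(j in B) x j).
Proof.
have e0 : e 0 = 1 by rewrite /e cos0 sin0.
have eD y z : e (y + z) = e y * e z.
  by rewrite /e cosD sinD; apply/eqP; rewrite eq_complex /= eqxx /= addrC.
have sqmodM y z : sqmod (y * z) = sqmod y * sqmod z.
  by case: y z => [a b] [c d]; rewrite /sqmod /=; ring.
have sqmod1D y : sqmod (1 + e y) = 2 + 2 * cos y.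
  rewrite /sqmod /e /= add0r sqrrD expr1n mul1r -addrA cos2Dsin2; ring.
have -> : \prod_j (2 + 2 * cos (x j)) = sqmod (\prod_j (e (x j) + 1)).
  elim/big_rec2: _ => [|j y z _ ->]; last by rewrite sqmodM [e _ + 1]addrC sqmod1D.
  by rewrite /sqmod /= expr1n expr0n addr0.
rewrite bigA_distr.
have -> : \sum_(A : {set J}) \prod_j (if j \in A then e (x j) else 1) =
    \sum_(A : {set J}) e (\sum_(j in A) x j).
  apply: eq_bigr => A _; rewrite -big_mkcond /=.
  by elim/big_rec2: _ => [|j y z _ ->]; rewrite ?e0 ?eD.
rewrite /sqmod (raddf_sum (@complex.Re R)) (raddf_sum (@complex.Im R)) /=.
rewrite !expr2 !big_distrlr /= -big_split /=.
apply: eq_bigr => A _; rewrite -big_split; apply: eq_bigr => B _.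
by rewrite cosB.
Qed.

End ExponentialSums.

(** The right-hand side is [#|U|] times the sum of the squares of the sizes of
    the fibres of [w]: this is the Cauchy-Schwarz inequality. *)
Lemma collisions (T U : finType) (w : T -> U) :
  (#|T| ^ 2 <= #|U| * \sum_a \sum_b (w a == w b))%N.
Proof.
pose n u := (\sum_a (w a == u))%N.
have cardT : (#|T| = \sum_u n u)%N.
  rewrite -sum1_card exchange_big; apply: eq_bigr => a _ /=.
  by rewrite (bigD1 (w a)) //= eqxx big1 ?addn0 // => u /negPf; rewrite eq_sym => ->.
have -> : (\sum_a \sum_b (w a == w b) = \sum_u n u ^ 2)%N.
  transitivity (\sum_a n (w a))%N.
    by apply: eq_bigr => a _; apply: eq_bigr => b _; rewrite eq_sym.
  transitivity (\sum_a \sum_u (w a == u) * n u)%N.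
    apply: eq_bigr => a _; rewrite (bigD1 (w a)) //= eqxx mul1n.
    by rewrite big1 ?addn0 // => u /negPf; rewrite eq_sym => ->.
  rewrite exchange_big; apply: eq_bigr => u _ /=.
  by rewrite -big_distrl /= mulnn.
rewrite cardT -(leq_pmul2l (isT : (0 < 2)%N)).
have -> : (2 * (\sum_u n u) ^ 2 = \sum_u \sum_v 2 * (n u * n v))%N.
  rewrite -mulnn big_distrlr /= big_distrr; apply: eq_bigr => u _ /=.
  by rewrite big_distrr.
have -> : (2 * (#|U| * \sum_u n u ^ 2) = \sum_u \sum_v (n u ^ 2 + n v ^ 2))%N.
  under [RHS]eq_bigr do rewrite big_split sum_nat_const /=.
  by rewrite big_split /= sum_nat_const -big_distrr /= addnn mul2n.
by apply: leq_sum => u _; apply: leq_sum => v _; exact: nat_Cauchy.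
Qed.

Lemma exp_beats_poly {R : realType} (n : nat) (d : R) : 0 < d -> d <= 1 ->
  exists p : nat, (p.+1%:R) ^+ n * (1 - d) ^+ p < 1.
Proof.
move=> d0 d1; pose N : R := n.+1%:R.
have N0 : 0 < N by rewrite ltr0n.
have [k kC] : exists k : nat, N ^+ n / d ^+ n.+1 < k.+1%:R.
  exists (Num.bound (N ^+ n / d ^+ n.+1)).
  have /archi_boundP h : 0 <= N ^+ n / d ^+ n.+1.
    by rewrite divr_ge0 // exprn_ge0 // ltW.
  by rewrite (lt_trans h) // ltr_nat.
(* By Bernoulli's inequality [(1 - d) ^ k] is of order [1 / k], and its power of
   exponent [n + 1] beats [k ^ n]. *)
exists (n.+1 * k)%N.
have k0 : 0 < k.+1%:R :> R by rewrite ltr0n.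
have dk : (1 - d) ^+ k * (1 + k%:R * d) <= 1.
  have bern : 1 + k%:R * d <= (1 + d) ^+ k.
    elim: k {kC k0} => [|k IH]; first by rewrite mul0r addr0 expr0.
    rewrite exprS (le_trans _ (ler_wpM2l _ IH)) ?addr_ge0 ?(ltW d0) //.
    rewrite -(natr1 k) mulrDl mul1r mulrDr mulr1 mulrDl mul1r.
    have : 0 <= d * (k%:R * d) by rewrite !mulr_ge0 // ltW.
    lra.
  apply: le_trans (ler_wpM2l _ bern) _; first by rewrite exprn_ge0 ?subr_ge0.
  rewrite -exprMn exprn_ile1 //; nra.
have dk1 : (1 - d) ^+ k <= (d * k.+1%:R)^-1.
  rewrite -[leRHS]mul1r ler_pdivlMr ?mulr_gt0 //.
  apply: le_trans (ler_wpM2l _ _) dk; first by rewrite exprn_ge0 ?subr_ge0.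
  rewrite -(natr1 k); nra.
have -> : (1 - d) ^+ (n.+1 * k) = ((1 - d) ^+ k) ^+ n.+1 by rewrite mulnC exprM.
have lt1 : ((n.+1 * k).+1%:R : R) <= N * k.+1%:R.
  by rewrite -natrM ler_nat; lia.
apply: (@le_lt_trans _ _ ((N * k.+1%:R) ^+ n * ((d * k.+1%:R)^-1) ^+ n.+1)).
  have K0 : 0 <= (1 - d) ^+ k by rewrite exprn_ge0 ?subr_ge0.
  have dK0 : 0 <= (d * k.+1%:R)^-1 by rewrite invr_ge0 mulr_ge0 // ltW.
  have NK0 : 0 <= N * k.+1%:R by rewrite mulr_ge0 // ltW.
  apply: ler_pM; [exact: exprn_ge0|exact: exprn_ge0| |].
    by rewrite lerXn2r ?nnegrE.
  by rewrite lerXn2r ?nnegrE.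
rewrite exprVn ltr_pdivrMr ?exprn_gt0 ?mulr_gt0 // mul1r !exprMn.
rewrite ltr_pdivrMr ?exprn_gt0 // in kC.
rewrite [k.+1%:R ^+ n.+1]exprSr mulrCA mulrC [d ^+ _ * _]mulrC mulrC.
by rewrite [N ^+ n * _]mulrC ltr_pM2l ?exprn_gt0.
Qed.

(** * Kronecker's theorem for characters of the rational numbers *)

Ltac int_ring h :=
  let H := fresh in have H := h;
  match type of H with is_true (in_mem ?a _) =>
    match goal with |- is_true (in_mem ?b _) =>
      rewrite (_ : b = a); [exact: H | ring] end end.

(** Homomorphisms to the circle [R / Z] are represented by real functions that
    are additive modulo integers. *)
Definition additive_mod_int {R : realType} {G : zmodType} (g : G -> R) :=
  forall q r, g (q + r) - (g q + g r) \is a Num.int.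

Section AdditiveModInt.
Context {R : realType} {G : zmodType} (g : G -> R).
Hypothesis gA : additive_mod_int g.

Lemma additive_mod_int0 : g 0 \is a Num.int.
Proof. by have := gA 0 0; rewrite addr0 opprD addNKr rpredN. Qed.

Lemma additive_mod_intN q : g (- q) + g q \is a Num.int.
Proof.
have := rpredB additive_mod_int0 (gA (- q) q).
by rewrite addNr opprB addrC subrK.
Qed.

Lemma additive_mod_int_mulrn q n : g (q *+ n) - n%:R * g q \is a Num.int.
Proof.
elim: n => [|n IH]; first by rewrite mulr0n mul0r subr0 additive_mod_int0.
rewrite mulrS -(natr1 n); int_ring (rpredD (gA q (q *+ n)) IH).
Qed.

Lemma additive_mod_int_mulrz q (m : int) : g (q *~ m) - m%:~R * g q \is a Num.int.
Proof.
case: m => n; first exact: additive_mod_int_mulrn.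
rewrite NegzE !mulrNz.
int_ring (rpredB (additive_mod_intN (q *+ n.+1)) (additive_mod_int_mulrn q n.+1)).
Qed.

End AdditiveModInt.

Lemma additive_mod_int_sum {R : realType} {G : zmodType} (n : nat)
    (g : 'I_n -> G -> R) (m : 'I_n -> int) :
  (forall i, additive_mod_int (g i)) ->
  additive_mod_int (fun q => \sum_i (m i)%:~R * g i q).
Proof.
move=> gA q r; rewrite -big_split -sumrB rpred_sum // => i _ /=.
by rewrite -mulrDr -mulrBr rpredM ?intr_int ?gA.
Qed.

Lemma rat_common_denominator (q : rat) (N : nat) : (0 < N)%N ->
  (`|denq q| %| N)%N -> exists k : int, q = (N%:R)^-1 *~ k.
Proof.
move=> N0 /dvdnP[d Nd]; exists (numq q * d%:Z).
have dq0 : (denq q)%:~R != 0 :> rat by rewrite intr_eq0 denq_eq0.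
have NE : N%:R = d%:R * (denq q)%:~R :> rat.
  by rewrite Nd natrM natr_absz gtr0_norm ?denq_gt0.
have N0' : N%:R != 0 :> rat by rewrite pnatr_eq0 -lt0n.
rewrite -mulrzr intrM mulrC -[LHS]divq_num_den -pmulrn; apply: (mulIf N0').
rewrite mulfVK // NE mulrCA mulfVK //; ring.
Qed.

(** Kronecker's density theorem: targets compatible with all integer relations
    between finitely many characters of [rat] can be approximated
    simultaneously.  If they could not be, then [\prod_i (2 + 2 cos x_i)], with
    [x_i] the phase between the [i]-th character and its target, would be bounded away from its
    maximum, so that the average of its [p]-th power along the multiples of
    some [1 / N] would decay exponentially.  But that power is a sum of
    cosines of integer combinations of the [x_i]; those of nontrivial
    characters average to [0], and the others, all equal to [1], are
    polynomially frequent by [collisions]. *)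
Theorem kronecker {R : realType} (n : nat) (g : 'I_n -> rat -> R)
    (y : 'I_n -> R) (eps : R) :
  (forall i, additive_mod_int (g i)) ->
  (forall m : 'I_n -> int,
    (forall q, \sum_i (m i)%:~R * g i q \is a Num.int) ->
    \sum_i (m i)%:~R * y i \is a Num.int) ->
  0 < eps ->
  exists q, forall i, 1 - eps < cos (2 * pi * (g i q - y i)).
Proof.
move=> gA rel eps0; apply: contrapT => noq.
have {noq} far q : exists i, cos (2 * pi * (g i q - y i)) <= 1 - eps.
  apply: contrapT => h; apply: noq; exists q => i.
  by rewrite ltNge; apply/negP => le; apply: h; exists i.
have [i0 _] := far 0.
have eps2 : eps <= 2.
  by have [i hi] := far 0; have := cos_geN1 (2 * pi * (g i 0 - y i)); lra.
have d0 : 0 < eps / 2 by lra.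
have d1 : eps / 2 <= 1 by lra.
have [p hp] := exp_beats_poly n d0 d1.
pose J : finType := ('I_n * 'I_p)%type.
(* A subset of [J] selects [c A i] of the [p] factors of index [i]; [chi A B] and
   [Y A B] are the character and the target in the cosine that [A] and [B]
   contribute. *)
pose c (A : {set J}) (i : 'I_n) : nat := #|[pred k | (i, k) \in A]|.
have cp A i : (c A i < p.+1)%N by rewrite ltnS -[leqRHS]card_ord max_card.
pose w (A : {set J}) : {ffun 'I_n -> 'I_p.+1} := [ffun i => Ordinal (cp A i)].
pose nu (A B : {set J}) i : int := (c A i)%:Z - (c B i)%:Z.
pose chi A B q : R := \sum_i (nu A B i)%:~R * g i q.
pose Y A B : R := \sum_i (nu A B i)%:~R * y i.
have chiA A B : additive_mod_int (chi A B) by exact: additive_mod_int_sum.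
pose trivial A B := `[< forall q, chi A B q \is a Num.int >].
(* [N] is such that no nontrivial [chi A B] is trivial on the multiples of
   [1 / N]. *)
pose wit (AB : {set J} * {set J}) : rat :=
  xget 0 [set q | ~~ (chi AB.1 AB.2 q \is a Num.int)].
pose N := (\prod_AB `|denq (wit AB)|)%N.
have N0 : (0 < N)%N.
  by apply: prodn_gt0 => AB; rewrite lt0n absz_eq0 denq_eq0.
have chiN A B : ~~ trivial A B -> ~~ (chi A B (N%:R)^-1 \is a Num.int).
  move=> /asboolPn/existsNP[q /negP chiq].
  have : ~~ (chi A B (wit (A, B)) \is a Num.int).
    by rewrite /wit; case: xgetP => [r -> //|/(_ q)] /=; case.
  apply: contra => chi1.
  have [|k ->] := @rat_common_denominator (wit (A, B)) N N0.
    by rewrite /N (bigD1 (A, B)) //= dvdn_mulr.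
  rewrite -[chi A B _](subrK (k%:~R * chi A B (N%:R)^-1)).
  by rewrite rpredD ?rpredM ?intr_int ?additive_mod_int_mulrz.
pose T A B (M : nat) : R :=
  \sum_(k < M) cos (2 * pi * (chi A B ((N%:R)^-1 *+ k) - Y A B)).
pose C A B : R := `|sin (2 * pi * chi A B (N%:R)^-1 / 2)|^-1.
have TE A B M : T A B M = \sum_(k < M)
    cos (k%:R * (2 * pi * chi A B (N%:R)^-1) + (- 2 * pi * Y A B)).
  apply: eq_bigr => k _.
  rewrite (_ : chi A B _ - _ = (k%:R * chi A B (N%:R)^-1 - Y A B) +
    (chi A B ((N%:R)^-1 *+ k) - k%:R * chi A B (N%:R)^-1)); last by ring.
  by rewrite cos_shift_int ?additive_mod_int_mulrn //; congr cos; ring.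
have Ttriv A B M : trivial A B -> T A B M = M%:R.
  move=> /asboolP tr; rewrite -[RHS]mulr1 -[M in RHS]card_ord mulr_natl -sumr_const.
  apply: eq_bigr => k _; rewrite addrC cos_shift_int // -[- _]add0r.
  by rewrite cos_shift_int ?mulr0 ?cos0 // rpredN; exact: rel.
have C0 A B : 0 <= C A B by rewrite invr_ge0.
have Tnon A B M : ~~ trivial A B -> - C A B <= T A B M.
  move=> /chiN ntr; have s0 : sin (2 * pi * chi A B (N%:R)^-1 / 2) != 0.
    apply: contra ntr => /eqP s0; apply: sin_pi_eq0.
    by rewrite -[RHS]s0; move: (chi A B _) => z; congr sin; field.
  by have := @sum_cos_bounded R _ (- 2 * pi * Y A B) M s0; rewrite -TE ler_norml => /andP[].
have Tlow A B M : (w A == w B)%:R * M%:R - C A B <= T A B M.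
  have [tr|ntr] := boolP (trivial A B).
    rewrite Ttriv //; have [_|_] := eqVneq (w A) (w B).
      by rewrite mul1r gerBl C0.
    by rewrite mul0r sub0r (le_trans _ (ler0n _ _)) // oppr_le0.
  suff /negPf-> : w A != w B by rewrite mul0r sub0r Tnon.
  apply: contra ntr => /eqP wAB; apply/asboolP => q.
  rewrite /chi big1 ?rpred0 // => i _; have /(congr1 (fun f : {ffun 'I_n -> 'I_p.+1} => val (f i))) := wAB.
  by rewrite /nu !ffunE /= => ->; rewrite subrr mul0r.
pose x q i := 2 * pi * (g i q - y i).
have expand q : (\prod_i (2 + 2 * cos (x q i))) ^+ p =
    \sum_A \sum_B cos (2 * pi * (chi A B q - Y A B)).
  transitivity (\prod_(j : J) (2 + 2 * cos (x q j.1))).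
    rewrite -(pair_bigA _ (fun i k => 2 + 2 * cos (x q i))) /= -prodrXl.
    by apply: eq_bigr => i _; rewrite prodr_const card_ord.
  rewrite prod_cos_expand; apply: eq_bigr => A _; apply: eq_bigr => B _.
  have sumE (D : {set J}) : \sum_(j in D) x q j.1 = \sum_i (c D i)%:R * x q i.
    transitivity (\sum_i \sum_k (if (i, k) \in D then x q i else 0)).
      by rewrite big_mkcond pair_bigA; apply: eq_bigr => -[].
    apply: eq_bigr => i _; rewrite -big_mkcond /= sumr_const mulr_natl.
    congr (_ *+ _); rewrite /c; by apply: eq_card => k; rewrite !inE.
  congr cos; rewrite !sumE -sumrB /chi /Y -sumrB big_distrr; apply: eq_bigr => i _ /=.
  by rewrite /nu /x intrB -!pmulrn; ring.
have up q : (\prod_i (2 + 2 * cos (x q i))) ^+ p <= (4 ^+ n * (1 - eps / 2)) ^+ p.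
  have [i hi] := far q; have term0 j : 0 <= 2 + 2 * cos (x q j) <= 4.
    by have := cos_geN1 (x q j); have := cos_le1 (x q j); lra.
  have P0 : 0 <= \prod_j (2 + 2 * cos (x q j)).
    by apply: prodr_ge0 => j _; case/andP: (term0 j).
  rewrite lerXn2r ?nnegrE //; first by rewrite mulr_ge0 ?exprn_ge0 ?subr_ge0.
  rewrite (bigD1 i) //= mulrC.
  have -> : 4 ^+ n = 4 ^+ n.-1 * 4 :> R by rewrite -exprSr prednK // (leq_trans _ (ltn_ord i)).
  rewrite -mulrA; apply: ler_pM.
  - by apply: prodr_ge0 => j _; case/andP: (term0 j).
  - by case/andP: (term0 i).
  - have : \prod_(j | j != i) (2 + 2 * cos (x q j)) <= \prod_(j | j != i) 4.
      by apply: ler_prod => j _; exact: term0.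
    by rewrite prodr_const cardC1 card_ord.
  - rewrite /x; lra.
pose Z : R := (\sum_A \sum_B (w A == w B))%N%:R.
pose K : R := (p.+1)%:R ^+ n.
have K0 : 0 < K by rewrite exprn_gt0 // ltr0n.
have KZ : 4 ^+ n ^+ p <= K * Z.
  rewrite -exprM -natrX /K /Z -natrX -natrM ler_nat.
  have -> : (4 ^ (n * p) = #|{set J}| ^ 2)%N.
    rewrite (_ : #|{set J}| = 2 ^ #|J|)%N; last first.
      by rewrite -[in RHS]cardsT -card_powerset powersetT cardsT.
    by rewrite card_prod !card_ord -expnM (mulnC _ 2%N) (expnM 2).
  by have := collisions w; rewrite card_ffun !card_ord.
pose h : R := K * (1 - eps / 2) ^+ p.
pose Q : R := 4 ^+ n ^+ p.
have Q0 : 0 < Q by rewrite !exprn_gt0.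
pose Ctot := \sum_A \sum_B C A B.
have bound M : M%:R * (Q * (1 - h)) <= K * Ctot.
  have S1 : Z * M%:R - Ctot <= \sum_A \sum_B T A B M.
    rewrite /Z /Ctot natr_sum mulr_suml -sumrB ler_sum // => A _.
    by rewrite natr_sum mulr_suml -sumrB ler_sum // => B _; exact: Tlow.
  have S2 : \sum_A \sum_B T A B M <= M%:R * (Q * (1 - eps / 2) ^+ p).
    have -> : \sum_A \sum_B T A B M =
        \sum_(k < M) (\prod_i (2 + 2 * cos (x ((N%:R)^-1 *+ k) i))) ^+ p.
      under [RHS]eq_bigr do rewrite expand.
      rewrite [RHS]exchange_big; apply: eq_bigr => A _.
      by rewrite [RHS]exchange_big.
    rewrite (_ : M%:R * _ = \sum_(k < M) Q * (1 - eps / 2) ^+ p); last first.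
      by rewrite sumr_const card_ord mulr_natl.
    by apply: ler_sum => k _; rewrite -exprMn up.
  have := le_trans S1 S2; rewrite -(ler_pM2l K0) /h.
  have := ler_wpM2r (ler0n R M) KZ; rewrite -/Q.
  nra.
have [M hM] : exists M : nat, K * Ctot < M%:R * (Q * (1 - h)).
  have pos : 0 < Q * (1 - h) by rewrite mulr_gt0 // subr_gt0.
  exists (Num.bound (K * Ctot / (Q * (1 - h)))); rewrite -ltr_pdivrMr //.
  apply: archi_boundP; rewrite divr_ge0 ?(ltW pos) // mulr_ge0 ?(ltW K0) //.
  by apply: sumr_ge0 => A _; apply: sumr_ge0.
by have := bound M; rewrite leNgt hM.
Qed.

(** * Bogolyubov's lemma in cyclic groups *)

Section Bogolyubov.
Context {R : realType}.

Lemma sin_shift_int (x y : R) : x \is a Num.int ->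
  sin (2 * pi * (y + x)) = sin (2 * pi * y).
Proof.
move=> xZ; rewrite -!cosBpihalf.
have pi0 : pi != 0 :> R by rewrite gt_eqF ?pi_gt0.
rewrite (_ : _ - _ = 2 * pi * ((y - 1 / 4) + x)); last by field.
by rewrite cos_shift_int //; congr cos; field.
Qed.

Variable L' : nat.
Let L := L'.+1.

(** Orthogonality of the characters of the cyclic group of order [L]. *)
Lemma sum_cos_cyclic (n : int) : ~~ (L%:Z %| n)%Z ->
  \sum_(k < L) cos (2 * pi * (n%:~R * k%:R / L%:R)) = 0 :> R.
Proof.
move=> Ln; have L0 : L%:R != 0 :> R by rewrite pnatr_eq0.
pose a : R := 2 * pi * (n%:~R / L%:R).
have sa : 2 * sin (a / 2) != 0.
  rewrite mulf_neq0 ?pnatr_eq0 //; apply: contra Ln => /eqP s0.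
  have : n%:~R / L%:R \is a @Num.int R.
    by apply: sin_pi_eq0; rewrite -[RHS]s0 /a; congr sin; field; rewrite L0.
  move=> /intrP[m mE]; apply/dvdzP; exists m; apply/eqP; rewrite -(eqr_int R).
  by rewrite intrM -mE -pmulrn divfK.
apply: (mulfI sa); rewrite mulr0.
transitivity (2 * sin (a / 2) * \sum_(k < L) cos (k%:R * a + 0)).
  by congr (_ * _); apply: eq_bigr => k _; congr cos; rewrite /a; field.
rewrite sum_cos_telescope addr0 add0r sinN opprK.
have -> : L%:R * a - a / 2 = 2 * pi * (- (n%:~R / L%:R / 2) + n%:~R).
  by rewrite /a; field.
rewrite sin_shift_int ?intr_int // mulrN sinN addrC; apply/eqP.
by rewrite subr_eq0; apply/eqP; congr sin; rewrite /a; field.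
Qed.

Variable A : {set 'I_L}.
Hypothesis A0 : (0 < #|A|)%N.

Let ch (n : int) (k : 'I_L) : R := cos (2 * pi * (n%:~R * (k : nat)%:R / L%:R)).
(* The squared modulus of the [k]-th Fourier coefficient of [A]. *)
Let D (k : 'I_L) : R := \sum_(a in A) \sum_(b in A) ch (a%:Z - b%:Z) k.
Let card : R := #|A|%:R.
Let tau : R := card ^+ 3 / L%:R.

Definition large_frequencies := [pred k : 'I_L | tau <= D k].

Let L0 : 0 < L%:R :> R. Proof. by rewrite ltr0n. Qed.
Let card0 : 0 < card. Proof. by rewrite ltr0n. Qed.

Let D_ge0 k : 0 <= D k.
Proof.
have -> : D k = (\sum_(a in A) ch a k) ^+ 2 +
    (\sum_(a in A) sin (2 * pi * (a%:R * (k : nat)%:R / L%:R))) ^+ 2.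
  rewrite !expr2 !big_distrlr -big_split /=; apply: eq_bigr => a _.
  rewrite -big_split; apply: eq_bigr => b _ /=; rewrite /ch -cosB intrB.
  by congr cos; rewrite -!pmulrn; ring.
by rewrite addr_ge0 ?sqr_ge0.
Qed.

Let sum_ch0 (n : int) : ~~ (L%:Z %| n)%Z -> \sum_k ch n k = 0.
Proof. exact: sum_cos_cyclic. Qed.

Let ch0 k : ch 0 k = 1.
Proof. by rewrite /ch mul0r mul0r mulr0 cos0. Qed.

Let sum_D : \sum_k D k = L%:R * card.
Proof.
rewrite exchange_big /= /card -sum1_card natr_sum big_distrr; apply: eq_bigr => a aA.
have e1 : \sum_k ch 0 k = L%:R.
  by under eq_bigr do rewrite ch0; rewrite sumr_const card_ord.
rewrite exchange_big /= (bigD1 a) //= subrr e1 big1 ?addr0 ?mulr1 // => b /andP[_ ba].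
apply: sum_ch0; apply: contra ba => /dvdzP[m abm]; apply/eqP/val_inj => /=.
move: abm (ltn_ord a) (ltn_ord b); move: (nat_of_ord a) (nat_of_ord b) => u v.
rewrite -/L => uvm uL vL; have [m1|m1|m1] := ltrgtP m 0; [|nia..].
have : m * L%:Z <= - L%:Z by nia.
by lia.
Qed.

(** The squared moduli of the Fourier coefficients add up to [L * #|A|]. *)
Lemma card_large_frequencies : (#|large_frequencies| * #|A| ^ 2 <= L ^ 2)%N.
Proof.
have : #|large_frequencies|%:R * tau <= L%:R * card.
  rewrite -sum_D mulr_natl -sumr_const.
  apply: (@le_trans _ _ (\sum_(k in large_frequencies) D k)).
    by apply: ler_sum => k; rewrite inE.
  by rewrite [leRHS](bigID (mem large_frequencies)) /= lerDl sumr_ge0.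
rewrite /tau mulrA ler_pdivrMr // => h.
rewrite -(ler_nat R) natrM !natrX -(ler_pM2r card0).
rewrite (_ : _ * _ * card = #|large_frequencies|%:R * card ^+ 3); last first.
  by rewrite -/card; ring.
by rewrite (le_trans h) // mulrAC expr2.
Qed.

(** Bogolyubov's lemma: the elements [x] at which all large frequencies of [A]
    have nonnegative real part are sums of two elements of [A] minus two
    others, because the number of such decompositions of [x] is a Fourier
    series in which these frequencies dominate. *)
Lemma bogolyubov (x : int) :
  (forall k, k \in large_frequencies -> 0 <= ch x k) ->
  exists a b c d, [/\ a \in A, b \in A, c \in A & d \in A] /\
    (L%:Z %| a%:Z + b%:Z - c%:Z - d%:Z - x)%Z.
Proof.
move=> xlarge; apply: contrapT => none.
have nodvd a b c d : a \in A -> b \in A -> c \in A -> d \in A ->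
    ~~ (L%:Z %| a%:Z + b%:Z - c%:Z - d%:Z - x)%Z.
  by move=> aA bA cA dA; apply/negP => h; apply: none; exists a, b, c, d.
have sum0 : \sum_k D k ^+ 2 * ch x k = 0.
  transitivity (\sum_k \sum_(a in A) \sum_(b in A) \sum_(c in A) \sum_(d in A)
      ch (a%:Z - b%:Z) k * ch (c%:Z - d%:Z) k * ch x k).
    apply: eq_bigr => k _; rewrite expr2 mulr_suml mulr_suml.
    apply: eq_bigr => a _; rewrite mulr_suml mulr_suml; apply: eq_bigr => b _.
    rewrite /D mulr_sumr mulr_suml; apply: eq_bigr => c _.
    by rewrite mulr_sumr mulr_suml.
  rewrite exchange_big big1 // => a aA; rewrite exchange_big big1 // => b bA.
  rewrite exchange_big big1 // => c cA; rewrite exchange_big big1 // => d dA.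
  have prod3 (u v w : int) k : ch u k * ch v k * ch w k =
      4^-1 * (ch (u + v + w) k + ch (u + v - w) k + ch (u - v + w) k + ch (u - v - w) k).
    have chE n : ch n k = cos (n%:~R * (2 * pi * ((k : nat)%:R / L%:R))).
      by rewrite /ch; congr cos; ring.
    rewrite !chE; move: (2 * pi * _) => t.
    by rewrite !(intrD, mulrNz, mulrDl, mulNr) !(cosD, cosN, sinD, sinN); field.
  rewrite (eq_bigr _ (fun k _ => prod3 _ _ _ k)) -big_distrr /= !big_split /=.
  rewrite !sum_ch0 ?addr0 ?mulr0 //.
  - apply: contra (nodvd _ _ _ _ aA dA bA cA).
    by rewrite (_ : _ - x = a%:Z + d%:Z - b%:Z - c%:Z - x) //; ring.
  - apply: contra (nodvd _ _ _ _ bA cA aA dA); rewrite -rpredN.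
    by rewrite (_ : - (_ + x) = b%:Z + c%:Z - a%:Z - d%:Z - x) //; ring.
  - apply: contra (nodvd _ _ _ _ aA cA bA dA).
    by rewrite (_ : _ - x = a%:Z + c%:Z - b%:Z - d%:Z - x) //; ring.
  - apply: contra (nodvd _ _ _ _ bA dA aA cA); rewrite -rpredN.
    by rewrite (_ : - (_ + x) = b%:Z + d%:Z - a%:Z - c%:Z - x) //; ring.
have tauL : tau * (L%:R * card) = card ^+ 4 by rewrite /tau; field; rewrite gt_eqF.
have tau0 : 0 < tau by rewrite divr_gt0 // exprn_gt0.
have D0 : D ord0 = card ^+ 2.
  rewrite /D (eq_bigr (fun=> card)) => [|a _].
    by rewrite sumr_const -/card -mulr_natr expr2.
  rewrite (eq_bigr (fun=> 1)) ?sumr_const // => b _.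
  by rewrite /ch /= mulr0 mul0r mulr0 cos0.
have low : \sum_k (- tau * D k + (k == ord0)%:R * (card ^+ 4 + tau * card ^+ 2)) <= 0.
  rewrite -[leRHS]sum0; apply: ler_sum => k _.
  have [->|k0] := eqVneq k ord0.
    rewrite D0 /= (_ : ch x ord0 = 1) ?/ch /= ?mulr0 ?mul0r ?mulr0 ?cos0 //.
    by rewrite le_eqVlt; apply/orP; left; apply/eqP; ring.
  rewrite mul0r addr0; have [kL|kL] := boolP (k \in large_frequencies).
    apply: (@le_trans _ _ 0); last by rewrite mulr_ge0 ?sqr_ge0 ?xlarge.
    by rewrite mulNr oppr_le0 mulr_ge0 // ltW.
  have Dk : D k <= tau by move: kL; rewrite inE -ltNge => /ltW.
  have h1 : 0 <= D k ^+ 2 * (1 + ch x k).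
    by rewrite mulr_ge0 ?sqr_ge0 // -lerBlDl sub0r cos_geN1.
  have h2 : 0 <= D k * (tau - D k) by rewrite mulr_ge0 ?subr_ge0.
  by nra.
move: low; rewrite big_split /= -big_distrr /= sum_D mulNr tauL (bigD1 ord0) //= mul1r.
rewrite big1 => [|k /negPf ->]; last by rewrite mul0r.
by rewrite addr0 addKr leNgt mulr_gt0 ?exprn_gt0.
Qed.

End Bogolyubov.

(** * Bogolyubov's theorem for the rational numbers *)

Lemma ultra_cvg_compact (I : Type) (G : set_system I) (T : topologicalType)
    (K : set T) (u : I -> T) : UltraFilter G -> compact K ->
  (\forall i \near G, K (u i)) -> exists2 l, K l & u @ G --> l.
Proof.
move=> GU cK GK; have [l [Kl cl]] := cK (u @ G) _ GK.
exists l => // V lV; have [//|GnV] := in_ultra_setVsetC (u @^-1` V) GU.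
by have [x [nVx Vx]] := cl (~` V) V GnV lV.
Qed.

(** The largest colour class among the [k / F], [k < L0], is read as a subset of
    density at least [1 / 4 M] of a cyclic group of order [4 * L0], large enough
    for congruences between sums of four elements to be equalities;
    [bogolyubov] then applies, and there are at most [16 * M ^ 2] large
    frequencies whatever [L0] is. *)
Lemma bohr_finite {R : realType} (M : nat) (kappa : rat -> 'I_M) (F L0 : nat) :
  (0 < L0)%N ->
  exists t : 'I_(16 * M ^ 2) -> R, forall x : int, (`|x| <= L0)%N ->
    (forall j, 0 <= cos (2 * pi * (x%:~R * t j))) ->
    exists a b c d, [/\ a + b - c - d = x%:~R / F%:R, kappa a = kappa b,
      kappa a = kappa c & kappa a = kappa d].
Proof.
move=> L00; pose L' := (4 * L0).-1.
have LE : L'.+1 = (4 * L0)%N by rewrite prednK ?muln_gt0.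
pose pt (k : nat) : rat := k%:R / F%:R.
pose A i : {set 'I_L'.+1} := finset (fun k : 'I_L'.+1 => (k < L0)%N && (kappa (pt k) == i)).
have [i Ai] : exists i, (L0 <= #|A i| * M)%N.
  apply: contrapT => none.
  have lt_i i : (#|A i| * M < L0)%N by rewrite ltnNge; apply/negP => h; apply: none; exists i.
  have sumA : (\sum_i #|A i| = L0)%N.
    transitivity (\sum_i \sum_(k < L'.+1) ((k < L0) && (kappa (pt k) == i)))%N.
      apply: eq_bigr => i _; rewrite -sum1_card big_mkcond; apply: eq_bigr => k _.
      by rewrite inE; case: ifP.
    rewrite exchange_big /=.
    transitivity (\sum_(k < L'.+1) (k < L0))%N.
      apply: eq_bigr => k _; rewrite (bigD1 (kappa (pt k))) //= eqxx andbT.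
      by rewrite big1 ?addn0 // => j /negPf; rewrite eq_sym => ->; rewrite andbF.
    rewrite -(big_mkord xpredT (fun k => (k < L0 : nat))%N) LE.
    rewrite (big_cat_nat _ (n := L0)) //=; last by lia.
    rewrite [X in (_ + X)%N]big_nat_cond [X in (_ + X)%N]big1; last first.
      by move=> k /andP[/andP[h _] _]; rewrite ltnNge h.
    rewrite addn0 big_nat_cond (eq_bigr (fun=> 1%N)); last first.
      by move=> k /andP[/andP[_ ->]].
    by rewrite -big_nat_cond sum_nat_const_nat subn0 muln1.
  have : (\sum_i (#|A i| * M) < \sum_(i < M) L0)%N.
    have M0 : (0 < M)%N by case: (kappa 0) => m /(leq_trans _); exact.
    rewrite (bigD1 (kappa 0)) //= [ltnRHS](bigD1 (kappa 0)) //=.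
    by rewrite -addSn leq_add // leq_sum // => j _; exact: ltnW.
  by rewrite -big_distrl /= sumA sum_nat_const card_ord mulnC ltnn.
have A0 : (0 < #|A i|)%N by rewrite lt0n; apply: contraTneq Ai => ->; rewrite -ltnNge.
pose Lam := enum (large_frequencies (R := R) (A i)).
have Lam_size : (size Lam <= 16 * M ^ 2)%N.
  have h : (size Lam * #|A i| ^ 2 <= (4 * L0) ^ 2)%N.
    by rewrite -[in leqRHS]LE -[size Lam]cardE card_large_frequencies.
  have : (size Lam * L0 ^ 2 <= (16 * M ^ 2) * L0 ^ 2)%N.
    apply: (@leq_trans (size Lam * (#|A i| * M) ^ 2)).
      by rewrite leq_mul2l leq_exp2r // Ai orbT.
    rewrite expnMn mulnA; apply: leq_trans (leq_mul h (leqnn _)) _.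
    by rewrite expnMn -mulnA (mulnC (L0 ^ 2)%N) mulnA.
  by rewrite leq_pmul2r // expn_gt0 L00.
exists (fun j => (nth ord0 Lam j : nat)%:R / (L'.+1)%:R) => x xL0 hx.
have [k kL|a [b [c [d [[aA bA cA dA]]]]]] := @bogolyubov R L' (A i) A0 x.
  have kLam : k \in Lam by rewrite mem_enum.
  have js : (index k Lam < 16 * M ^ 2)%N by rewrite (leq_trans _ Lam_size) ?index_mem.
  by rewrite -(mulrA x%:~R); have := hx (Ordinal js); rewrite /= nth_index.
move: aA bA cA dA; rewrite !inE => /andP[aL /eqP ka] /andP[bL /eqP kb] /andP[cL /eqP kc]
  /andP[dL /eqP kd] /dvdzP[m hm].
exists (pt a), (pt b), (pt c), (pt d); split; rewrite ?ka //.
have -> : x = a%:Z + b%:Z - c%:Z - d%:Z.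
  move: hm xL0 aL bL cL dL.
  move: (nat_of_ord a) (nat_of_ord b) (nat_of_ord c) (nat_of_ord d) => u v w z.
  rewrite LE => hm xL0 uL vL wL zL; have m0 : m = 0 by nia.
  by move: hm; rewrite m0 mul0r => /eqP; lia.
by rewrite /pt !intrD !mulrNz -!pmulrn; ring.
Qed.

Definition frac {R : realType} (x : R) := x - (Num.floor x)%:~R.

Lemma frac_itv {R : realType} (x : R) : frac x \in `[0, 1].
Proof.
rewrite in_itv /= subr_ge0 floor_le /= lerBlDl ltW //.
by rewrite -intrD1 floorD1_gt.
Qed.

Lemma additive_mod_int_frac {R : realType} (G : zmodType) (g : G -> R) :
  {morph g : q r / q + r} -> additive_mod_int (fun q => frac (g q)).
Proof.
move=> gD q r; rewrite gD /frac.
have h : (Num.floor (g q))%:~R + (Num.floor (g r))%:~R - (Num.floor (g q + g r))%:~R \is a @Num.int R.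
  by rewrite -intrD -intrB intr_int.
int_ring h.
Qed.

Lemma cvg_int {R : realType} (I : Type) (G : set_system I) {GG : ProperFilter G}
    (h : I -> R) (l : R) :
  h @ G --> l -> (forall i, h i \is a Num.int) -> l \is a Num.int.
Proof.
move=> hl hZ; apply: sin_pi_eq0.
have c : (fun i => sin (pi * h i)) @ G --> sin (pi * l).
  have ct : {for l, continuous (fun x => sin (pi * x))}.
    apply: (@continuous_comp _ _ _ (fun x => pi * x) sin); first exact: mulrl_continuous.
    exact: continuous_sin.
  exact: (continuous_cvg _ ct hl).
rewrite -(cvg_lim (@Rhausdorff R) c).
have sin_int x : x \is a Num.int -> sin (pi * x) = 0 :> R.
  move=> xZ; have := sin_shift_int (0 : R) xZ.
  have := cos_shift_int (0 : R) xZ; rewrite add0r mulr0 cos0 => c1 _.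
  have : cos (pi * x *+ 2) = 1 by rewrite -c1; congr cos; rewrite mulr2n; ring.
  rewrite cos_mulr2n => e; apply/eqP; rewrite -sqrf_eq0 sin2cos2; apply/eqP.
  by move: e; rewrite mulr2n; lra.
under eq_fun do rewrite sin_int //.
exact: lim_cst.
Qed.

(** Bogolyubov's theorem on [rat]: finite characters that are all close to [0]
    only at differences [a + b - c - d] within one colour.  They are limits,
    along an ultrafilter, of the ones [bohr_finite] provides on the arithmetic
    progressions of step [1 / n!]; their number is bounded independently of
    [n]. *)
Theorem bohr_coloring {R : realType} (M : nat) (kappa : rat -> 'I_M) :
  exists m (g : 'I_m -> rat -> R), (forall i, additive_mod_int (g i)) /\
    forall q, (forall i, 0 < cos (2 * pi * g i q)) ->
      exists a b c d, [/\ a + b - c - d = q, kappa a = kappa b,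
        kappa a = kappa c & kappa a = kappa d].
Proof.
have L0pos n : (0 < n.+1 * n.+1`!)%N by rewrite muln_gt0 fact_gt0.
have /choice[t tP] n := @bohr_finite R M kappa n.+1`! _ (L0pos n).
pose m := (16 * M ^ 2)%N.
have [G [GU leG]] := @ultraFilterLemma nat \oo _.
pose gn i q n := frac (ratr q * (n.+1`!%:R * t n i)).
have ex_lim (iq : 'I_m * rat) : exists l : R, gn iq.1 iq.2 @ G --> l.
  case: iq => i q; have itv : \forall n \near G, `[0, 1]%classic (gn i q n).
    by apply: filterE => n /=; exact: frac_itv.
  have [l _ ul] := ultra_cvg_compact GU (@segment_compact R 0 1) itv.
  by exists l.
have [g gP] := @boolp.choice _ _ (fun (iq : 'I_m * rat) (l : R) => gn iq.1 iq.2 @ G --> l) ex_lim.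
exists m, (fun i q => g (i, q)); split=> [i q r|q hq].
  pose h n := gn i (q + r) n - (gn i q n + gn i r n).
  apply: (@cvg_int R _ G _ h); last first.
    move=> n; apply: (@additive_mod_int_frac R rat (fun q => ratr q * (n.+1`!%:R * t n i))).
    by move=> x y; rewrite rmorphD mulrDl.
  apply: cvgB; first exact: gP (i, q + r).
  by apply: cvgD; [exact: gP (i, q)|exact: gP (i, r)].
have near_pos : \forall n \near G, forall i, 0 < cos (2 * pi * gn i q n).
  apply: filter_forall => i; have := hq i.
  have c : (fun n => cos (2 * pi * gn i q n)) @ G --> cos (2 * pi * g (i, q)).
    have ct : {for g (i, q), continuous (fun x : R => cos (2 * pi * x))}.
      apply: (@continuous_comp _ _ _ (fun x => 2 * pi * x) cos); first exact: mulrl_continuous.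
      exact: continuous_cos.
    exact: (continuous_cvg _ ct (gP (i, q))).
  exact: (cvgr_gt _ c).
have near_big : \forall n \near G, (`|denq q| <= n.+1 /\ `|numq q| <= n)%N.
  apply: leG; near=> n; split.
    by apply: (@leq_trans n) => //; near: n; exact: nbhs_infty_ge.
  by near: n; exact: nbhs_infty_ge.
have [n [pos [dn nn]]] := filter_ex (filterI near_pos near_big).
pose x : int := numq q * (n.+1`! %/ `|denq q|)%N.
have dF : (`|denq q| %| n.+1`!)%N by rewrite dvdn_fact // dn absz_gt0 denq_neq0.
have d0 : `|denq q|%:R != 0 :> rat by rewrite pnatr_eq0 absz_eq0 denq_neq0.
have F0 : n.+1`!%:R != 0 :> rat by rewrite pnatr_eq0 -lt0n fact_gt0.
have xE : x%:~R = q * n.+1`!%:R.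
  have FE : n.+1`!%:R = (n.+1`! %/ `|denq q|)%:R * `|denq q|%:R :> rat.
    by rewrite -natrM divnK.
  have qE : q = (numq q)%:~R / `|denq q|%:R.
    by rewrite -[LHS]divq_num_den natr_absz gtr0_norm ?denq_gt0.
  rewrite /x intrM -pmulrn [in RHS]FE mulrCA mulrC.
  by congr (_ * _); rewrite -[LHS](divfK d0) -qE.
have [|j|a [b [c [d [e h1 h2 h3]]]]] := tP n x.
- rewrite /x abszM /= leq_mul //; first by rewrite (leq_trans nn).
  exact: leq_div.
- have : ratr q * (n.+1`!%:R * t n j) = x%:~R * t n j.
    by rewrite mulrA -[in RHS](ratr_int R) xE rmorphM /= ratr_nat.
  move=> E; have := pos j; rewrite /gn /frac E => /ltW.
  by rewrite -mulrNz cos_shift_int ?intr_int.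
by exists a, b, c, d; split => //; rewrite e xE mulfK.
Unshelve. all: by end_near. Qed.

(** * Extension of homomorphisms and finite rank *)

Definition subgroup {G : zmodType} (S : set G) :=
  S 0 /\ forall x y, S x -> S y -> S (x - y).

Section Subgroup.
Context {G : zmodType} (S : set G).
Hypothesis SS : subgroup S.

Lemma subgroupN x : S x -> S (- x).
Proof. by move=> Sx; rewrite -sub0r; apply: SS.2 => //; exact: SS.1. Qed.

Lemma subgroupD x y : S x -> S y -> S (x + y).
Proof. by move=> Sx Sy; rewrite -[y]opprK; apply: SS.2 => //; exact: subgroupN. Qed.

Lemma subgroupMz x (k : int) : S x -> S (x *~ k).
Proof.
move=> Sx; have nat_case (n : nat) : S (x *~ n).
  elim: n => [|n IH]; first by rewrite mulr0z; exact: SS.1.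
  by rewrite -addn1 PoszD mulrzDr; exact: subgroupD.
by case: k => n; rewrite ?NegzE ?mulrNz //; apply: subgroupN.
Qed.

Lemma subgroup_sum (I : finType) (F : I -> G) :
  (forall i, S (F i)) -> S (\sum_i F i).
Proof.
by move=> SF; apply: (big_ind S) => //; [exact: SS.1 | exact: subgroupD].
Qed.

End Subgroup.

Lemma mulrz_pair (G H : zmodType) (x : G) (y : H) (k : int) :
  (x, y) *~ k = (x *~ k, y *~ k).
Proof.
have nat_case (n : nat) : (x, y) *+ n = (x *+ n, y *+ n).
  by elim: n => // n IH; rewrite !mulrS IH.
by case: k => n; [exact: nat_case | rewrite NegzE !mulrNz -!pmulrn nat_case].
Qed.

(** Homomorphisms defined on a subgroup of [G] are handled through their
    graphs. *)
Definition hom_graph {G H : zmodType} (D : set (G * H)) :=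
  subgroup D /\ forall y, D (0, y) -> y = 0.

(** A partial homomorphism extends to the whole of [G] as soon as it, and all
    its extensions, can be extended to one more element: this is Zorn's lemma. *)
Lemma hom_graph_extend {G H : zmodType} (D0 : set (G * H)) :
  hom_graph D0 ->
  (forall D x, hom_graph D -> D0 `<=` D -> ~ (exists y, D (x, y)) ->
    exists y, forall (k : int) w, D (x *~ k, w) -> w = y *~ k) ->
  exists2 psi : G -> H, zmod_morphism psi & forall x y, D0 (x, y) -> psi x = y.
Proof.
move=> D0g step.
pose T := {D : set (G * H) | hom_graph D /\ D0 `<=` D}.
pose le (D E : T) := `[< sval D `<=` sval E >].
have [D Dmax] : exists t : T, forall s, le t s -> s = t.
  apply: Zorn => [t|r s t|s t|A totA].
  - exact/asboolP.
  - by move=> /asboolP rs /asboolP st; apply/asboolP; exact: subset_trans st.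
  - case: s t => [S hS] [E hE] /asboolP SE /asboolP ES; apply: eq_exist.
    by apply/seteqP.
  have [[t0 At0]|A0] := pselect (exists t, A t); last first.
    have D00 : hom_graph D0 /\ D0 `<=` D0 by split.
    by exists (exist _ D0 D00) => s As; case: A0; exists s.
  pose U : set (G * H) := \bigcup_(t in A) sval t.
  have common u v : U u -> U v -> exists2 t, A t & sval t u /\ sval t v.
    move=> [s As su] [t At tv]; have [/asboolP st|/asboolP ts] := totA _ _ As At.
      by exists t => //; split => //; exact: st.
    by exists s => //; split => //; exact: ts.
  have Ug : hom_graph U /\ D0 `<=` U.
    split; last by move=> u D0u; exists t0 => //; exact: (svalP t0).2.
    split; last by move=> y [t At ty]; apply: (svalP t).1.2.
    split; first by exists t0 => //; exact: (svalP t0).1.1.1.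
    by move=> u v Uu Uv; have [t At [tu tv]] := common _ _ Uu Uv; exists t => //;
      exact: (svalP t).1.1.2.
  by exists (exist _ U Ug) => s As; apply/asboolP => u su; exists s.
have [[DS D1] D0D] := svalP D.
have total x : exists y, sval D (x, y).
  apply: contrapT => nx; have [y hy] := step (sval D) x (conj DS D1) D0D nx.
  pose E : set (G * H) := [set u | exists k : int, sval D (u - (x *~ k, y *~ k))].
  have Eg : hom_graph E /\ D0 `<=` E.
    split; last by move=> u D0u; exists 0; rewrite !mulr0z subr0; exact: D0D.
    split; last first.
      move=> w [k Dk]; have : sval D (x *~ k, y *~ k - w).
        by rewrite -[(_, _)]opprK; apply: (subgroupN DS); congr (sval D _): Dk; apply/pair_equal_spec; rewrite /= sub0r opprB.
      by move=> /hy /eqP; rewrite -subr_eq0 addrAC subrr sub0r oppr_eq0 => /eqP.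
    split; first by exists 0; rewrite !mulr0z subr0; exact: DS.1.
    move=> u v [k Dk] [l Dl]; exists (k - l); have := DS.2 _ _ Dk Dl.
    congr (sval D _); rewrite !mulrzBr.
    by case: u v {Dk Dl} => [u1 u2] [v1 v2]; apply/pair_equal_spec; split => /=;
      rewrite !opprB addrACA [RHS]addrACA; congr (_ + _); rewrite addrC.
  have /(congr1 sval) /= EE : exist _ E Eg = D.
    by apply: Dmax; apply/asboolP => u Du; exists 0; rewrite !mulr0z subr0.
  apply: nx; exists y; rewrite -EE; exists 1; rewrite !mulr1z subrr; exact: DS.1.
have [psi psiP] := boolp.choice total.
have uniq x y z : sval D (x, y) -> sval D (x, z) -> y = z.
  move=> h1 h2; apply/eqP; rewrite -subr_eq0; apply/eqP/D1.
  have := DS.2 _ _ h1 h2; rewrite (_ : (x, y) - (x, z) = (0, y - z)) //.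
  by apply/pair_equal_spec; rewrite subrr.
exists psi => [x z|x y D0xy]; last by apply: (uniq x) => //; exact: D0D.
by apply: (uniq (x - z)) => //; exact: (DS.2 _ _ (psiP x) (psiP z)).
Qed.

Definition independent_mod {G : zmodType} (S : set G) (k : nat) (x : nat -> G) :=
  forall c : nat -> int, S (\sum_(i < k) x i *~ c i) -> forall i, (i < k)%N -> c i = 0.

(** The divisibility of [R] lets one prescribe, on independent elements, a real
    homomorphism that vanishes on a given subgroup. *)
Lemma extend_to_real {R : realType} {G : zmodType} (S : set G) (k : nat)
    (x : nat -> G) (y : nat -> R) : subgroup S -> independent_mod S k x ->
  exists psi : G -> R, [/\ zmod_morphism psi, (forall h, S h -> psi h = 0) &
    forall i, (i < k)%N -> psi (x i) = y i].
Proof.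
move=> SS ind.
pose val_ (c : nat -> int) : R := \sum_(i < k) y i *~ c i.
pose D0 : set (G * R) := [set u | exists2 c : nat -> int,
  S (u.1 - \sum_(i < k) x i *~ c i) & u.2 = val_ c].
have sumB (V : zmodType) (z : nat -> V) (c d : nat -> int) :
    \sum_(i < k) z i *~ (c i - d i) = \sum_(i < k) z i *~ c i - \sum_(i < k) z i *~ d i.
  by rewrite -sumrB; apply: eq_bigr => i _; rewrite mulrzBr.
have D0g : hom_graph D0.
  split; [split|].
  - exists (fun=> 0) => /=; last by rewrite /val_ big1.
    by rewrite big1 ?subrr //; exact: SS.1.
  - move=> u v [c Sc uc] [d Sd vd]; exists (fun i => c i - d i) => /=; last first.
      by rewrite uc vd /val_ sumB.
    rewrite sumB.
    by have := SS.2 _ _ Sc Sd; congr S; rewrite !opprB addrACA [RHS]addrACA;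
        congr (_ + _); rewrite addrC.
  - move=> r [c /= Sc ->]; rewrite /val_ big1 // => i _.
    have S' : S (\sum_(i < k) x i *~ c i).
      by rewrite -[X in S X]opprK -[X in S (- X)]sub0r; exact: subgroupN.
    by rewrite (ind _ S' i) ?mulr0z.
have [D z [DS D1] _ _|psi psiB psiD] := hom_graph_extend D0g.
  have [[n [n0 [w Dw]]]|none] := pselect (exists n : int, n != 0 /\ exists w, D (z *~ n, w)).
    exists (w / n%:~R) => k' w' Dw'.
    have := DS.2 _ _ (subgroupMz DS n Dw') (subgroupMz DS k' Dw).
    rewrite (_ : _ - _ = (0, w' *~ n - w *~ k')).
      move=> /D1 /eqP; rewrite subr_eq0 -[w' *~ _]mulrzr -[w *~ k']mulrzr => /eqP e.
      apply: (@mulIf _ n%:~R); first by rewrite intr_eq0.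
      by rewrite e -[X in _ = X * _]mulrzr mulrAC divfK ?intr_eq0.
    rewrite !mulrz_pair; apply/pair_equal_spec; split => //=.
    by rewrite -!mulrzA mulrC subrr.
  exists 0 => k' w Dw; rewrite mul0rz; have [k0|k0] := eqVneq k' 0.
    by apply: D1; move: Dw; rewrite k0 mulr0z.
  by case: none; exists k'; split => //; exists w.
exists psi; split => // [h Sh|i ik]; apply: psiD.
  by exists (fun=> 0); rewrite /= ?big1 ?subr0 // /val_ big1.
exists (fun j => (j == i)%:R).
  rewrite /= (bigD1 (Ordinal ik)) //= eqxx mulr1z big1 ?addr0 ?subrr; first exact: SS.1.
  by move=> j /negPf; rewrite -val_eqE /= => ->.
rewrite /= /val_ (bigD1 (Ordinal ik)) //= eqxx mulr1z big1 ?addr0 //.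
by move=> j /negPf; rewrite -val_eqE /= => ->.
Qed.

(** Finiteness of the rank of [P] modulo [Q]; sets rather than subgroups, so that
    [Q] may be a mere neighbourhood of [0]. *)
Definition finite_rank {G : zmodType} (P Q : set G) :=
  exists I : finType, forall x : I -> G, (forall i, P (x i)) ->
    exists2 c : I -> int, (exists i, c i != 0) & Q (\sum_i x i *~ c i).

Lemma finite_rank_trans {G : zmodType} (P Q S : set G) :
  finite_rank P Q -> finite_rank Q S -> finite_rank P S.
Proof.
move=> [I hI] [J hJ]; exists (J * I)%type => x Px.
have /boolp.choice[c hc] : forall j, exists c : I -> int,
    (exists i, c i != 0) /\ Q (\sum_i x (j, i) *~ c i).
  by move=> j; have [c c0 Qc] := hI (fun i => x (j, i)) (fun i => Px _); exists c.
have [d [j dj] Sd] := hJ (fun j => \sum_i x (j, i) *~ c j i) (fun j => (hc j).2).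
exists (fun ji => c ji.1 ji.2 * d ji.1).
  by have [[i ci] _] := hc j; exists (j, i); rewrite mulf_neq0.
move: Sd; congr S.
transitivity (\sum_j \sum_i x (j, i) *~ (c j i * d j)); last first.
  by rewrite pair_bigA; apply: eq_bigr => -[].
by apply: eq_bigr => j' _; rewrite mulrz_suml; apply: eq_bigr => i _; rewrite mulrzA.
Qed.

(** A maximal independent family of elements of [P]. *)
Lemma finite_rank_basis {G : zmodType} (P S : set G) : subgroup S -> finite_rank P S ->
  exists k (x : nat -> G), [/\ forall i, (i < k)%N -> P (x i), independent_mod S k x &
    forall z, P z -> exists2 n : int, n != 0 &
      exists c : nat -> int, S (z *~ n - \sum_(i < k) x i *~ c i)].
Proof.
move=> SS [I hI]; apply: contrapT => none.
have ext k : exists2 x : nat -> G, forall i, (i < k)%N -> P (x i) & independent_mod S k x.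
  elim: k => [|k [x Px ind]]; first by exists (fun=> 0).
  have [z Pz nz] : exists2 z, P z & forall (n : int) (c : nat -> int),
      S (z *~ n - \sum_(i < k) x i *~ c i) -> n = 0.
    apply: contrapT => noz; apply: none; exists k, x; split => // z Pz.
    apply: contrapT => nn; apply: noz; exists z => // n c Sc; apply/eqP/negP => /negP n0.
    by apply: nn; exists n => //; exists c.
  exists (fun i => if (i < k)%N then x i else z) => [i|c]; first by case: ifP => // /Px.
  rewrite big_ord_recr /= ltnn (eq_bigr (fun i : 'I_k => x i *~ c i)); last first.
    by move=> i _; rewrite ltn_ord.
  move=> Sc; have ck : c k = 0.
    apply: (nz _ (fun i => - c i)); move: Sc; congr S; rewrite addrC; congr (_ + _).
    by rewrite -sumrN; apply: eq_bigr => i _; rewrite mulrNz opprK.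
  move=> i; rewrite ltnS leq_eqVlt => /predU1P[->//|ik]; apply: ind => //.
  by move: Sc; rewrite ck mulr0z addr0.
have [x Px ind] := ext #|I|.
have [c [i ci] Sc] := hI (fun i => x (enum_rank i)) (fun i => Px _ (ltn_ord _)).
pose d j : int := if @insub _ _ 'I_#|I| j is Some u then c (enum_val u) else 0.
have dE (j : 'I_#|I|) : d j = c (enum_val j) by rewrite /d valK.
have := ind d; rewrite (eq_bigr (fun j : 'I_#|I| => x j *~ c (enum_val j))); last first.
  by move=> j _; rewrite dE.
rewrite (reindex (@enum_rank I)) /=; last by apply: onW_bij; exact: enum_rank_bij.
rewrite (eq_bigr (fun i => x (enum_rank i) *~ c i)); last by move=> j _; rewrite enum_rankK.
move=> /(_ Sc _ (ltn_ord (enum_rank i))); rewrite dE enum_rankK.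
by apply/eqP.
Qed.

Lemma finite_rank_seq {G : zmodType} (S : set G) (s : seq G) : S 0 ->
  finite_rank [set x | x \in s] S.
Proof.
move=> S0; exists 'I_(size s).+1 => x xs.
have lt_s i : (index (x i) s < size s)%N by rewrite index_mem; exact: xs.
have [i [j [ij xij]]] : exists i j, i != j /\ x i = x j.
  apply: contrapT => inj; suff /leq_card : injective (fun i => Ordinal (lt_s i)).
    by rewrite !card_ord ltnn.
  move=> i j [xij]; apply/eqP/negPn/negP => ij; apply: inj; exists i, j; split => //.
  have xi : x i \in s by exact: xs.
  have xj : x j \in s by exact: xs.
  by rewrite -(nth_index 0 xi) xij nth_index.
exists (fun k => (k == i)%:R - (k == j)%:R).
  by exists i; rewrite eqxx (negPf ij) subr0 oner_eq0.
under eq_bigr do rewrite mulrzBr; rewrite sumrB.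
have delta k : \sum_l x l *~ (l == k)%:R = x k.
  rewrite (bigD1 k) //= eqxx mulr1z big1 ?addr0 // => l /negPf ->.
  by rewrite mulr0z.
by rewrite !delta xij subrr.
Qed.

(** * Topological abelian groups *)

Section ZmodMorphism.
Context {A B : zmodType} (f : A -> B).
Hypothesis fB : zmod_morphism f.
Let F : {additive A -> B} := HB.pack f (GRing.isZmodMorphism.Build A B f fB).

Lemma zmod_morphism0 : f 0 = 0. Proof. exact: (raddf0 F). Qed.
Lemma zmod_morphismD x y : f (x + y) = f x + f y. Proof. exact: (raddfD F). Qed.
Lemma zmod_morphismMn x n : f (x *+ n) = f x *+ n. Proof. exact: (raddfMn F). Qed.
Lemma zmod_morphismMz x k : f (x *~ k) = f x *~ k. Proof. exact: (raddfMz F). Qed.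
Lemma zmod_morphism_sum (I : Type) (r : seq I) (P : pred I) (E : I -> A) :
  f (\sum_(i <- r | P i) E i) = \sum_(i <- r | P i) f (E i).
Proof. exact: (raddf_sum F). Qed.

End ZmodMorphism.

Section TopologicalGroup.
Context {G : topologicalZmodType}.
Implicit Types (U V : set G) (x y : G).

Lemma nbhs_addl x U : nbhs x U -> nbhs 0 [set y | U (x + y)].
Proof.
move=> xU; have c : {for 0, continuous (fun y => x + y)}.
  apply: (@continuous_comp _ _ _ (fun y => (x, y)) (fun z : G * G => z.1 + z.2)).
    by apply: cvg_pair; [exact: cvg_cst|exact: cvg_id].
  exact: add_continuous.
by apply: c; rewrite addr0.
Qed.

Lemma nbhs_subl x U : nbhs 0 U -> nbhs x [set y | U (y - x)].
Proof.
move=> U0; have c : {for x, continuous (fun y => y - x)}.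
  apply: (@continuous_comp _ _ _ (fun y => (y, x)) (fun z : G * G => z.1 - z.2)).
    by apply: cvg_pair; [exact: cvg_id|exact: cvg_cst].
  exact: sub_continuous.
by apply: c; rewrite subrr.
Qed.

Lemma nbhs0_opp U : nbhs 0 U -> nbhs 0 [set y | U (- y)].
Proof. by move=> U0; apply: (@opp_continuous G 0); rewrite oppr0. Qed.

Lemma nbhs_subr x U : nbhs 0 U -> nbhs x [set y | U (x - y)].
Proof.
by move=> /nbhs0_opp /(nbhs_subl x); apply: filterS => y /=; rewrite opprB.
Qed.

Lemma nbhs0_sum (n : nat) U : nbhs 0 U -> exists V, [/\ nbhs 0 V,
  forall x, V x -> V (- x) & forall s : seq G, (size s <= n)%N ->
    (forall x, x \in s -> V x) -> U (\sum_(x <- s) x)].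
Proof.
have sym V : nbhs 0 V -> exists W, [/\ nbhs 0 W, W `<=` V & forall x, W x -> W (- x)].
  move=> V0; exists (V `&` [set y | V (- y)]); split; last by move=> x [] /= *; rewrite opprK.
    by apply: filterI => //; exact: nbhs0_opp.
  by move=> x [].
elim: n U => [|n IH] U U0.
  have [W [W0 WU Wsym]] := sym U U0; exists W; split => // s.
  by rewrite leqn0 size_eq0 => /eqP -> _; rewrite big_nil; exact: nbhs_singleton.
have [[P Q] /= [P0 Q0] PQU] : nbhs ((0, 0) : G * G) (fun z : G * G => U (z.1 + z.2)).
  by apply: (add_continuous (0, 0)); rewrite /= addr0.
have [V [V0 Vsym VQ]] := IH _ Q0.
have [W [W0 WPV Wsym]] := sym _ (filterI P0 V0).
exists W; split => // -[|x s] /= sn Ws.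
  by rewrite big_nil; exact: nbhs_singleton.
rewrite big_cons; apply: (PQU (x, _)); split => /=.
  by have [] := WPV x (Ws x (mem_head _ _)).
by apply: VQ => // y ys; have [] := WPV y; first by apply: Ws; rewrite inE ys orbT.
Qed.

Lemma nbhs0_sum2 U : nbhs 0 U -> exists V, [/\ nbhs 0 V,
  forall x, V x -> V (- x), V `<=` U & forall x y, V x -> V y -> U (x + y)].
Proof.
move=> /(@nbhs0_sum 2)[V [V0 Vs VU]]; exists V; split => //.
  move=> x Vx; have := VU [:: x] isT; rewrite big_seq1; apply=> y.
  by rewrite inE => /eqP ->.
move=> x y Vx Vy; have := VU [:: x; y] isT; rewrite big_cons big_seq1; apply=> z.
by rewrite !inE => /orP[] /eqP ->.
Qed.

Lemma hausdorff_eq0 x : hausdorff_space G -> (forall U, nbhs 0 U -> U x) -> x = 0.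
Proof.
move=> hG xU; apply/esym/hG => A B A0 Bx; exists x; split; first exact: xU.
exact: nbhs_singleton.
Qed.

Lemma compact_finite_translates (K U : set G) : compact K -> nbhs 0 U ->
  exists2 s : seq G, forall c, c \in s -> K c &
    forall x, K x -> exists2 c, c \in s & U (x - c).
Proof.
move=> /compact_near_coveringP cK U0.
pose F : set_system (seq G) := [set P | exists2 s0 : seq G, forall c, c \in s0 -> K c &
  forall s : seq G, {subset s0 <= s} -> P s].
have FF : Filter F.
  split; first by exists [::].
    move=> P Q [s Ks Ps] [t Kt Qt]; exists (s ++ t) => [c|u stu].
      by rewrite mem_cat => /orP[/Ks|/Kt].
    by split; [apply: Ps|apply: Qt] => c cs; apply: stu; rewrite mem_cat cs ?orbT.
  by move=> P Q PQ [s Ks Ps]; exists s => // u su; exact/PQ/Ps.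
have [x Kx|s Ks Ps] := cK _ F (fun s x => exists2 c, c \in s & U (x - c)) FF.
  exists ([set y | U (y - x)], [set s : seq G | x \in s]) => /=; last first.
    by move=> [y s] /= [Uy xs]; exists x.
  split; first exact: nbhs_subl.
  exists [:: x] => [c|s]; first by rewrite inE => /eqP ->.
  by apply; rewrite inE.
by exists s => // x Kx; exact: (Ps s).
Qed.

End TopologicalGroup.

Lemma additive_continuous (A B : topologicalZmodType) (f : A -> B) : zmod_morphism f ->
  (forall U, nbhs 0 U -> nbhs 0 (f @^-1` U)) -> continuous f.
Proof.
move=> fB f0 x U /(@nbhs_addl B) /f0 /(nbhs_subl x).
by apply: filterS => y /=; rewrite fB addrC subrK.
Qed.

(** * One-parameter subgroups from homomorphisms of the rational numbers *)

(** A triangle inequality for the squared distance [2 - 2 * cos a] of [exp (i a)]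
    to [1]. *)
Lemma cos_add_lower {R : realType} (a b : R) :
  1 - cos (a + b) <= 2 * (1 - cos a) + 2 * (1 - cos b).
Proof.
rewrite cosD; have := cos2Dsin2 a; have := cos2Dsin2 b.
move: (cos a) (sin a) (cos b) (sin b) => c s c' s' h h'.
have := sqr_ge0 (s - s'); have := sqr_ge0 (c + c' - 2).
by rewrite !expr2 in h h' *; nra.
Qed.

Section OneParameterSubgroups.
Context {R : realType} {G : topologicalZmodType}.
Hypothesis hG : hausdorff_space G.
Variables (K : set G) (phi : rat -> G).
Hypotheses (cK : compact K) (phiB : zmod_morphism phi) (phiK : forall q, K (phi q)).

Let phiD q r : phi (q + r) = phi q + phi r.
Proof. exact: zmod_morphismD. Qed.

(** The topology that [G] induces on [rat] is coarser than the topology defined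
    by all characters of [rat]: colour [q] by a small translate that contains
    [phi q], among finitely many that cover [K], and apply [bohr_coloring]. *)
Lemma bohr_nbhs (U : set G) : nbhs 0 U ->
  exists m (g : 'I_m -> rat -> R), (forall i, additive_mod_int (g i)) /\
    forall q, (forall i, 0 < cos (2 * pi * g i q)) -> U (phi q).
Proof.
move=> /(@nbhs0_sum _ 4)[V [V0 Vsym VU]].
have [s _ hs] := compact_finite_translates cK V0.
have /boolp.choice[kappa kP] : forall q, exists i : 'I_(size s), V (phi q - nth 0 s i).
  move=> q; have [c cs Vc] := hs _ (phiK q).
  have lt_s : (index c s < size s)%N by rewrite index_mem.
  by exists (Ordinal lt_s); rewrite /= nth_index.
have [m [g [gA gP]]] := @bohr_coloring R _ kappa.
exists m, g; split => // q /gP[a [b [c [d [<- ab ac ad]]]]].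
have := VU [:: phi a - nth 0 s (kappa a); phi b - nth 0 s (kappa b);
  - (phi c - nth 0 s (kappa c)); - (phi d - nth 0 s (kappa d))] isT.
have va := kP a; have vb := kP b; have vc := kP c; have vd := kP d.
rewrite -ab -ac -ad in vb vc vd *; rewrite !big_cons big_nil !phiB phiD => h.
move: va vb vc vd h; set z := nth _ _ _ => va vb vc vd h.
have -> : phi a + phi b - phi c - phi d =
    phi a - z + (phi b - z + (- (phi c - z) + (- (phi d - z) + 0))).
  rewrite addr0 !opprB [phi b - z + _]addrA subrKA [phi b - _ + _]addrC.
  by rewrite [RHS]addrA subrKA addrACA -[LHS]addrA [- phi c + _]addrC.
by apply: h => x; rewrite !inE => /or4P[] /eqP -> //; exact: Vsym.
Qed.

(** A homomorphism from the characters of [rat] to [R] defines a one-parameter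
    subgroup of the Bohr compactification of [rat].  Kronecker's theorem makes
    each of its points, [t], a limit of rational numbers, along the following
    filter, and [bohr_nbhs] makes the images under [phi] converge in [G]. *)
Section Limit.
Variable psi : (rat -> R) -> R.
Hypotheses (psiB : zmod_morphism psi)
  (psi_int : forall g, (forall q, g q \is a Num.int) -> psi g = 0).

Let close (t : R) (s : seq (rat -> R)) (eps : R) : set rat :=
  [set q | forall g, g \in s -> 1 - eps < cos (2 * pi * (g q - t * psi g))].

Let approx (t : R) : set_system rat := [set A | exists s eps,
  [/\ 0 < eps, forall g, g \in s -> additive_mod_int g & close t s eps `<=` A]].

Let approx_filter t : ProperFilter (approx t).
Proof.
apply: Build_ProperFilter_ex.
  move=> A [s [eps [eps0 sA /(_ _) cA]]].
  have [|m hm|//|q hq] := @kronecker R (size s) (fun i => nth (fun=> 0) s i)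
    (fun i => t * psi (nth (fun=> 0) s i)) eps.
  - by move=> i; apply: sA; exact: mem_nth.
  - rewrite (eq_bigr (fun i : 'I_(size s) => t * psi (nth (fun=> 0) s i *~ m i))); last first.
      by move=> i _; rewrite (zmod_morphismMz psiB) -mulrzr; ring.
    rewrite -mulr_sumr -(zmod_morphism_sum psiB) psi_int ?mulr0 ?int_num0 // => q.
    rewrite (_ : _ q = \sum_(i < size s) (m i)%:~R * nth (fun=> 0) s i q) ?hm //.
    rewrite fct_sumE; apply: eq_bigr => i _.
    rewrite mulrC mulrzr; have nat_case (n : nat) (g : rat -> R) : (g *+ n) q = g q *+ n.
      by elim: n => // n IH; rewrite !mulrS -IH.
    case: (m i) => n; first exact: nat_case.
    by rewrite NegzE !mulrNz -!pmulrn -nat_case.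
  - exists q; apply: cA => g gs; have gi : (index g s < size s)%N by rewrite index_mem.
    by have := hq (Ordinal gi); rewrite /= nth_index.
split; first by exists [::], 1; split.
  move=> A B [s [e [e0 sA cA]]] [r [d [d0 rA cB]]].
  exists (s ++ r), (Num.min e d); split; first by rewrite lt_min e0 d0.
    by move=> g; rewrite mem_cat => /orP[/sA|/rA].
  move=> q hq; split; [apply: cA => g gs|apply: cB => g gs].
    have := hq g; rewrite mem_cat gs => /(_ isT); apply: le_lt_trans.
    by rewrite lerD2l lerN2 ge_min lexx.
  have := hq g; rewrite mem_cat gs orbT => /(_ isT); apply: le_lt_trans.
  by rewrite lerD2l lerN2 ge_min lexx orbT.
by move=> A B AB [s [e [e0 sA cA]]]; exists s, e; split => //; exact: subset_trans AB.
Qed.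

Lemma bohr_limit : exists f : R -> G, [/\ zmod_morphism f, continuous f,
  forall t, K (f t) & forall t (s : seq (rat -> R)) eps V, 0 < eps ->
    (forall g, g \in s -> additive_mod_int g) -> nbhs 0 V ->
    exists q, (forall g, g \in s -> 1 - eps < cos (2 * pi * (g q - t * psi g))) /\
      V (f t - phi q)].
Proof.
have /boolp.choice[f fP] (t : R) : exists x, K x /\ cluster (phi @ approx t) x.
  have tK : (phi @ approx t) K.
    by exists [::], 1; split => // q _; exact: phiK.
  by have [x [Kx cx]] := @cK _ (fmap_proper_filter phi (approx_filter t)) tK; exists x.
have near_f (t : R) (s : seq (rat -> R)) (eps : R) V : 0 < eps -> (forall g, g \in s -> additive_mod_int g) ->
    nbhs 0 V -> exists q, close t s eps q /\ V (f t - phi q).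
  move=> eps0 sA V0; have [_ /(_ (phi @` close t s eps))] := fP t.
  move=> /(_ [set y | V (f t - y)])[||_ [[q cq <-] Vq]]; last by exists q.
    by exists s, eps; split => //; move=> q cq; exists q.
  exact: nbhs_subr.
have small (g : rat -> R) a b (t u : R) : additive_mod_int g ->
    1 - 1 / 10 < cos (2 * pi * (g a - t * psi g)) ->
    1 - 1 / 10 < cos (2 * pi * (g b - u * psi g)) ->
    6 / 10 < cos (2 * pi * (g (a + b) - (t + u) * psi g)).
  move=> gA ha hb; have h := cos_add_lower (2 * pi * (g a - t * psi g))
    (2 * pi * (g b - u * psi g)).
  rewrite (_ : g (a + b) - _ = (g a - t * psi g + (g b - u * psi g)) +
    (g (a + b) - (g a + g b))); last ring.
  by rewrite (cos_shift_int _ (gA a b)) mulrDr; lra.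
have fD t u : f (t + u) = f t + f u.
  apply/eqP; rewrite -subr_eq0; apply/eqP; apply: hausdorff_eq0 => // U.
  move=> /(@nbhs0_sum _ 4)[V [V0 Vsym VU]].
  have [m [g [gA gP]]] := bohr_nbhs V0.
  pose s := [seq g i | i <- enum 'I_m].
  have sA h : h \in s -> additive_mod_int h by move=> /mapP[i _ ->].
  have gs i : g i \in s by apply: map_f; rewrite mem_enum.
  have e0 : 0 < 1 / 10 :> R by lra.
  have [a [ca Va]] := near_f t s _ V e0 sA V0.
  have [b [cb Vb]] := near_f u s _ V e0 sA V0.
  have [c [cc Vc]] := near_f (t + u) s _ V e0 sA V0.
  have Vabc : V (phi (c - (a + b))).
    apply: gP => i; have hab := small _ _ _ _ _ (gA i) (ca _ (gs i)) (cb _ (gs i)).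
    have hc := cc _ (gs i).
    have h := cos_add_lower (2 * pi * (g i c - (t + u) * psi (g i)))
      (2 * pi * - (g i (a + b) - (t + u) * psi (g i))).
    have hN z : cos (2 * pi * - z) = cos (2 * pi * z) :> R by rewrite mulrN cosN.
    rewrite hN -mulrDr in h.
    have gAc := gA i (c - (a + b)) (a + b); rewrite subrK in gAc.
    have E : 2 * pi * (g i c - (t + u) * psi (g i) + - (g i (a + b) - (t + u) * psi (g i))) =
        2 * pi * (g i (c - (a + b)) + (g i c - (g i (c - (a + b)) + g i (a + b)))).
      by ring.
    by rewrite E (cos_shift_int _ gAc) in h; lra.
  have := VU [:: f (t + u) - phi c; phi (c - (a + b)); - (f t - phi a); - (f u - phi b)] isT.
  rewrite !big_cons big_nil phiB phiD => h.
  have -> : f (t + u) - (f t + f u) = f (t + u) - phi c + (phi c - (phi a + phi b) +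
    (- (f t - phi a) + (- (f u - phi b) + 0))).
    by rewrite addr0 !opprB [phi a - _ + _]addrACA -opprD !subrKA.
  apply: h => x; rewrite !inE => /or4P[] /eqP -> //; [|exact: Vsym..].
  by rewrite -phiD -phiB.
have fB : zmod_morphism f.
  by move=> t u; apply/eqP; rewrite eq_sym subr_eq -fD subrK.
exists f; split; [exact: fB| |by move=> t; case: (fP t)|exact: near_f].
apply: additive_continuous => // U /(@nbhs0_sum2 G)[V [V0 Vsym _ VU]].
have [m [g [gA gP]]] := bohr_nbhs V0.
have near_t : \forall t \near (0 : R), forall i, 1 - 1 / 10 < cos (2 * pi * (t * psi (g i))).
  apply: (filter_forall (nbhs_filter (0 : R))) => i.
  have c : {for 0, continuous (fun t : R => cos (2 * pi * (t * psi (g i))))}.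
    apply: (@continuous_comp _ _ _ (fun t : R => 2 * pi * (t * psi (g i))) cos).
      apply: (@continuous_comp _ _ _ (fun t : R => t * psi (g i)) (fun t => 2 * pi * t)).
        exact: mulrr_continuous.
      exact: mulrl_continuous.
    exact: continuous_cos.
  apply: (cvgr_gt _ c); rewrite mul0r mulr0 cos0; lra.
apply: filterS near_t => t ht /=.
pose s := [seq g i | i <- enum 'I_m].
have sA h : h \in s -> additive_mod_int h by move=> /mapP[i _ ->].
have gs i : g i \in s by apply: map_f; rewrite mem_enum.
have e0 : 0 < 1 / 10 :> R by lra.
have [q [cq Vq]] := near_f t s _ V e0 sA V0.
rewrite -(subrK (phi q) (f t)); apply: VU => //; apply: gP => i.
have := cos_add_lower (2 * pi * (g i q - t * psi (g i))) (2 * pi * (t * psi (g i))).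
by rewrite -mulrDr subrK; have := cq _ (gs i); have := ht i; lra.
Qed.

End Limit.

(** Choose in [bohr_limit] a [psi] whose values at the characters that control a
    small neighbourhood of [0] agree modulo [1] with their values at [q0]: the
    one-parameter subgroup then takes a value close to [phi q0] at [1]. *)
Theorem exists_one_parameter_subgroup (q0 : rat) : phi q0 != 0 ->
  exists f : R -> G, [/\ zmod_morphism f, continuous f, forall t, K (f t) &
    exists t, f t != 0].
Proof.
move=> phi0.
have [U [U0 nU]] : exists U : set G, nbhs 0 U /\ ~ U (phi q0).
  apply: contrapT => none; move/eqP: phi0; apply; apply: hausdorff_eq0 => // U U0.
  by apply: contrapT => nU; apply: none; exists U.
have [V [V0 Vsym VsU VU]] := nbhs0_sum2 U0.
have [m [g [gA gP]]] := bohr_nbhs V0.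
pose S : set (rat -> R) := [set h | forall q, h q \is a Num.int].
have SS : subgroup S.
  by split=> [q|x y Sx Sy q]; [exact: int_num0|rewrite rpredB ?Sx ?Sy].
have fct_mulrz (h : rat -> R) (k : int) q : (h *~ k) q = k%:~R * h q.
  rewrite mulrC mulrzr; have nat_case (n : nat) : (h *+ n) q = h q *+ n.
    by elim: n => // n IH; rewrite !mulrS -IH.
  by case: k => n; [exact: nat_case|rewrite NegzE !mulrNz -!pmulrn -nat_case].
pose s := [seq g i | i <- enum 'I_m].
have sA h : h \in s -> additive_mod_int h by move=> /mapP[i _ ->].
have gs i : g i \in s by apply: map_f; rewrite mem_enum.
have [k [x [xs ind span]]] := finite_rank_basis SS (finite_rank_seq s SS.1).
have /boolp.choice[n nP] i : exists n : int, n != 0 /\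
    exists c : nat -> int, S (g i *~ n - \sum_(j < k) x j *~ c j).
  by have [n n0 h] := span _ (gs i); exists n.
pose N := \prod_i n i.
have N0 : N != 0 by apply/prodf_neq0 => i _; have [] := nP i.
pose q1 := q0 / N%:~R.
have q1E : q1 *~ N = q0 by rewrite -mulrzr divfK ?intr_eq0.
(* On the basis [x] the value at [q0] lifts to [R] as [N] times the value at
   [q0 / N]; the factor [N] absorbs the denominators of the other [g i]. *)
have [psi [psiB psiS psix]] := extend_to_real (fun j => N%:~R * x j q1) SS ind.
have psig i : psi (g i) - g i q0 \is a Num.int.
  have [ni0 [c Sc]] := nP i.
  have : psi (g i) *~ n i = \sum_(j < k) psi (x j) *~ c j.
    apply/eqP; rewrite -subr_eq0 -(zmod_morphismMz psiB).
    under eq_bigr do rewrite -(zmod_morphismMz psiB).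
    by rewrite -(zmod_morphism_sum psiB) -psiB psiS.
  rewrite (eq_bigr (fun j : 'I_k => N%:~R * (c j)%:~R * x j q1)); last first.
    by move=> j _; rewrite psix // -mulrzr; ring.
  under eq_bigr do rewrite -mulrA; rewrite -mulr_sumr -mulrzr => E.
  pose z : R := (n i)%:~R * g i q1 - \sum_(j < k) (c j)%:~R * x j q1.
  have zZ : z \is a Num.int.
    rewrite /z -fct_mulrz.
    have -> : \sum_(j < k) (c j)%:~R * x j q1 = (\sum_(j < k) x j *~ c j) q1.
      by rewrite fct_sumE; apply: eq_bigr => j _; rewrite fct_mulrz.
    exact: (Sc q1).
  have gq0 : g i q0 - N%:~R * g i q1 \is a Num.int.
    by rewrite -q1E additive_mod_int_mulrz.
  pose N' := \prod_(j | j != i) n j.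
  have NE : N = n i * N' by rewrite /N (bigD1 i).
  have n0' : (n i)%:~R != 0 :> R by rewrite intr_eq0.
  have -> : psi (g i) - g i q0 = - (g i q0 - N%:~R * g i q1) - N'%:~R * z.
    apply: (mulIf n0'); rewrite mulrBl E NE intrM /z; ring.
  by rewrite rpredB ?rpredN // rpredM // intr_int.
have [f [fB fc fK fP]] := bohr_limit psiB psiS.
exists f; split => //; exists 1.
have e0 : 0 < 1 / 10 :> R by lra.
have [q [cq Vq]] := fP 1 s _ V e0 sA V0.
apply: contra_notN nU => /eqP f1; rewrite f1 sub0r in Vq.
rewrite -[phi q0](subrK (phi q)) -opprB -phiB; apply: VU; last first.
  by rewrite -[phi q]opprK; exact: Vsym.
apply: Vsym; apply: gP => i; have cqi := cq _ (gs i); rewrite [1 * psi _]mul1r in cqi.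
have gAq := gA i (q - q0) q0; rewrite subrK in gAq.
rewrite -(cos_shift_int (g i (q - q0)) (rpredB gAq (psig i))).
rewrite (_ : _ + _ = g i q - psi (g i)); last ring.
by lra.
Qed.

End OneParameterSubgroups.

(** * Coordinates on one-parameter subgroups *)

Lemma continuous_comp2 {A B C : topologicalType} (f : A -> B) (g : B -> C) :
  continuous f -> continuous g -> continuous (g \o f).
Proof. by move=> cf cg x; apply: continuous_comp; [exact: cf|exact: cg]. Qed.

Lemma closed_ball_rV_compact {R : realType} (d : nat) (r : R) :
  compact [set x : 'rV[R]_d | `|x| <= r].
Proof.
apply: bounded_closed_compact.
  exists r; split; first exact: num_real.
  move=> M rM x /= xr; exact: le_trans xr (ltW rM).
apply: (@closed_comp _ _ (fun x : 'rV[R]_d => `|x|) [set y | y <= r]).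
  by move=> x _; exact: norm_continuous.
exact: closed_le.
Qed.

Lemma sphere_rV_compact {R : realType} (d : nat) : compact [set x : 'rV[R]_d | `|x| = 1].
Proof.
apply: (@subclosed_compact _ _ [set x : 'rV[R]_d | `|x| <= 1]);
  [|exact: closed_ball_rV_compact|by move=> x /= ->].
apply: (@closed_comp _ _ (fun x : 'rV[R]_d => `|x|) [set y | y = 1]).
  by move=> x _; exact: norm_continuous.
exact: closed_eq.
Qed.

Section OneParamCoordinates.
Context {R : realType} {G : topologicalZmodType}.

Lemma one_param_coordinates : finite_dimensional (one_param R G) ->
  exists d (P : 'rV[R]_d -> G), [/\ zmod_morphism P, continuous P,
    forall f : chom R G, exists x, forall t, f t = P (t *: x) &
    forall x, (forall t, P (t *: x) = 0) -> x = 0].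
Proof.
move=> [d /unsquash[v2r lin [g gK Kg]]].
have v2rB : zmod_morphism v2r by move=> x y; rewrite -scaleN1r addrC lin scaleN1r addrC.
have v2rZ a x : v2r (a *: x) = a *: v2r x.
  by have := lin a x 0; rewrite (zmod_morphism0 v2rB) !addr0.
have gB : zmod_morphism g by move=> x y; rewrite -[x in LHS]Kg -[y in LHS]Kg -v2rB gK.
have gZ a x : g (a *: x) = a *: g x by rewrite -[x in LHS]Kg -v2rZ gK.
pose ev (f : one_param R G) : G := (f : chom R G) 1.
have evB : zmod_morphism ev by [].
pose P x := ev (g x).
have PB : zmod_morphism P by move=> x y; rewrite /P gB evB.
have PZ t x : P (t *: x) = (g x : chom R G) t.
  by rewrite /P gZ /ev /= /chom_fun mulr1.
exists d, P; split => //.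
- have PE x : P x = \sum_j (g (delta_mx 0 j) : chom R G) (x 0 j).
    rewrite [x in LHS]row_sum_delta (zmod_morphism_sum PB).
    by apply: eq_bigr => j _; rewrite PZ.
  apply: additive_continuous => // U /(@nbhs0_sum G d)[V [V0 _ VU]].
  have near_x : \forall x \near (0 : 'rV[R]_d), forall j : 'I_d,
      V ((g (delta_mx 0 j) : chom R G) ((x : 'rV[R]_d) 0 j)).
    apply: (filter_forall (nbhs_filter (0 : 'rV[R]_d))) => j.
    have c : continuous (fun x : 'rV[R]_d => (g (delta_mx 0 j) : chom R G) (x 0 j)).
      apply: (@continuous_comp2 _ _ _ (fun x : 'rV[R]_d => x 0 j)); last exact: cts_fun.
      exact: coord_continuous.
    by apply: (c 0); rewrite mxE raddf0.
  apply: filterS near_x => x Vx /=; rewrite PE.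
  have := VU [seq (g (delta_mx 0 j) : chom R G) (x 0 j) | j <- enum 'I_d].
  rewrite size_map size_enum_ord big_map big_enum; apply=> // y /mapP[j _ ->].
  exact: Vx.
- by move=> f; exists (v2r f) => t; rewrite PZ gK.
- move=> x Px; rewrite -[x]Kg (_ : g x = 0) ?(zmod_morphism0 v2rB) //.
  by apply/chomP => t; rewrite -PZ Px.
Qed.

(** One-parameter subgroups that stay near [0] for a long time have small
    coordinates; in particular none of them stays near [0] forever.  This is
    the compactness of the unit sphere. *)
Lemma one_param_bound (d : nat) (P : 'rV[R]_d -> G) : hausdorff_space G ->
  zmod_morphism P -> continuous P -> (forall x, (forall t, P (t *: x) = 0) -> x = 0) ->
  exists W T, [/\ nbhs 0 W, 0 < T & forall s x, 0 < s ->
    (forall t, `|t| <= s -> W (P (t *: x))) -> `|x| <= T / s].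
Proof.
move=> hG PB Pc P0.
have /compact_near_coveringP cS := @sphere_rV_compact R d.
(* Neighbourhoods of [0] that shrink, together with bounds that grow. *)
pose F : set_system (set G * R) := [set Q | exists W T, nbhs 0 W /\
  forall W' T', W' `<=` W -> T <= T' -> Q (W', T')].
have FF : Filter F.
  split; first by exists setT, 0; split => //; exact: filterT.
    move=> Q1 Q2 [W1 [T1 [n1 h1]]] [W2 [T2 [n2 h2]]].
    exists (W1 `&` W2), (Num.max T1 T2); split; first exact: filterI.
    move=> W' T' WW; rewrite ge_max => /andP[t1 t2]; split; [apply: h1|apply: h2] => //.
      by move=> x /WW[].
    by move=> x /WW[].
  by move=> Q1 Q2 QQ [W [T [n h]]]; exists W, T; split => // *; apply/QQ/h.
have [x x1|W [T [W0 h]]] := cS _ F (fun WT x => exists t, `|t| <= WT.2 /\ ~ WT.1 (P (t *: x))) FF.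
  have [t Pt] : exists t, P (t *: x) != 0.
    apply: contrapT => none; have x0 : x = 0.
      by apply: P0 => t; apply/eqP/negPn/negP => h; apply: none; exists t.
    by move: x1; rewrite /= x0 normr0 => /esym/eqP; rewrite oner_eq0.
  have [U [U0 nU]] : exists U : set G, nbhs 0 U /\ ~ U (P (t *: x)).
    apply: contrapT => none; move/eqP: Pt; apply; apply: hausdorff_eq0 => // U U0.
    by apply: contrapT => nU; apply: none; exists U.
  have [V [V0 Vsym VsU VU]] := nbhs0_sum2 U0.
  have Ptc : continuous (fun y : 'rV[R]_d => P (t *: y)).
    by apply: (@continuous_comp2 _ _ _ (fun y : 'rV[R]_d => t *: y)) => //; exact: scaler_continuous.
  exists ([set y | V (P (t *: x) - P (t *: y))], [set WT | WT.1 `<=` V /\ `|t| <= WT.2]).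
    split; last by exists V, `|t|.
    by apply: (Ptc x [set z | V (P (t *: x) - z)]); exact: nbhs_subr.
  move=> [y [W T]] /= [Vy [WV tT]]; exists t; split => // Wy; apply: nU.
  by rewrite -(subrK (P (t *: y)) (P (t *: x))); apply: VU => //; exact: WV.
exists W, (Num.max T 1); split => //; first by rewrite lt_max ltr01 orbT.
move=> s x s0 Wx; rewrite leNgt; apply/negP => xT.
have T0 : 0 < Num.max T 1 by rewrite lt_max ltr01 orbT.
have x0 : 0 < `|x| by apply: lt_trans xT; exact: divr_gt0.
have Tm : T <= Num.max T 1 by rewrite le_max lexx.
have [|t [tT]] := h W (Num.max T 1) (@subset_refl _ _) Tm (`|x|^-1 *: x).
  by rewrite /= normrZ ger0_norm ?invr_ge0 // mulVf ?gt_eqF.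
rewrite /= scalerA; apply; apply: Wx; rewrite normrM [`|_^-1|]ger0_norm ?invr_ge0 //.
rewrite ler_pdivrMr //; apply: le_trans tT _ => /=.
by rewrite ltr_pdivrMr // in xT; rewrite mulrC ltW.
Qed.

End OneParamCoordinates.

(** * Ultralimits of homomorphisms *)

Section GroupLimits.
Context {G : topologicalZmodType} {I : Type} {F : set_system I} {FF : Filter F}.
Implicit Types (u v : I -> G) (x y : G).

Lemma cvg_addg u v x y : u @ F --> x -> v @ F --> y -> (fun i => u i + v i) @ F --> x + y.
Proof.
move=> ux vy; apply: (@cvg_comp _ _ _ (fun i => (u i, v i)) (fun z : G * G => z.1 + z.2)
  F (nbhs (x, y)) (nbhs (x + y))); first exact: cvg_pair.
exact: (@add_continuous G (x, y)).
Qed.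

Lemma cvg_oppg u x : u @ F --> x -> (fun i => - u i) @ F --> - x.
Proof. by move=> ux; exact: (continuous_cvg _ (@opp_continuous G x) ux). Qed.

Lemma cvg_subg u v x y : u @ F --> x -> v @ F --> y -> (fun i => u i - v i) @ F --> x - y.
Proof. by move=> ux vy; apply: cvg_addg => //; exact: cvg_oppg. Qed.

Lemma cvg_mulrng u x n : u @ F --> x -> (fun i => u i *+ n) @ F --> x *+ n.
Proof.
move=> ux; elim: n => [|n IH]; first exact: cvg_cst.
by under eq_fun do rewrite mulrS; rewrite mulrS; exact: cvg_addg.
Qed.

Lemma cvg_mulrzg u x (k : int) : u @ F --> x -> (fun i => u i *~ k) @ F --> x *~ k.
Proof.
move=> ux; case: k => n; first exact: cvg_mulrng.
rewrite NegzE mulrNz; under eq_fun do rewrite mulrNz.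
by apply: cvg_oppg; exact: cvg_mulrng.
Qed.

Lemma cvg_bounded_mulrz u (k : I -> int) (C : nat) : u @ F --> 0 ->
  (forall i, (`|k i| <= C)%N) -> (fun i => u i *~ k i) @ F --> 0.
Proof.
move=> u0 kC U /(@nbhs0_sum G C)[V [V0 Vsym VU]].
have multiple x (n : nat) : V x -> (n <= C)%N -> U (x *+ n).
  move=> Vx nC; have := VU (nseq n x); rewrite size_nseq big_nseq iter_addr_0.
  by apply=> // y /nseqP[->].
have nV : \forall i \near F, V (u i) by exact: (u0 _ V0).
suff : \forall i \near F, U (u i *~ k i) by [].
apply: filterS nV => i /= Vui; have := kC i; case: (k i) => n nC.
  exact: multiple.
by rewrite NegzE mulrNz -mulNrz; apply: multiple => //; exact: Vsym.
Qed.

End GroupLimits.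

Section UltraLimits.
Context {G : topologicalZmodType}.
Hypothesis hG : hausdorff_space G.

(** Homomorphisms are constructed in this way from approximate ones, [F] being an
    ultrafilter. *)
Lemma limit_zmod_morphism (I : Type) (F : set_system I) (D : zmodType) (Phi : I -> D -> G) :
  ProperFilter F -> (forall q, exists l : G, Phi ^~ q @ F --> l) ->
  (forall q r, (fun i => Phi i (q - r) - (Phi i q - Phi i r)) @ F --> (0 : G)) ->
  exists2 phi : D -> G, zmod_morphism phi & forall q, Phi ^~ q @ F --> phi q.
Proof.
move=> FF /boolp.choice[phi phiP] Phi0; exists phi => // q r.
have c := cvg_addg (Phi0 q r) (cvg_subg (phiP q) (phiP r)).
rewrite add0r in c; apply: (cvg_unique hG (phiP (q - r))).
rewrite (_ : Phi ^~ (q - r) = fun i => Phi i (q - r) - (Phi i q - Phi i r) +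
  (Phi i q - Phi i r)); first exact: c.
by apply/funext => i; rewrite subrK.
Qed.

(** By [exists_one_parameter_subgroup], a compact set that contains no nontrivial
    one-parameter subgroup has this property. *)
Definition rat_free (W : set G) :=
  forall phi : rat -> G, zmod_morphism phi -> (forall q, W (phi q)) -> forall q, phi q = 0.

Variable W : set G.
Hypotheses (cW : compact W) (clW : closed W) (Wrat : rat_free W).

(** The elements with many multiples in [W] have small factorial multiples:
    otherwise their multiples would accumulate to a copy of [rat] in [W]. *)
Lemma factorial_multiples_small (U : set G) : nbhs 0 U ->
  exists n, forall w, (forall k : int, (`|k| <= n * n`!)%N -> W (w *~ k)) -> U (w *+ n`!).
Proof.
move=> U0; apply: contrapT => none.
have /boolp.choice[w wP] n : exists w, (forall k : int, (`|k| <= n * n`!)%N -> W (w *~ k)) /\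
    ~ U (w *+ n`!).
  apply: contrapT => nn; apply: none; exists n => w hw; apply: contrapT => nU.
  by apply: nn; exists w.
have [F [FU leF]] := @ultraFilterLemma nat \oo _.
pose Phi n (q : rat) := w n *~ Num.floor (q * (n`!)%:R).
have integral (q : rat) : \forall n \near F, q * (n`!)%:R \is a Num.int.
  apply: leF; near=> n.
  have /dvdnP[k ->] : (`|denq q| %| n`!)%N.
    rewrite dvdn_fact // absz_gt0 denq_neq0 /=; near: n; exact: nbhs_infty_ge.
  rewrite natrM mulrCA rpredM ?natr_int // -[q in q * _]divq_num_den.
  by rewrite natr_absz gtr0_norm ?denq_gt0 // divfK ?intr_eq0 ?denq_eq0 // intr_int.
have inW (q : rat) : \forall n \near F, W (Phi n q).
  have big : \forall n \near F, (Num.bound `|q| <= n)%N by apply: leF; exact: nbhs_infty_ge.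
  near=> n; apply: (wP n).1; have qi : q * (n`!)%:R \is a Num.int by near: n.
  suff : `|Num.floor (q * (n`!)%:R)|%N%:R <= (n * n`!)%:R :> rat by rewrite ler_nat.
    rewrite natr_absz intr_norm floorK // normrM natrM [`|_%:R|]ger0_norm //.
    rewrite ler_pM2r ?ltr0n ?fact_gt0 //.
    apply: le_trans (ltW (archi_boundP _)) _ => //; rewrite ler_nat.
    by near: n.
have lim (q : rat) : exists l : G, Phi ^~ q @ F --> l.
  by have [l _ ql] := ultra_cvg_compact FU cW (inW q); exists l.
have add_ (q r : rat) : (fun n => Phi n (q - r) - (Phi n q - Phi n r)) @ F --> (0 : G).
  apply: cvg_near_cst; near=> n.
  have qi : q * (n`!)%:R \is a Num.int by near: n.
  have ri : r * (n`!)%:R \is a Num.int by near: n.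
  by rewrite /Phi mulrBl floorDrz ?rpredN // floorN // mulrzBr subrr.
have [phi phiB phiP] := limit_zmod_morphism _ lim add_.
have phiW q : W (phi q).
  exact: (closed_cvg _ clW (inW q) _ (phiP q)).
have phi1 := Wrat phiB phiW 1.
have : \forall n \near F, U (Phi n 1) by apply: (phiP 1); rewrite phi1.
move=> /filter_ex[n]; have [_] := wP n; rewrite /Phi mul1r.
by rewrite -[(n`!)%:R]/((n`!)%:Z%:~R) intrKfloor.
Unshelve. all: by end_near. Qed.

End UltraLimits.

(** * One-parameter subgroups as rescaled limits *)

Lemma floor_sub_bound {R : archiRealDomainType} (a b : R) :
  (`|(Num.floor (a - b) - (Num.floor a - Num.floor b))%R| <= 1)%N.
Proof.
have := floor_itv (a - b); have := floor_itv a; have := floor_itv b.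
set x := Num.floor a; set y := Num.floor b; set z := Num.floor (a - b).
rewrite !intrD => /andP[b1 b2] /andP[a1 a2] /andP[c1 c2].
have h1 : (z - (x - y))%:~R < (2 : int)%:~R :> R.
  by rewrite !intrB (_ : 2%:~R = 1 + 1) //; lra.
have h2 : (- 2 : int)%:~R < (z - (x - y))%:~R :> R.
  by rewrite !intrB (_ : (- 2)%:~R = - (1 + 1)) // ?mulrNz //; lra.
rewrite !ltr_int in h1 h2; lia.
Qed.

Lemma norm_floor_le {R : archiRealDomainType} (t : R) (N : nat) : `|t| <= N%:R ->
  (`|Num.floor t| <= N)%N.
Proof.
rewrite ler_norml => /andP[t1 t2].
have h1 : Num.floor t <= N%:Z.
  rewrite -(ler_int R); apply: le_trans (floor_le t) _; exact: t2.
have h2 : - N%:Z <= Num.floor t by rewrite floor_ge_int mulrNz.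
lia.
Qed.

Section Escape.
Context {R : realType} {G : topologicalZmodType}.
Hypothesis hG : hausdorff_space G.
Variable W : set G.
Hypotheses (cW : compact W) (clW : closed W) (Wrat : rat_free W).

Let phi0 (I : Type) (F : set_system I) (Phi : I -> rat -> G) : UltraFilter F ->
  (forall q, \forall i \near F, W (Phi i q)) ->
  (forall q r, (fun i => Phi i (q - r) - (Phi i q - Phi i r)) @ F --> (0 : G)) ->
  forall q, Phi ^~ q @ F --> (0 : G).
Proof.
move=> FU PhiW Phi0 q.
have lim (r : rat) : exists l : G, Phi ^~ r @ F --> l.
  by have [l _ rl] := ultra_cvg_compact FU cW (PhiW r); exists l.
have [phi phiB phiP] := limit_zmod_morphism hG _ lim Phi0.
suff <- : phi q = 0 by exact: phiP.
by apply: Wrat => // r; exact: (closed_cvg _ clW (PhiW r) _ (phiP r)).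
Qed.

(** The integral parts of the rational multiples of [j i] define an approximate
    homomorphism from [rat] to [W], hence a null one. *)
Lemma multiples_far_from_escape (I : Type) (F : set_system I) (y : I -> G) (j : I -> int) :
  UltraFilter F -> y @ F --> (0 : G) ->
  (forall C : nat, \forall i \near F, forall k : int, (`|k| <= C * `|j i|)%N -> W (y i *~ k)) ->
  (fun i => y i *~ j i) @ F --> (0 : G).
Proof.
move=> FU y0 Wy; pose Phi i (q : rat) := y i *~ Num.floor (q * (j i)%:~R).
have := @phi0 I F Phi FU _ _ 1; rewrite /Phi.
under [X in _ -> X @ F --> _]eq_fun do rewrite mul1r intrKfloor.
apply=> [q|q r]; rewrite /Phi.
  apply: filterS (Wy (Num.bound `|q|)) => i; apply; apply: norm_floor_le.
  rewrite normrM natrM natr_absz intr_norm ler_wpM2r //.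
  by rewrite ltW // archi_boundP.
under eq_fun do rewrite -mulrzBr -mulrzBr mulrBl.
by apply: (@cvg_bounded_mulrz _ _ _ _ _ _ 1%N) => // i; exact: floor_sub_bound.
Qed.

(** The multiples of a null family, rescaled by the number [N i] of them that
    are known to be in [W], have a one-parameter subgroup as limit, and the
    convergence is uniform. *)
Lemma rescaled_limit (I : Type) (F : set_system I) (y : I -> G) (N : I -> nat) :
  UltraFilter F -> y @ F --> (0 : G) ->
  (forall C : nat, \forall i \near F, (C <= N i)%N) ->
  (\forall i \near F, forall k : int, (`|k| <= N i)%N -> W (y i *~ k)) ->
  exists f : chom R G, forall U, nbhs 0 U -> \forall i \near F,
    forall k : int, (`|k| <= N i)%N -> U (y i *~ k - f (k%:~R / (N i)%:R)).
Proof.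
move=> FU y0 Noo Wy; pose Phi i (t : R) := y i *~ Num.floor (t * (N i)%:R).
have PhiW (t : R) : `|t| <= 1 -> \forall i \near F, W (Phi i t).
  move=> t1; apply: filterS Wy => i; apply; apply: norm_floor_le.
  by rewrite normrM [`|_%:R|]ger0_norm // ler_piMl.
have add_ (t u : R) : (fun i => Phi i (t - u) - (Phi i t - Phi i u)) @ F --> (0 : G).
  rewrite /Phi; under eq_fun do rewrite -mulrzBr -mulrzBr mulrBl.
  by apply: (@cvg_bounded_mulrz _ _ _ _ _ _ 1%N) => // i; exact: floor_sub_bound.
have lim (t : R) : exists l : G, Phi ^~ t @ F --> l.
  pose n := (Num.bound `|t|).+1.
  have tn : `|t / n%:R| <= 1.
    rewrite normrM normfV [`|n%:R|]ger0_norm // ler_pdivrMr ?ltr0n // mul1r.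
    by rewrite (le_trans (ltW (archi_boundP (normr_ge0 t)))) // ler_nat.
  have [l _ ll] := ultra_cvg_compact FU cW (PhiW _ tn).
  exists (l *+ n); pose r i := Num.floor (t * (N i)%:R) - Num.floor (t / n%:R * (N i)%:R) * n%:Z.
  have PhiE : Phi ^~ t = fun i => Phi i (t / n%:R) *+ n + y i *~ r i.
    apply/funext => i; rewrite /Phi /r mulrzBr.
    by rewrite mulrzA -pmulrn addrC subrK.
  rewrite PhiE -[l *+ n]addr0; apply: cvg_addg; first exact: cvg_mulrng.
  apply: (@cvg_bounded_mulrz _ _ _ _ _ _ n.+1) => // i; rewrite /r.
  have n0 : (0 : R) < n%:R by rewrite ltr0n.
  have := floor_itv (t * (N i)%:R); have := floor_itv (t / n%:R * (N i)%:R).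
  set a := Num.floor _; set b := Num.floor _; rewrite !intrD => /andP[a1 a2] /andP[b1 b2].
  have E : t / n%:R * (N i)%:R * n%:R = t * (N i)%:R by rewrite mulrAC divfK ?gt_eqF.
  have A1 : (a * n%:Z)%:~R <= t * (N i)%:R by rewrite -E intrM -pmulrn ler_pM2r.
  have A2 : t * (N i)%:R < ((a + 1) * n%:Z)%:~R.
    by rewrite -E intrM -pmulrn ltr_pM2r // intrD.
  have h1 : ((b < (a + 1) * n%:Z))%R.
    by rewrite -(ltr_int R); apply: le_lt_trans A2.
  have h2 : ((a * n%:Z < b + 1))%R.
    by rewrite -(ltr_int R) intrD; apply: le_lt_trans b2.
  lia.
have [f fB fP] := limit_zmod_morphism hG _ lim add_.
have fW t : `|t| <= 1 -> W (f t) by move=> t1; exact: (closed_cvg _ clW (PhiW t t1) _ (fP t)).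
have fc : continuous f.
  apply: additive_continuous => // U U0; apply: contrapT => nU.
  have /boolp.choice[t tP] n : exists t : R, `|t| <= n.+1%:R^-1 /\ ~ U (f t).
    apply: contrapT => none; apply: nU; apply/nbhs_ballP.
    exists n.+1%:R^-1 => /=; first by rewrite invr_gt0 ltr0n.
    move=> t; rewrite /ball /= sub0r normrN => tn /=; apply: contrapT => nUt.
    by apply: none; exists t; split => //; exact: ltW.
  have [H [HU leH]] := @ultraFilterLemma nat \oo _.
  have := @phi0 nat H (fun n q => f (ratr q * t n)) HU _ _ 1.
  under [X in _ -> X @ H --> _]eq_fun do rewrite rmorph1 mul1r.
  move=> h; have : \forall n \near H, U (f (t n)).
    apply: h U0 => [q|q r].
      have big : \forall n \near H, (Num.bound `|q| <= n)%N by apply: leH; exact: nbhs_infty_ge.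
      apply: filterS big => n qn; apply: fW; rewrite normrM.
      apply: le_trans (ler_wpM2l _ (tP n).1) _ => //.
      rewrite ler_pdivrMr ?ltr0n // mul1r -ratr_norm -(ratr_nat R) ler_rat.
      by rewrite (le_trans (ltW (archi_boundP (normr_ge0 q)))) // ler_nat ltnW.
    under eq_fun do rewrite rmorphB mulrBl fB subrr; exact: cvg_cst.
  by move=> /filter_ex[n]; have [] := tP n.
exists (mk_chom fB fc) => // U U0; apply: contrapT => nU.
have bad : \forall i \near F, exists k : int, (`|k| <= N i)%N /\
    ~ U (y i *~ k - f (k%:~R / (N i)%:R)).
  have [//|h] := in_ultra_setVsetC [set i | forall k : int, (`|k| <= N i)%N ->
    U (y i *~ k - f (k%:~R / (N i)%:R))] FU.
  apply: filterS h => i /= /existsNP[k /not_implyP[kN nUk]]; exists k; split => //.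
have /boolp.choice[k kP] i : exists k : int, (exists k : int, (`|k| <= N i)%N /\
    ~ U (y i *~ k - f (k%:~R / (N i)%:R))) -> (`|k| <= N i)%N /\
    ~ U (y i *~ k - f (k%:~R / (N i)%:R)).
  have [[k kP]|none] := pselect (exists k : int, (`|k| <= N i)%N /\
    ~ U (y i *~ k - f (k%:~R / (N i)%:R))); first by exists k.
  by exists 0.
pose s i : R := (k i)%:~R / (N i)%:R.
have N0 : \forall i \near F, (0 < N i)%N by exact: Noo.
have s1 : \forall i \near F, `[-1, 1]%classic (s i).
  apply: filterS (filterI bad N0) => i [/kP[ki _] Ni] /=; rewrite in_itv /= -ler_norml.
  by rewrite normrM normfV [`|(N i)%:R|]ger0_norm // ler_pdivrMr ?ltr0n // mul1r
    -intr_norm -natr_absz ler_nat.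
have [t _ st] := ultra_cvg_compact FU (@segment_compact R (-1) 1) s1.
have fs : (fun i => f (s i)) @ F --> f t by exact: (continuous_cvg _ (fc t) st).
have yk : (fun i => y i *~ (k i - Num.floor (t * (N i)%:R))) @ F --> (0 : G).
  apply: multiples_far_from_escape => // C.
  have near_t : \forall i \near F, `|t - s i| < (2 * C.+1%:R)^-1.
    have /cvgrPdist_lt := st; apply; rewrite invr_gt0 mulr_gt0 // ltr0n.
  have big : \forall i \near F, (2 * C.+1 <= N i)%N by exact: Noo.
  apply: filterS (filterI (filterI near_t big) Wy) => i [[ti Ni] Wi] l lC; apply: Wi.
  apply: leq_trans lC _.
  have Ni0 : 0 < (N i)%:R :> R by rewrite ltr0n; apply: leq_trans Ni; rewrite muln_gt0.
  have kE : (k i)%:~R = s i * (N i)%:R by rewrite /s divfK ?gt_eqF.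
  rewrite -(ler_nat R) natrM natr_absz intr_norm intrB kE.
  have := floor_itv (t * (N i)%:R); set a := Num.floor _; rewrite intrD => /andP[a1 a2].
  have h1 : `|s i * (N i)%:R - a%:~R| <= `|t - s i| * (N i)%:R + 1.
    rewrite (_ : s i * _ - _ = - ((t - s i) * (N i)%:R) + (t * (N i)%:R - a%:~R)); last ring.
    rewrite (le_trans (ler_normD _ _)) // normrN normrM [`|(N i)%:R|]ger0_norm // lerD2l.
    rewrite ler_norml; apply/andP; split; lra.
  have h2 : `|t - s i| * (N i)%:R <= (2 * C.+1%:R)^-1 * (N i)%:R.
    by rewrite ler_wpM2r // ltW.
  have C0 : 0 <= C%:R :> R by [].
  have C1 : 0 < C.+1%:R :> R by rewrite ltr0n.
  have h3 : C%:R * ((2 * C.+1%:R)^-1 * (N i)%:R) <= (N i)%:R / 2 :> R.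
    rewrite (_ : _ * _ = (C%:R / C.+1%:R) * ((N i)%:R / 2)); last first.
      by field; rewrite lt0r_neq0.
    by rewrite ler_piMl ?divr_ge0 // ler_pdivrMr // mul1r ler_nat.
  have h4 : C%:R <= (N i)%:R / 2 :> R.
    rewrite ler_pdivlMr // -natrM ler_nat; lia.
  apply: le_trans (ler_wpM2l C0 h1) _; rewrite mulrDr mulr1.
  apply: le_trans (lerD (le_trans (ler_wpM2l C0 h2) h3) h4) _.
  by rewrite -splitr.
have lim0 : (fun i => y i *~ k i - f (s i)) @ F --> (0 : G).
  have c := cvg_subg (cvg_addg yk (fP t)) fs; rewrite add0r subrr in c.
  rewrite (_ : (fun i => y i *~ k i - f (s i)) = fun i =>
    y i *~ (k i - Num.floor (t * (N i)%:R)) + Phi i t - f (s i)); first exact: c.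
  by apply/funext => i; rewrite mulrzBr /Phi subrK.
have : \forall i \near F, U (y i *~ k i - f (s i)) by exact: lim0.
by move=> /(filterI bad)/filter_ex[i [/kP[_ nUi]]].
Qed.

End Escape.

(** * Locally compact abelian groups near zero *)

Lemma lca_compact_nbhs {G : topologicalZmodType} (U : set G) : LCA G -> nbhs 0 U ->
  exists K, [/\ nbhs 0 K, K `<=` U, compact K, closed K & forall x, K x -> K (- x)].
Proof.
move=> [hG lG] U0; have [K0 nK0 [cK0 clK0]] := lG 0 I.
have {}nK0 : nbhs 0 K0.
  by move: nK0; rewrite /within /=; apply: filterS => x; apply.
have [V V0 VU] := topologicalZmod_regular U0.
pose K := K0 `&` closure V.
have nK : nbhs 0 K by apply: filterI => //; apply: filterS V0; exact: subset_closure.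
have clK : closed K by apply: closedI => //; exact: closed_closure.
have clN : closed [set x : G | K (- x)].
  by apply: (@closed_comp _ _ (-%R : G -> G) K) => // x _; exact: opp_continuous.
exists (K `&` [set x | K (- x)]); split.
- by apply: filterI => //; exact: nbhs0_opp.
- by move=> x [[_ Vx] _]; exact: VU.
- by apply: compact_closedI => //; apply: compact_closedI => //; exact: closed_closure.
- exact: closedI.
- by move=> x [Kx KNx]; split; rewrite /= ?opprK.
Qed.

Definition multiples_in {G : zmodType} (W : set G) : set G :=
  [set w | forall k : int, W (w *~ k)].

Lemma multiples_inMz {G : zmodType} (W : set G) w (k : int) :
  multiples_in W w -> multiples_in W (w *~ k).
Proof. by move=> Ww l; rewrite -mulrzA; exact: Ww. Qed.

(** What is needed of the structure of a locally compact abelian group [G] near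
    [0].  Classically an open subgroup of [G] is the product of some [R ^ n] and of
    a compact group, and [W] would be a neighbourhood of [0] in such a product;
    here [P] collects all the one-parameter subgroups, also those of the compact
    factor.  [ls_bound] says quantitatively that [W] contains no nontrivial
    one-parameter subgroup. *)
Record local_structure {R : realType} {G : topologicalZmodType} (d : nat)
    (P : 'rV[R]_d -> G) (W : set G) (T r : R) : Prop := LocalStructure {
  ls_morph : zmod_morphism P;
  ls_cont : continuous P;
  ls_coord : forall f : chom R G, exists x, forall t, f t = P (t *: x);
  ls_radius : 0 < r;
  ls_bound : forall s x, 0 < s -> (forall t, `|t| <= s -> W (P (t *: x))) -> `|x| <= T / s;
  ls_nbhs : nbhs 0 W;
  ls_compact : compact W;
  ls_closed : closed W;
  ls_opp : forall x, W x -> W (- x);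
  ls_rat_free : rat_free W;
  ls_split : nbhs 0 [set x | exists v, `|v| <= r /\ multiples_in W (x - P v)] }.

Section LocalStructure.
Context {R : realType} {G : topologicalZmodType}.
Hypotheses (lcaG : LCA G).
Let hG := lcaG.1.

Lemma bounded_line_eq0 (d : nat) (P : 'rV[R]_d -> G) (W : set G) (T : R) x : 0 <= T ->
  (forall s x, 0 < s -> (forall t, `|t| <= s -> W (P (t *: x))) -> `|x| <= T / s) ->
  (forall t, W (P (t *: x))) -> x = 0.
Proof.
move=> T0 bound Wx; apply/eqP; rewrite -normr_le0 leNgt; apply/negP => x0.
have s0 : 0 < (T + 1) / `|x| by rewrite divr_gt0 // ltr_wpDl.
have T1 : 0 < T + 1 by rewrite ltr_wpDl.
have := bound _ x s0 (fun t _ => Wx t).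
rewrite (_ : T / _ = T / (T + 1) * `|x|); last by field; rewrite !gt_eqF.
suff : T / (T + 1) * `|x| < 1 * `|x| by lra.
by rewrite ltr_pM2r // ltr_pdivrMr // mul1r ltrDl.
Qed.

(** [exists_one_parameter_subgroup] turns a nonzero homomorphism from [rat] into a
    line in [W]. *)
Lemma no_line_rat_free (d : nat) (P : 'rV[R]_d -> G) (W : set G) :
  (forall f : chom R G, exists x, forall t, f t = P (t *: x)) ->
  (forall x, (forall t, W (P (t *: x))) -> x = 0) -> zmod_morphism P ->
  compact W -> rat_free W.
Proof.
move=> coord line0 PB cW phi phiB phiW q; apply/eqP/negPn/negP => phiq.
have [f [fB fc fW [t ft]]] := @exists_one_parameter_subgroup R G hG W phi cW phiB phiW q phiq.
have [x xP] := coord (mk_chom fB fc).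
have fP u : f u = P (u *: x) by exact: (xP u).
have x0 : x = 0 by apply: line0 => u; rewrite -fP.
by move: ft; rewrite fP x0 scaler0 (zmod_morphism0 PB) eqxx.
Qed.

(** Elements near [0] split: subtract from [x] the bounded one-parameter
    contribution [P v] that maximizes the number of multiples of [x - P v]
    staying in [W1].  If this number [N] were finite for arbitrarily small [x],
    these multiples would have a one-parameter subgroup as rescaled limit, and
    subtracting [1 / N] times it as well would do better. *)
Lemma split_near0 (d : nat) (P : 'rV[R]_d -> G) (W W1 : set G) (r : R) :
  zmod_morphism P -> continuous P ->
  (forall f : chom R G, exists x, forall t, f t = P (t *: x)) ->
  (forall x, (forall t, W (P (t *: x))) -> x = 0) ->
  0 < r -> nbhs 0 W1 -> compact W1 -> closed W1 -> rat_free W1 ->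
  (forall x v, W1 x -> `|v| <= r -> W (x + P v)) ->
  nbhs 0 [set x | exists v, `|v| <= r /\ multiples_in W1 (x - P v)].
Proof.
move=> PB Pc coord line0 r0 nW1 cW1 clW1 rf W1W.
set S := [set x | _]; apply: contrapT => nS.
have PZ (k : int) x : P (k%:~R *: x) = P x *~ k.
  by rewrite scaler_int (zmod_morphismMz PB).
pose E (n : nat) x v := `|v| <= r /\ forall k : int, (`|k| <= n)%N -> W1 ((x - P v) *~ k).
have Emono n m x v : (n <= m)%N -> E m x v -> E n x v.
  by move=> nm [vr h]; split => // k kn; apply: h; exact: leq_trans nm.
have maxi x : ~ S x -> exists Nv : nat * 'rV[R]_d, E Nv.1 x Nv.2 /\ forall v, ~ E Nv.1.+1 x v.
  move=> nSx; have [n nE] : exists n, forall v, ~ E n x v.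
    apply: contrapT => none.
    have ne n : exists v, E n x v.
      by apply: contrapT => nv; apply: none; exists n => v Ev; apply: nv; exists v.
    have /boolp.choice[v vP] := ne.
    have [F [FU leF]] := @ultraFilterLemma nat \oo _.
    have vr : \forall n \near F, [set v : 'rV[R]_d | `|v| <= r] (v n).
      by apply: filterE => n; case: (vP n).
    have [l lr lv] := ultra_cvg_compact FU (@closed_ball_rV_compact R d r) vr.
    apply: nSx; exists l; split => // k.
    have c : (fun n => (x - P (v n)) *~ k) @ F --> (x - P l) *~ k.
      apply: cvg_mulrzg; apply: cvg_subg; first exact: cvg_cst.
      exact: (continuous_cvg _ (Pc l) lv).
    apply: (closed_cvg _ clW1 _ _ c).
    have big : \forall n \near F, (`|k| <= n)%N by apply: leF; exact: nbhs_infty_ge.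
    by apply: filterS big => n kn; case: (vP n) => _; apply.
  have [n1 [v0 Ev0] nE1] : exists2 n, exists v, E n x v & forall v, ~ E n.+1 x v.
    apply: contrapT => none; have : exists v, E n x v.
      elim: n {nE} => [|n [v Ev]]; last first.
        by apply: contrapT => nv; apply: none; exists n; [exists v|move=> u Eu; apply: nv; exists u].
      exists 0; split; first by rewrite normr0 ltW.
      by move=> k; rewrite leqn0 absz_eq0 => /eqP ->; rewrite mulr0z; exact: nbhs_singleton.
    by move=> [v /nE].
  by exists (n1, v0).
have /boolp.choice[Nv NvP] x : exists Nv : nat * 'rV[R]_d, ~ S x ->
    E Nv.1 x Nv.2 /\ forall v, ~ E Nv.1.+1 x v.
  by have [Sx|/maxi[Nv h]] := pselect (S x); [exists (0%N, 0) | exists Nv].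
have FS : ProperFilter (within (~` S) (nbhs (0 : G))).
  apply: Build_ProperFilter_ex => A; rewrite /within /= => nA; apply: contrapT => noA.
  by apply: nS; apply: filterS nA => x; apply: contraPP => nSx /(_ nSx) Ax; apply: noA; exists x.
have [F [FU leF]] := ultraFilterLemma FS.
have F0 : id @ F --> (0 : G).
  by move=> A A0; apply: leF; apply: filterS A0 => x Ax _.
have FnS : \forall x \near F, ~ S x by apply: leF; exact: withinT.
have Noo (C : nat) : \forall x \near F, (C <= (Nv x).1)%N.
  have near_E : \forall x \near F, E C x 0.
    apply: F0; have [V [V0 Vsym VW]] := nbhs0_sum C nW1.
    have V00 := nbhs_singleton V0.
    apply: filterS V0 => x Vx; split; first by rewrite normr0 ltW.
    move=> k kC; rewrite (zmod_morphism0 PB) subr0.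
    have := VW (nseq `|k| (x *~ sgz k)); rewrite size_nseq big_nseq iter_addr_0.
    have -> : x *~ sgz k *+ `|k| = x *~ k by rewrite pmulrn -mulrzA; congr (x *~ _); rewrite -intEsg.
    apply=> // y /nseqP[-> _]; case: sgzP => _; rewrite ?mulr0z ?mulr1z ?mulrN1z //.
    exact: Vsym.
  apply: filterS (filterI near_E FnS) => x [Ex /NvP[_ nE]].
  by rewrite leqNgt; apply/negP => NC; apply: (nE 0); exact: Emono Ex.
have vr : \forall x \near F, [set v : 'rV[R]_d | `|v| <= r] (Nv x).2.
  by apply: filterS FnS => x /NvP[[]].
have [l lr lv] := ultra_cvg_compact FU (@closed_ball_rV_compact R d r) vr.
have Pl : (fun x => P (Nv x).2) @ F --> P l by exact: (continuous_cvg _ (Pc l) lv).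
have yl : (fun x => x - P (Nv x).2) @ F --> - P l.
  by rewrite -[- P l]add0r; exact: (cvg_subg F0 Pl).
have l0 : l = 0.
  have W1k (k : int) : W1 (P l *~ k).
    rewrite -[P l]opprK mulNrz -mulrNz.
    have c : (fun x => (x - P (Nv x).2) *~ (- k)) @ F --> (- P l) *~ (- k) by exact: cvg_mulrzg.
    apply: (closed_cvg _ clW1 _ _ c).
    by apply: filterS (filterI (Noo `|k|%N) FnS) => x [kN /NvP[[_ h] _]]; apply: h; rewrite abszN.
  apply: line0 => t; rewrite -(subrK (Num.floor t)%:~R t) scalerDl (zmod_morphismD PB) PZ addrC.
  apply: W1W => //; rewrite normrZ; apply: le_trans lr; rewrite ler_piMl //.
  have := floor_itv t; rewrite intrD => /andP[h1 h2]; rewrite ger0_norm; lra.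
rewrite l0 (zmod_morphism0 PB) oppr0 in yl; rewrite l0 in lv.
have Wy : \forall x \near F, forall k : int, (`|k| <= (Nv x).1)%N -> W1 ((x - P (Nv x).2) *~ k).
  by apply: filterS FnS => x /NvP[[]].
have [f fP] := rescaled_limit (R := R) hG cW1 clW1 rf FU yl Noo Wy.
have [v' v'P] := coord f.
have [U [U0 _ UW1 UU]] := nbhs0_sum2 nW1.
have small : \forall x \near F, `|(Nv x).2 + (Nv x).1%:R^-1 *: v'| <= r.
  have s1 : \forall x \near F, `|(Nv x).2| < r / 2.
    have := lv; move=> /cvgr_norm_lt; apply; rewrite normr0; lra.
  have s2 : \forall x \near F, (Num.bound (2 * `|v'| / r) < (Nv x).1)%N by exact: Noo.
  apply: filterS (filterI s1 s2) => x [h1 h2]; apply: le_trans (ler_normD _ _) _.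
  rewrite [r]splitr lerD ?(ltW h1) // normrZ normfV [`|_%:R|]ger0_norm //.
  have N0 : 0 < (Nv x).1%:R :> R by rewrite ltr0n (leq_ltn_trans _ h2).
  rewrite ler_pdivrMl // -ler_pdivrMr ?divr_gt0 //.
  have b0 : 0 <= 2 * `|v'| / r by rewrite divr_ge0 ?mulr_ge0 // ltW.
  rewrite (_ : _ / _ = 2 * `|v'| / r); last by field; rewrite gt_eqF.
  by rewrite (le_trans (ltW (archi_boundP b0))) // ler_nat ltnW.
have N1 : \forall x \near F, (0 < (Nv x).1)%N by exact: Noo.
have [x [[xU xs] [xN nSx]]] := filter_ex (filterI (filterI (fP U U0) small) (filterI N1 FnS)).
have [_ /(_ ((Nv x).2 + (Nv x).1%:R^-1 *: v'))] := NvP x nSx; apply; split => //.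
set N := (Nv x).1 in xU xs xN *; set v := (Nv x).2 in xU xs xN *.
have xU' (k : int) : (`|k| <= N)%N -> U ((x - P (v + N%:R^-1 *: v')) *~ k).
  move=> kN; have := xU k kN; rewrite v'P => h.
  by rewrite (zmod_morphismD PB) opprD addrA mulrzBl -PZ scalerA.
move=> k kN; pose k1 : int := if (0 < k)%R then 1 else if k == 0 then 0 else -1.
rewrite -(subrK k1 k) mulrzDr; by apply: UU; apply: xU'; rewrite /k1; case: (ltrgt0P k) => kk; lia.
Qed.

Theorem exists_local_structure : finite_dimensional (one_param R G) ->
  exists d (P : 'rV[R]_d -> G) W T r, local_structure P W T r.
Proof.
move=> /one_param_coordinates[d [P [PB Pc coord P0]]].
have [Wb [T [nWb T0 bound]]] := one_param_bound hG PB Pc P0.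
have [W [nW WWb cW clW Wsym]] := lca_compact_nbhs lcaG nWb.
have boundW s x : 0 < s -> (forall t, `|t| <= s -> W (P (t *: x))) -> `|x| <= T / s.
  by move=> s0 h; apply: bound => // t ts; exact/WWb/h.
have line0 x : (forall t, W (P (t *: x))) -> x = 0.
  by move=> Wx; exact: (bounded_line_eq0 (ltW T0) boundW Wx).
have rf := no_line_rat_free coord line0 PB cW.
have [V [V0 _ VW VV]] := nbhs0_sum2 nW.
have [W1 [nW1 W1V cW1 clW1 _]] := lca_compact_nbhs lcaG V0.
have [r r0 rV] : exists2 r, 0 < r & forall v, `|v| <= r -> V (P v).
  have /nbhs_ballP[e e0 eV] : nbhs (0 : 'rV[R]_d) (P @^-1` V).
    by apply: (Pc 0); rewrite (zmod_morphism0 PB).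
  exists (e / 2) => [|v ve]; first by rewrite divr_gt0.
  apply: eV; rewrite -ball_normE /= sub0r normrN; apply: le_lt_trans ve _.
  by rewrite ltr_pdivrMr // ltr_pMr // ltr1n.
have rf1 : rat_free W1 by move=> phi phiB h; apply: rf => // q; exact/VW/W1V/h.
exists d, P, W, T, r; split => //.
have sp := split_near0 PB Pc coord line0 r0 nW1 cW1 clW1 rf1.
have {}sp := sp (fun x v W1x vr => VV _ _ (W1V _ W1x) (rV _ vr)).
apply: filterS sp => x [v [vr h]]; exists v; split => // k; exact/VW/W1V/h.
Qed.

End LocalStructure.

(** * Strict homomorphisms and multiplication by an integer *)

Lemma filter_all_seq {T : Type} {I : eqType} (F : set_system T) (P : I -> set T) (s : seq I) :
  Filter F -> (forall i, i \in s -> F (P i)) -> F [set x | forall i, i \in s -> P i x].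
Proof.
move=> FF; elim: s => [|i s IH] FP; first exact: filterE.
apply: filterS (filterI (FP i (mem_head _ _)) (IH _)) => [x [Pi Ps] j|j js].
  by rewrite inE => /predU1P[->|/Ps].
by apply: FP; rewrite inE js orbT.
Qed.

Section Strict.
Local Open Scope quotient_scope.
Context {A B : topologicalZmodType} (f : chom A B).

Lemma closed_translate (C : set B) (c : B) : closed C -> closed [set y | C (y - c)].
Proof.
move=> clC; apply: (@closed_comp _ _ (fun y : B => y - c) C) => // x _.
move=> U /(@nbhs_addl B) /(nbhs_subl x).
by apply: filterS => y /=; rewrite addrC addrA subrK.
Qed.

Lemma finite_cokernelP : finite_set [set: cokernel f] <->
  exists s : seq B, forall y, exists2 c, c \in s & range f (y - c).
Proof.
have imE (y z : B) : (\pi_(cokernel f) y = \pi_(cokernel f) z) <-> range f (y - z).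
  split=> [/eqP|h].
    by rewrite -Quotient.idealrBE => /asboolP.
  by apply/eqP; rewrite -Quotient.idealrBE; apply/asboolP.
split=> [/finite_seqP[s sP]|[s hs]].
  exists (map repr s) => y; exists (repr (\pi_(cokernel f) y)).
    apply: map_f; have : [set: cokernel f] (\pi_(cokernel f) y) by [].
    by rewrite sP.
  by apply/imE; rewrite reprK.
apply: (@sub_finite_set _ _ [set` map (\pi_(cokernel f)) s]); last exact: finite_seq.
move=> z _ /=; have [c cs /imE E] := hs (repr z).
by apply/mapP; exists c => //; rewrite -E reprK.
Qed.

Lemma range_coimage_map : range (coimage_map f) = range f.
Proof.
apply/seteqP; split=> [_ [x _ <-]|_ [x _ <-]]; first by exists (repr x).
by exists (\pi_(coimage f) x) => //; exact: coimage_mapE.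
Qed.

(** The image of [f] is closed of finite index, hence open. *)
Lemma strict_open : strict f -> finite_set [set: cokernel f] ->
  forall U, nbhs 0 U -> nbhs 0 (f @` U).
Proof.
move=> [inj emb clr] /finite_cokernelP[s hs] U.
rewrite range_coimage_map in clr.
have nr : nbhs 0 (range f).
  have : nbhs 0 [set y : B | forall c, c \in s -> ~ range f c -> ~ range f (y - c)].
    apply: filter_all_seq => c cs; have [rc|nrc] := pselect (range f c).
      by apply: filterE => y /(_ rc).
    have oc : open [set y : B | ~ range f (y - c)].
      by apply: (@closed_openC _ [set y : B | range f (y - c)]); exact: closed_translate.
    have nc : ~ range f (0 - c).
      by move=> [x _ fx]; apply: nrc; exists (- x) => //; rewrite raddfN /= fx sub0r opprK.
    by apply: filterS (open_nbhs_nbhs (conj oc nc)) => y ny _.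
  apply: filterS => y hy; have [c cs ryc] := hs y.
  have [[x _ fx]|nrc] := pselect (range f c); last by case: (hy c cs nrc ryc).
  by case: ryc => z _ fz; exists (z + x) => //; rewrite raddfD /= fx fz subrK.
move=> /nbhs_interior U0; pose V := U°.
pose piV : set (coimage f) := [set \pi_(coimage f) x | x in V].
have opiV : open piV.
  rewrite /open /= /quotient_open.
  have -> : \pi_(coimage f) @^-1` piV = \bigcup_(k in [set k | f k = 0]) [set x | V (x - k)].
    apply/seteqP; split=> x /=.
      move=> [v Vv piE]; have fE : f v = f x by rewrite -!coimage_mapE piE.
      exists (x - v); first by rewrite /= raddfB /= fE subrr.
      by rewrite /= subKr.
    move=> [k /= fk Vxk]; exists (x - k) => //; apply: inj.
    by rewrite !coimage_mapE raddfB /= fk subr0.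
  apply: bigcup_open => k _; rewrite openE => x /= Vxk.
  have oV : nbhs (x - k) V by apply: open_nbhs_nbhs; split => //; exact: open_interior.
  move: oV => /(@nbhs_addl A) /(nbhs_subl x); rewrite /interior /=.
  by apply: filterS => y /=; rewrite addrC addrA subrK.
have [Y oY YE] := (emb piV).1 opiV.
have Y0 : Y 0.
  have : piV (\pi_(coimage f) 0) by exists 0 => //; exact: nbhs_singleton U0.
  by rewrite -YE /= coimage_mapE raddf0.
apply: filterS (filterI (open_nbhs_nbhs (conj oY Y0)) nr) => y [Yy [x _ xE]]; rewrite -xE in Yy *.
rewrite -coimage_mapE in Yy; have : piV (\pi_(coimage f) x) by rewrite -YE.
move=> [v Vv piE]; exists v; first exact: interior_subset.
by rewrite -coimage_mapE piE coimage_mapE.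
Qed.

(** An open subgroup is closed, so that the image of an open [f] is. *)
Lemma open_strict : (forall U, nbhs 0 U -> nbhs 0 (f @` U)) -> strict f.
Proof.
move=> fo; have inj : injective (coimage_map f).
  move=> u v; rewrite -[u]reprK -[v]reprK !coimage_mapE => fuv.
  have : repr u - repr v \in chom_ker f by apply/eqP; rewrite raddfB /= fuv subrr.
  by rewrite Quotient.idealrBE => /eqP.
split=> // [U|].
  split=> [oU|[V oV <-]]; last first.
    rewrite /open /= /quotient_open.
    have -> : \pi_(coimage f) @^-1` (coimage_map f @^-1` V) = f @^-1` V.
      by apply/seteqP; split=> x /=; rewrite coimage_mapE.
    by move/continuousP: (@cts_fun _ _ f); apply.
  exists (f @` (\pi_(coimage f) @^-1` U)).
    rewrite openE => _ [x Ux <-]; rewrite /interior.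
    have : nbhs x (\pi_(coimage f) @^-1` U) by apply: open_nbhs_nbhs.
    move=> /(@nbhs_addl A) /fo /(nbhs_subl (f x)); apply: filterS => y [z /= Uz fz].
    by exists (x + z) => //; rewrite raddfD /= fz addrC subrK.
  apply/seteqP; split=> u /=; last first.
    by move=> Uu; exists (repr u); rewrite /= ?reprK.
  rewrite -[u]reprK coimage_mapE => -[x Ux fx]; rewrite (_ : \pi _ = \pi_(coimage f) x) //.
  by apply: inj; rewrite !coimage_mapE.
rewrite range_coimage_map => y cly; have nr : nbhs 0 (range f) by apply: fo; exact: filterT.
have [z [[x _ xz] [w _ wz]]] := cly _ (nbhs_subl y nr).
by exists (x - w) => //; rewrite raddfB /= xz wz opprB addrC subrK.
Qed.

(** If an ultrafilter on [f @^-1` C] did not converge to any of the finitely many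
    preimages of the limit of its image, it would avoid a neighbourhood of all of
    them, whose image is a neighbourhood of that limit since [f] is open. *)
Lemma open_proper : (forall U, nbhs 0 U -> nbhs 0 (f @` U)) -> closed (range f) ->
  finite_set [set` chom_ker f] -> forall C, compact C -> compact (f @^-1` C).
Proof.
move=> fo clr /finite_seqP[ks kE] C cC; rewrite compact_ultra => F FU FC.
have [c [Cc cl]] := cC (f @ F) _ FC.
have cvg_c V : nbhs c V -> F (f @^-1` V).
  move=> cV; have [//|FnV] := in_ultra_setVsetC (f @^-1` V) FU.
  by have [y [nVy Vy]] := cl (~` V) V FnV cV.
have [b _ fb] : range f c.
  apply: clr => V /cvg_c /filter_ex[x Vx]; exists (f x); split => //.
apply: contrapT => none.
have bad k : k \in ks -> exists Y, nbhs (b + k) Y /\ F (~` Y).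
  move=> kks; apply: contrapT => noY; apply: none; exists (b + k); split.
    have fk : f k = 0 by apply/eqP; have : [set` ks] k by []; rewrite -kE.
    by rewrite /= raddfD /= fk addr0 fb.
  move=> V Vbk; have [//|FnV] := in_ultra_setVsetC V FU.
  by case: noY; exists V.
have /boolp.choice[Y YP] k : exists Y, k \in ks -> nbhs (b + k) Y /\ F (~` Y).
  have [/bad[Y hY]|_] := boolP (k \in ks); first by exists Y.
  by exists setT.
have F1 : F [set x | forall k, k \in ks -> (~` Y k) x].
  by apply: filter_all_seq => k /YP[].
have nU : nbhs 0 [set x | forall k, k \in ks -> Y k (b + k + x)].
  by apply: filter_all_seq => k /YP[/(@nbhs_addl A)].
have /cvg_c F2 := nbhs_subl c (fo _ nU).
have [x [nYx [u Yu fu]]] := filter_ex (filterI F1 F2).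
have kP : (x - b - u) \in ks.
  have : [set` chom_ker f] (x - b - u).
    by apply/eqP; rewrite !raddfB /= fu fb subrr.
  by rewrite kE.
apply: (nYx _ kP); have := Yu _ kP.
by rewrite /= (_ : b + _ + u = x) // (addrC b) addrAC !subrK.
Qed.

End Strict.

Definition open_proper_mul (A : topologicalZmodType) (n : nat) :=
  (forall U : set A, nbhs 0 U -> nbhs 0 [set x *+ n | x in U]) /\
  (forall C : set A, compact C -> compact [set x : A | C (x *+ n)]).

(** The hypotheses on prime numbers compose. *)
Lemma FLCAb_open_proper_mul {R : realType} (A : topologicalZmodType) (n : nat) :
  FLCAb R A -> (0 < n)%N -> open_proper_mul A n.
Proof.
move=> [_ [_ _ pA]]; elim/ltn_ind: n => n IH n0.
have [n1|n1] := leqP n 1%N.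
  have -> : n = 1%N by lia.
  split=> [U|C cC]; first by rewrite (_ : [set x *+ 1 | x in U] = U) // image_id.
  by rewrite (_ : [set x | C (x *+ 1)] = C).
have p_pr := pdiv_prime n1; have [st fk fc] := pA _ p_pr.
have nE : n = (n %/ pdiv n * pdiv n)%N by rewrite divnK ?pdiv_dvd.
have m0 : (0 < n %/ pdiv n)%N by rewrite divn_gt0 ?pdiv_gt0 // pdiv_leq.
have [op1 p1] := IH _ (ltn_Pdiv (prime_gt1 p_pr) n0) m0.
have op2 := strict_open st fc.
have clr : closed (range (chom_mulrn A (pdiv n))).
  by rewrite -range_coimage_map; case: st.
have p2 := open_proper op2 clr fk.
have mulE (x : A) : chom_mulrn A (pdiv n) (x *+ (n %/ pdiv n)) = x *+ n.
  by rewrite [RHS](congr1 (fun k => x *+ k) nE) mulrnA.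
split=> [U /op1/op2|C cC].
  by apply: filterS => _ [_ [x Ux <-] <-]; exists x.
rewrite (_ : [set x | _] = [set x | (chom_mulrn A (pdiv n) @^-1` C) (x *+ (n %/ pdiv n))]).
  exact/p1/p2.
by apply/seteqP; split=> x /=; rewrite -mulE.
Qed.

(** * Finite dimension and finite rank *)

Section FiniteDimension.
Context {R : realType}.

Lemma finite_dimensional_dependent (V : lmodType R) : finite_dimensional V ->
  exists n, forall v : 'I_n -> V, exists2 c : 'I_n -> R, (exists i, c i != 0) &
    \sum_i c i *: v i = 0.
Proof.
move=> [n /unsquash[v2r lin [g gK _]]]; exists n.+1 => v.
have v2rB : zmod_morphism v2r by move=> x y; rewrite -scaleN1r addrC lin scaleN1r addrC.
have v2rZ a x : v2r (a *: x) = a *: v2r x.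
  by have := lin a x 0; rewrite (zmod_morphism0 v2rB) !addr0.
pose M : 'M[R]_(n.+1, n) := \matrix_i v2r (v i).
have kM : kermx M != 0.
  by rewrite -mxrank_eq0 -lt0n mxrank_ker subn_gt0 (leq_ltn_trans (rank_leq_col M)).
have [i ri] : exists i, row i (kermx M) != 0.
  apply: contrapT => none; move/eqP: kM; apply; apply/row_matrixP => i; rewrite row0.
  by apply/eqP/negPn/negP => ri; apply: none; exists i.
pose c j := kermx M i j; exists c.
  apply: contrapT => none; move/eqP: ri; apply; apply/rowP => j; rewrite [LHS]mxE [RHS]mxE.
  by apply/eqP/negPn/negP => cj; apply: none; exists j.
rewrite -[LHS]gK (_ : v2r _ = 0); first by rewrite -(zmod_morphism0 v2rB) gK.
rewrite (zmod_morphism_sum v2rB).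
have := congr1 (row i) (mulmx_ker M); rewrite row_mul row0 mulmx_sum_row => E; rewrite -[RHS]E.
by apply: eq_bigr => j _; rewrite v2rZ rowK mxE.
Qed.

(** The image is exhausted by a subspace of maximal dimension contained in it. *)
Lemma injective_finite_dimensional (V : lmodType R) (n : nat) (phi : V -> 'rV[R]_n) :
  linear phi -> injective phi -> finite_dimensional V.
Proof.
move=> lin inj.
have phiB : zmod_morphism phi by move=> x y; rewrite -scaleN1r addrC lin scaleN1r addrC.
have phiZ a x : phi (a *: x) = a *: phi x.
  by have := lin a x 0; rewrite (zmod_morphism0 phiB) !addr0.
have [U [Uim Umax]] : exists U : {vspace 'rV[R]_n}, (forall u, u \in U -> range phi u) /\
    forall U' : {vspace 'rV[R]_n}, (forall u, u \in U' -> range phi u) -> (\dim U' <= \dim U)%N.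
  apply: contrapT => none.
  suff ext k : exists2 U : {vspace 'rV[R]_n}, (k <= \dim U)%N &
      forall u, u \in U -> range phi u.
    have [U kU _] := ext n.+1; have := leq_trans kU (dimvS (subvf U)).
    by rewrite dimvf /dim /= mul1n ltnn.
  elim: k => [|k [U kU Uim]].
    exists 0%VS => // u; rewrite memv0 => /eqP ->; exists 0 => //.
    exact: zmod_morphism0.
  apply: contrapT => nk; apply: none; exists U; split => // U' Uim'.
  rewrite leqNgt; apply/negP => lt; apply: nk; exists U' => //.
  exact: leq_ltn_trans lt.
have phiU v : phi v \in U.
  have dim_le := Umax (U + <[phi v]>)%VS.
  have /eqP -> : (U == U + <[phi v]>)%VS.
    rewrite eqEdim addvSl /=; apply: dim_le => _ /memv_addP[u /Uim[x _ <-] [_ /vlineP[a ->] ->]].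
    by exists (x + a *: v) => //; rewrite (zmod_morphismD phiB) phiZ.
  by apply: subvP (memv_line _); exact: addvSr.
pose b := vbasis U; have bU := vbasisP U.
have /boolp.choice[g gP] : forall r : 'rV[R]_(\dim U), exists v, phi v = \sum_i r 0 i *: b`_i.
  move=> r; have [|v _ vE] := Uim (\sum_i r 0 i *: b`_i); last by exists v.
  by apply: memv_suml => i _; apply: memvZ; apply: vbasis_mem; rewrite mem_nth ?size_tuple.
exists (\dim U); apply: squash.
exists (fun v => \row_i coord b i (phi v)).
  by move=> a x y; apply/rowP => i; rewrite !mxE lin linearP.
exists g => [v|r].
  by apply: inj; rewrite gP [RHS](coord_vbasis (phiU v)); apply: eq_bigr => i _; rewrite mxE.
by apply/rowP => i; rewrite mxE gP coord_sum_free ?(basis_free bU).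
Qed.

End FiniteDimension.

Section Rank.
Context {R : realType} {A : topologicalZmodType}.

(** Independent elements modulo an open subgroup are detected by real
    characters, which are continuous as soon as they vanish on it. *)
Lemma finite_rank_open (S : set A) : finite_dimensional (chom A R^o) ->
  subgroup S -> nbhs 0 S -> finite_rank setT S.
Proof.
move=> /finite_dimensional_dependent[n dep] SS nS.
exists 'I_n => x _; apply: contrapT => none.
pose x' (i : nat) : A := if insub i is Some j then x j else 0.
have x'E (j : 'I_n) : x' j = x j by rewrite /x' valK.
have ind : independent_mod S n x'.
  move=> c Sc i ik; apply/eqP/negPn/negP => ci; apply: none.
  exists (fun i : 'I_n => c i); first by exists (Ordinal ik).
  by move: Sc; congr S; apply: eq_bigr => j _; rewrite x'E.
have /boolp.choice[psi psiP] (i : 'I_n) : exists psi : chom A R^o,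
    forall j : 'I_n, psi (x j) = (j == i)%:R.
  have [psi [psiB psiS psix]] := extend_to_real (fun j => (j == i :> nat)%:R : R) SS ind.
  have psic : continuous (psi : A -> R^o).
    apply: (@additive_continuous A R^o) => // U U0; apply: filterS nS => h Sh /=.
    by rewrite psiS //; exact: nbhs_singleton.
  exists (@mk_chom A R^o psi psiB psic) => j.
  by rewrite -x'E; exact: psix.
have [c [j cj] /chomP/(_ (x j)) E] := dep psi; move/eqP: cj; apply.
have evE (f : 'I_n -> chom A R^o) : (\sum_i f i) (x j) = \sum_i f i (x j).
  by elim/big_rec2: _ => [|i y z _ <-].
move: E; rewrite evE (eq_bigr (fun i => c i * (j == i)%:R)) => [|i _]; last first.
  by rewrite -psiP.
rewrite (bigD1 j) //= eqxx mulr1 big1 ?addr0 // => i /negPf; rewrite eq_sym => ->.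
by rewrite mulr0.
Qed.

End Rank.

(** * Compact sets of homomorphisms *)

Section ChomE.
Context {A B : topologicalZmodType}.

Lemma chom_sumE (I : Type) (s : seq I) (f : I -> chom A B) x :
  (\sum_(i <- s) f i) x = \sum_(i <- s) f i x.
Proof. by elim/big_rec2: _ => [|i y z _ <-]. Qed.

Lemma chom_mulrnE (f : chom A B) n x : (f *+ n) x = f x *+ n.
Proof. by elim: n => // n IH; rewrite !mulrS -IH. Qed.

Lemma chom_mulrzE (f : chom A B) k x : (f *~ k) x = f x *~ k.
Proof. by case: k => n; rewrite ?NegzE ?mulrNz -!pmulrn ?chom_oppE chom_mulrnE. Qed.

End ChomE.

Section ChomTopology.
Context {A B : topologicalZmodType}.

Lemma chom_cvg (F : set_system (chom A B)) (g : chom A B) : Filter F ->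
  (forall K U, compact K -> open U -> (forall x, K x -> U (g x)) ->
    \forall f \near F, forall x : A, K x -> U ((f : chom A B) x)) ->
  F --> g.
Proof.
move=> FF h N; rewrite nbhsE => -[_ [[C oC <-] Cg] CN].
have : (@compact_open_of_chom A B) @ F --> (compact_open_of_chom g : {compact-open, A -> B}).
  apply/compact_open_cvgP => K U cK oU gKU.
  have : \forall f \near F, forall x : A, K x -> U ((f : chom A B) x).
    by apply: h => // x Kx; apply: gKU; exists x.
  by apply: filterS => f fKU _ [x Kx <-]; exact: fKU.
have nC : nbhs (compact_open_of_chom g) C by exact: open_nbhs_nbhs.
move=> /(_ C nC) FC; rewrite /fmap /= in FC; apply: (@filterS _ F _ _ _ CN).
exact: FC.
Qed.

Lemma nbhs_chom (K : set A) (U : set B) (g : chom A B) : compact K -> open U ->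
  (forall x, K x -> U (g x)) -> nbhs g [set f : chom A B | forall x, K x -> U (f x)].
Proof.
move=> cK oU gKU.
have hK : open_nbhs (compact_open_of_chom g)
    [set k : {compact-open, A -> B} | k @` K `<=` U].
  by split; [exact: compact_open_open|move=> _ [x Kx <-]; exact: gKU].
apply: (@filterS _ (nbhs g) _ (@compact_open_of_chom A B @^-1` _)); last first.
  exact: (@initial_continuous _ _ (@compact_open_of_chom A B) g _ (open_nbhs_nbhs hK)).
by move=> k kU x Kx; apply: kU; exists x.
Qed.

Lemma nbhs0_chom (K : set A) (U : set B) : compact K -> nbhs 0 U ->
  nbhs (0 : chom A B) [set f : chom A B | forall x, K x -> U (f x)].
Proof.
move=> cK /nbhs_interior U0.
apply: filterS (@nbhs_chom K U° 0 cK (@open_interior _ U) _) => [f fK x /fK|x Kx].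
  exact: interior_subset.
exact: nbhs_singleton U0.
Qed.

Lemma chom_eval_continuous (x : A) : continuous (fun f : chom A B => f x).
Proof.
move=> f U; rewrite nbhsE => -[V [oV Vf] VU].
have := @nbhs_chom [set x] V f (@compact_set1 _ x) oV.
by move=> /(_ (fun y => _)) h; apply: filterS (h _) => [g /(_ x erefl)/VU|y ->].
Qed.

Lemma chom_hausdorff : hausdorff_space B -> hausdorff_space (chom A B).
Proof.
move=> hB f g cl; apply/chomP => x; apply: hB => U V fU gV.
have fU' : nbhs f [set h : chom A B | U (h x)] by exact: chom_eval_continuous.
have gV' : nbhs g [set h : chom A B | V (h x)] by exact: chom_eval_continuous.
by have [h [Uh Vh]] := cl _ _ fU' gV'; exists (h x).
Qed.

End ChomTopology.

Fixpoint sums_of {G : zmodType} (W : set G) (l : nat) : set G :=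
  if l is l'.+1 then [set x | exists a b, [/\ W a, sums_of W l' b & x = a + b]]
  else [set 0].

Lemma sums_of_compact {G : topologicalZmodType} (W : set G) l :
  compact W -> compact (sums_of W l).
Proof.
move=> cW; elim: l => [|l IH] /=; first exact: compact_set1.
have -> : [set x | exists a b, [/\ W a, sums_of W l b & x = a + b]] =
    (fun z : G * G => z.1 + z.2) @` (W `*` sums_of W l).
  apply/seteqP; split=> x /=; first by move=> [a [b [Wa Wb ->]]]; exists (a, b).
  by move=> [[a b] [/= Wa Wb] <-]; exists a, b.
apply: continuous_compact; last exact: compact_setX.
by apply: continuous_subspaceT; exact: add_continuous.
Qed.

Lemma sums_of_sum {G : zmodType} (W : set G) (s : seq G) :
  (forall x, x \in s -> W x) -> sums_of W (size s) (\sum_(x <- s) x).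
Proof.
elim: s => [|x s IH] Ws; first by rewrite big_nil.
rewrite big_cons; exists x, (\sum_(y <- s) y); split => //.
  by apply: Ws; rewrite mem_head.
by apply: IH => y ys; apply: Ws; rewrite inE ys orbT.
Qed.

Definition generates_mod_torsion {A : zmodType} (V : set A) :=
  forall z, exists n : nat, (0 < n)%N /\ exists2 s : seq A,
    forall x, x \in s -> V x \/ V (- x) & z *+ n = \sum_(x <- s) x.

Section CompactSet.
Context {A B : topologicalZmodType}.
Variables (V : set A) (W : set B).
Hypotheses (hB : hausdorff_space B) (V0 : nbhs 0 V) (genV : generates_mod_torsion V)
  (openA : forall n (U : set A), (0 < n)%N -> nbhs 0 U -> nbhs 0 [set x *+ n | x in U])
  (properB : forall n (C : set B), (0 < n)%N -> compact C -> compact [set x : B | C (x *+ n)])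
  (cW : compact W) (clW : closed W) (Wopp : forall x, W x -> W (- x)) (Wrat : rat_free W).

(** Equicontinuity of the homomorphisms from [V] to [W]: on the neighbourhood
    of [0] made of the [n!]-th multiples of elements with many multiples in
    [V], they take values that are [n!]-th multiples of elements with many
    multiples in [W], and these are small by [factorial_multiples_small]. *)
Lemma chom_equicontinuous (U : set B) : nbhs 0 U ->
  exists2 N : set A, nbhs 0 N & forall f : chom A B,
    (forall x, V x -> W (f x)) -> forall x, N x -> U (f x).
Proof.
move=> U0; have [n hn] := factorial_multiples_small hB cW clW Wrat U0.
pose m := (n * n`!)%N.
pose N : set A := [set x | forall k : nat, k \in iota 0 m.+1 -> V (x *+ k)].
have N0 : nbhs 0 N.
  apply: filter_all_seq => k _.
  have ck : {for 0, continuous (fun x : A => x *+ k)}.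
    have : continuous (chom_mulrn A k) by exact: cts_fun.
    by move=> /(_ 0).
  by apply: ck; rewrite mul0rn.
exists [set x *+ n`! | x in N]; first by apply: openA => //; exact: fact_gt0.
move=> f fVW _ [x Nx <-]; rewrite raddfMn /=; apply: hn => -[k|k] km.
  by rewrite -pmulrn -raddfMn; apply/fVW/Nx; rewrite mem_iota /= add0n ltnS.
rewrite NegzE mulrNz; apply: Wopp; rewrite -pmulrn -raddfMn; apply/fVW/Nx.
by rewrite mem_iota /= add0n ltnS.
Qed.

(** The Arzela-Ascoli argument: along an ultrafilter of such homomorphisms the
    values at [x] converge, because a multiple of [x] is a sum of elements of
    [V] and multiplication by an integer is proper on [B]; the limit is continuous,
    and the convergence uniform on compact sets, by equicontinuity. *)
Theorem chom_compact : compact [set f : chom A B | forall x, V x -> W (f x)].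
Proof.
rewrite compact_ultra => F FU FVW.
have ptw (x : A) : exists l : B, (fun f : chom A B => f x) @ F --> l.
  have [n [n0 [s Vs xs]]] := genV x.
  have cK : compact [set y : B | sums_of W (size s) (y *+ n)].
    by apply: properB => //; exact: sums_of_compact.
  have FK : \forall f \near F, [set y : B | sums_of W (size s) (y *+ n)] ((f : chom A B) x).
    apply: filterS FVW => f fVW /=; rewrite -raddfMn xs raddf_sum.
    have := @sums_of_sum _ W (map f s); rewrite size_map big_map; apply=> _ /mapP[y ys ->].
    have [/fVW//|/fVW] := Vs y ys.
    by rewrite raddfN => /Wopp; rewrite opprK.
  by have [l _ ll] := ultra_cvg_compact FU cK FK; exists l.
have add_ (x y : A) : (fun f : chom A B => f (x - y) - (f x - f y)) @ F --> (0 : B).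
  by under eq_fun do rewrite raddfB subrr; exact: cvg_cst.
have [g gB gP] := limit_zmod_morphism hB _ ptw add_.
have gVW x : V x -> W (g x).
  move=> Vx; apply: (closed_cvg _ clW _ _ (gP x)).
  by apply: filterS FVW => f; apply.
have gc : continuous g.
  apply: additive_continuous => // U U0.
  have [C C0 CU] := topologicalZmod_regular U0.
  have [N N0 NU] := chom_equicontinuous C0.
  apply: filterS N0 => x Nx /=; apply: CU.
  apply: (closed_cvg _ (@closed_closure _ C) _ _ (gP x)).
  by apply: filterS FVW => f /NU /(_ x Nx); exact: subset_closure.
exists (mk_chom gB gc); split; first exact: gVW.
apply: chom_cvg => K U cK oU gKU.
move/compact_near_coveringP: cK => /(_ _ F (fun f x => U (f x))); apply=> x Kx.
have Ugx : nbhs (g x) U by apply: open_nbhs_nbhs; split => //; exact: gKU.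
have /nbhs0_sum2[U1 [U10 _ _ U1U]] := nbhs_addl Ugx.
have [N N0 NU] := chom_equicontinuous U10.
exists ([set y | N (y - x)], [set f : chom A B | (forall x, V x -> W (f x)) /\ U1 (f x - g x)]).
  split; first exact: nbhs_subl.
  apply: filterI => //.
  have : \forall y \near g x, U1 (y - g x) by exact: nbhs_subl.
  exact: gP.
move=> [y f] /= [Nyx [fVW fx]].
have := U1U _ _ fx (NU f fVW _ Nyx); rewrite /= raddfB /=.
by congr U; rewrite addrC [X in X + g x]addrC subrKA subrK.
Qed.

End CompactSet.

(** * Generators up to torsion *)

Definition split_ball {R : realType} {G : zmodType} (d : nat) (P : 'rV[R]_d -> G)
    (W : set G) (r : R) : set G :=
  [set x | exists v, `|v| <= r /\ multiples_in W (x - P v)].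

Definition split_subgroup {R : realType} {G : zmodType} (d : nat) (P : 'rV[R]_d -> G)
    (W : set G) : set G :=
  [set x | exists u s, (forall l, l \in s -> multiples_in W l) /\ x = P u + \sum_(l <- s) l].

Section Split.
Context {R : realType} {G : topologicalZmodType} (d : nat) (P : 'rV[R]_d -> G).
Context (W : set G) (T r : R).
Hypothesis ls : local_structure P W T r.

Lemma multiples_in0 : multiples_in W 0.
Proof. by move=> k; rewrite mul0rz; exact: nbhs_singleton (ls_nbhs ls). Qed.

Lemma split_ball_compact : compact (split_ball P W r).
Proof.
have clL : closed (multiples_in W).
  have -> : multiples_in W = \bigcap_(k in [set: int]) [set w | W (w *~ k)].
    by apply/seteqP; split=> w Ww k => [_|]; exact: Ww.
  apply: closed_bigI => k _; apply: (@closed_comp _ _ (fun w : G => w *~ k) W).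
    by move=> w _; apply: cvg_mulrzg; exact: cvg_id.
  exact: ls_closed ls.
have cL : compact (multiples_in W).
  apply: (subclosed_compact clL (ls_compact ls)) => w /(_ 1).
  by rewrite mulr1z.
have -> : split_ball P W r = (fun z : 'rV[R]_d * G => P z.1 + z.2) @`
    ([set v | `|v| <= r] `*` multiples_in W).
  apply/seteqP; split=> x /=.
    by move=> [v [vr h]]; exists (v, x - P v); rewrite //= addrC subrK.
  by move=> [[v l] [/= vr h] <-]; exists v; split => //=; rewrite addrAC subrr add0r.
apply: continuous_compact; last by apply: compact_setX => //; exact: closed_ball_rV_compact.
apply: continuous_subspaceT => z; apply: cvg_addg; last exact: cvg_snd.
apply: (@cvg_comp _ _ _ fst P (nbhs z) (nbhs z.1)); [exact: cvg_fst|exact: (ls_cont ls)].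
Qed.

Lemma split_subgroup_subgroup : subgroup (split_subgroup P W).
Proof.
split=> [|x y [u [s [hs ->]]] [v [t [ht ->]]]].
  by exists 0, [::]; rewrite big_nil addr0 (zmod_morphism0 (ls_morph ls)).
exists (u - v), (s ++ map -%R t); split=> [l|].
  rewrite mem_cat => /orP[/hs//|/mapP[w /ht wL ->]].
  by rewrite -mulrN1z; exact: multiples_inMz.
by rewrite (ls_morph ls) big_cat big_map sumrN opprD addrACA.
Qed.

Lemma split_ball_subgroup : split_ball P W r `<=` split_subgroup P W.
Proof.
move=> x [v [_ h]]; exists v, [:: x - P v]; split => [l|]; first by rewrite inE => /eqP ->.
by rewrite big_seq1 addrC subrK.
Qed.

Lemma split_subgroup_nbhs : nbhs 0 (split_subgroup P W).
Proof. exact: filterS split_ball_subgroup (ls_split ls). Qed.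

Lemma split_subgroup_generated x : split_subgroup P W x ->
  exists2 s : seq G, forall y, y \in s -> split_ball P W r y & x = \sum_(y <- s) y.
Proof.
move=> [u [s [hs ->]]]; pose M := (Num.bound (`|u| / r)).+1.
have r0 := ls_radius ls.
exists (nseq M (P (M%:R^-1 *: u)) ++ s).
  move=> y; rewrite mem_cat => /orP[/nseqP[-> _]|/hs yL].
    exists (M%:R^-1 *: u); split; last by rewrite subrr; exact: multiples_in0.
    rewrite normrZ normfV normr_nat ler_pdivrMl ?ltr0n // -ler_pdivrMr //.
    have h : `|u| / r <= (Num.bound (`|u| / r))%:R.
      by apply/ltW/archi_boundP; rewrite divr_ge0 // ltW.
    by rewrite (le_trans h) // ler_nat.
  by exists 0; rewrite normr0 (ltW r0) (zmod_morphism0 (ls_morph ls)) subr0.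
rewrite big_cat big_nseq iter_addr_0 -(zmod_morphismMn (ls_morph ls)) -scaler_nat.
by rewrite scalerA divff ?scale1r // pnatr_eq0.
Qed.

(** The quotient of [G] by an open subgroup has finite rank. *)
Lemma exists_generators : finite_dimensional (chom G R^o) ->
  exists s : seq G, generates_mod_torsion (split_ball P W r `|` [set x | x \in s]).
Proof.
move=> fdG; have SS := split_subgroup_subgroup.
have fr := finite_rank_open fdG SS split_subgroup_nbhs.
have [k [x [_ _ xP]]] := finite_rank_basis SS fr.
pose s := [seq x i | i <- iota 0 k]; exists s => z.
have {xP}[n n0 [c /split_subgroup_generated[t tb tE]]] := xP z I.
pose gen y := exists2 s' : seq G, (forall x, x \in s' ->
    (split_ball P W r `|` [set x | x \in s]) x \/
    (split_ball P W r `|` [set x | x \in s]) (- x)) & y = \sum_(x <- s') x.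
have genN y : gen y -> gen (- y).
  move=> [s' hs ->]; exists (map -%R s'); last by rewrite big_map sumrN.
  by move=> _ /mapP[w /hs h ->]; rewrite opprK; case: h; [right|left].
have genD y y' : gen y -> gen y' -> gen (y + y').
  move=> [s1 hs1 ->] [s2 hs2 ->]; exists (s1 ++ s2); last by rewrite big_cat.
  by move=> w; rewrite mem_cat => /orP[/hs1|/hs2].
have gen0 : gen 0 by exists [::]; rewrite ?big_nil.
have SG : subgroup gen by split=> // y y' gy gy'; apply: genD => //; exact: genN.
have genx (i : 'I_k) : gen (x i).
  exists [:: x i]; last by rewrite big_seq1.
  move=> w; rewrite inE => /eqP ->; left; right.
  by apply: map_f; rewrite mem_iota /= add0n.
have genz : gen (z *~ n).
  rewrite -(subrK (\sum_(i < k) x i *~ c i) (z *~ n)); apply: genD.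
    by exists t => // w /tb; left; left.
  by apply: (subgroup_sum SG) => i; exact: subgroupMz.
exists `|n|%N; split; first by rewrite absz_gt0.
have -> : z *+ `|n| = z *~ n *~ sgz n.
  by rewrite -mulrzA pmulrn; congr (z *~ _); rewrite mulrC -abszEsg.
by have := subgroupMz SG (sgz n) genz.
Qed.

End Split.

Lemma lca_of_compact_nbhs (G : topologicalZmodType) (C : set G) : hausdorff_space G ->
  compact C -> nbhs 0 C -> LCA G.
Proof.
move=> hG cC nC; split=> // x _; exists [set y | C (y - x)].
  by apply: filterS (nbhs_subl x nC) => y Cy _.
have cK : compact [set y | C (y - x)].
  rewrite (_ : [set y | _] = (fun y => y + x) @` C).
    apply: continuous_compact => //; apply: continuous_subspaceT => y.
    by apply: cvg_addg; [exact: cvg_id | exact: cvg_cst].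
  apply/seteqP; split=> y /=; first by exists (y - x); rewrite ?subrK.
  by move=> [z Cz <-]; rewrite addrK.
by split=> //; exact: compact_closed.
Qed.

(** * Division by a prime number in the group of homomorphisms *)

Definition finite_mod {G : zmodType} (Q S : set G) :=
  exists t : seq G, forall f, Q f -> exists2 g, g \in t & Q g /\ S (f - g).

Section FiniteMod.
Context {G : zmodType} (Q : set G).

(** One representative for each colour. *)
Lemma finite_mod_colour (C : eqType) (s : seq C) (P : G -> C -> Prop) (S : set G) :
  (forall f g c, P f c -> P g c -> S (f - g)) ->
  (forall f, Q f -> exists2 c, c \in s & P f c) -> finite_mod Q S.
Proof.
move=> PS h; have /boolp.choice[g gP] c : exists g, (exists f, Q f /\ P f c) -> Q g /\ P g c.
  by have [[f h']|n] := pselect (exists f, Q f /\ P f c); [exists f | exists 0].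
exists (map g s) => f Qf; have [c cs Pfc] := h f Qf; exists (g c); first exact: map_f.
by have [//|Qg Pg] := gP c; [exists f | split => //; exact: PS Pg].
Qed.

Lemma finite_mod_meet S1 S2 : subgroup S1 -> subgroup S2 ->
  finite_mod Q S1 -> finite_mod Q S2 -> finite_mod Q (S1 `&` S2).
Proof.
move=> S1S S2S [s1 h1] [s2 h2].
apply: (@finite_mod_colour _ [seq (a, b) | a <- s1, b <- s2]
  (fun f c => S1 (f - c.1) /\ S2 (f - c.2))) => [f g c [f1 f2] [g1 g2]|f Qf].
  split; [rewrite -(subrKA c.1)|rewrite -(subrKA c.2)]; rewrite -[_ - g]opprB.
    exact: S1S.2.
  exact: S2S.2.
have [a a1 [_ Sa]] := h1 f Qf; have [b b2 [_ Sb]] := h2 f Qf.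
by exists (a, b); first exact: allpairs_f.
Qed.

Lemma subgroup_all {I : eqType} (s : seq I) (S : I -> set G) :
  (forall i, subgroup (S i)) -> subgroup [set f | forall i, i \in s -> S i f].
Proof.
move=> SS; split=> [i _|f g hf hg i js]; first by case: (SS i).
by apply: (SS i).2; [exact: hf|exact: hg].
Qed.

Lemma finite_mod_all {I : eqType} (s : seq I) (S : I -> set G) :
  (forall i, subgroup (S i)) -> (forall i, i \in s -> finite_mod Q (S i)) ->
  finite_mod Q [set f | forall i, i \in s -> S i f].
Proof.
move=> SS; elim: s => [|i s IH] h.
  by apply: (@finite_mod_colour _ [:: tt] (fun _ _ => True)) => // f _; exists tt.
have -> : [set f | forall j, j \in i :: s -> S j f] = S i `&` [set f | forall j, j \in s -> S j f].
  apply/seteqP; split=> f.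
    by move=> hf; split=> [|j js]; apply: hf; rewrite inE ?eqxx // js orbT.
  by move=> [Si hf] j; rewrite inE => /predU1P[->|/hf].
apply: finite_mod_meet => //; first exact: subgroup_all.
  by apply: h; rewrite mem_head.
by apply: IH => j js; apply: h; rewrite inE js orbT.
Qed.

End FiniteMod.

Section HomBall.
Context {R : realType} {A B : topologicalZmodType}.
Hypotheses (hA : FLCAb R A) (hB : FLCAb R B).
Let H : topologicalZmodType := chom A B.

Section PrimeDivision.
Variable p : nat.
Hypothesis p_pr : prime p.
Let p0 : (0 < p)%N := prime_gt0 p_pr.

Let torsion (G : topologicalZmodType) : FLCAb R G ->
  exists s : seq G, forall x, x *+ p = 0 -> x \in s.
Proof.
move=> [_ [_ _ /(_ p p_pr)[_ /finite_seqP[s sE] _]]]; exists s => x xp.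
have : [set` chom_ker (chom_mulrn G p)] x by exact/eqP.
by rewrite sE.
Qed.

Let cosets (G : topologicalZmodType) : FLCAb R G ->
  exists s : seq G, forall x, exists2 c, c \in s & exists y, x = y *+ p + c.
Proof.
move=> [_ [_ _ /(_ p p_pr)[_ _ /finite_cokernelP[s sE]]]]; exists s => x.
by have [c cs [y _ yE]] := sE x; exists c => //; exists y; rewrite -[y *+ p]/(chom_mulrn G p y) yE subrK.
Qed.

(** A homomorphism [f] is divisible by [p] once it kills the [p]-torsion and
    has divisible values: [p *: a |-> f a] is then well defined, and extends to
    [A] one element at a time. *)
Lemma chom_divide (f : H) : (forall x, x *+ p = 0 -> f x = 0) ->
  (forall x, exists y, f x = y *+ p) -> exists g : H, f = g *+ p.
Proof.
move=> ftor fdiv; pose D0 : set (A * B) := [set z | exists a, z = (a *+ p, f a)].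
have D0g : hom_graph D0.
  split; last by move=> y [a [/esym a0 ->]]; exact: ftor.
  split; first by exists 0; rewrite mul0rn raddf0.
  by move=> _ _ [a ->] [b ->]; exists (a - b); rewrite mulrnBl raddfB.
have [D x [DS D1] D0D nx|psi psiB psiE] := hom_graph_extend D0g.
  have [y fy] := fdiv x; exists y => k w Dw.
  have Dx (l : int) : D (x *~ (p%:Z * l), f x *~ l).
    rewrite mulrzA -pmulrn -mulrz_pair; apply: subgroupMz => //.
    by apply: D0D; exists x.
  have /dvdzP[l kE] : (p%:Z %| k)%Z.
    apply: contrapT => /negP nk; apply: nx.
    have cop : coprimez p%:Z k by rewrite coprimezE prime_coprime.
    have [u [v uv]] := Bezoutz p%:Z k.
    exists (f x *~ u + w *~ v).
    have := subgroupD DS (Dx u) (subgroupMz DS v Dw).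
    rewrite mulrz_pair -mulrzA; congr D; congr (_, _).
    rewrite -mulrzDr [p%:Z * u]mulrC [k * v]mulrC uv.
    by move/eqP: cop => ->.
  rewrite kE [l * _]mulrC in Dw *. have : D (0, w - f x *~ l).
    by rewrite -(subrr (x *~ (p%:Z * l))); exact: (DS.2 _ _ Dw (Dx l)).
  move=> /D1 /eqP; rewrite subr_eq0 => /eqP ->.
  by rewrite fy pmulrn -mulrzA.
have psiM x : psi (x *+ p) = f x by apply: psiE; exists x.
have psic : continuous psi.
  apply: additive_continuous => // U U0.
  have fU : nbhs 0 (f @^-1` U).
    have fc : continuous (f : A -> B) by exact: cts_fun.
    by apply: (fc 0); rewrite raddf0.
  apply: filterS ((FLCAb_open_proper_mul hA p0).1 _ fU) => _ [x Ux <-].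
  by rewrite /= psiM.
exists (mk_chom psiB psic); apply/chomP => x; rewrite -psiM (zmod_morphismMn psiB).
by rewrite chom_mulrnE.
Qed.

Let kill_torsion x : set H := [set f | x *+ p = 0 -> f x = 0].
Let divide_value x : set H := [set f | exists y, f x = y *+ p].

Let kill_torsion_subgroup x : subgroup (kill_torsion x).
Proof.
split=> [//|f g f0 g0 xp].
by rewrite /= chom_addE chom_oppE f0 ?g0 ?subrr.
Qed.

Let divide_value_subgroup x : subgroup (divide_value x).
Proof.
split=> [|f g [y fy] [z gz]]; first by exists 0; rewrite mul0rn.
by exists (y - z); rewrite chom_addE chom_oppE fy gz mulrnBl.
Qed.

Let values_torsion (f : H) x : x *+ p = 0 -> f x *+ p = 0.
Proof. by move=> xp; rewrite -raddfMn /= xp raddf0. Qed.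

Let chom_divideP : exists sT sC : seq A, forall f : H,
  (forall x, x \in sT -> kill_torsion x f) -> (forall x, x \in sC -> divide_value x f) ->
  exists g : H, f = g *+ p.
Proof.
have [sT hT] := torsion hA; have [sC hC] := cosets hA; exists sT, sC => f fT fC.
apply: chom_divide => x; first by move=> xp; apply: fT => //; exact: hT.
have [c cC [y ->]] := hC x; have [z fz] := fC c cC.
by exists (f y + z); rewrite raddfD raddfMn /= fz mulrnDl.
Qed.

(** The conditions of [chom_divide] are finitely many, by finiteness of the
    [p]-torsion and of the cokernel in [A], and each of them concerns a value that
    has, modulo what is wanted, finitely many possibilities, by the same in
    [B]. *)
Lemma chom_mulrn_finite_cokernel : exists t : seq H, forall f : H,
  exists2 g, g \in t & exists h : H, f - g = h *+ p.
Proof.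
have [sT [sC hD]] := chom_divideP.
have finT x : x \in sT -> finite_mod setT (kill_torsion x).
  move=> xT; have [tB hT] := torsion hB.
  apply: (@finite_mod_colour _ _ _ (0 :: tB) (fun (f : H) c => x *+ p = 0 -> f x = c)).
    by move=> f g c fc gc xp; rewrite chom_addE chom_oppE fc // gc // subrr.
  move=> f _; have [xp|xp] := pselect (x *+ p = 0).
    by exists (f x) => //; rewrite inE; apply/orP; right; apply: hT; exact: values_torsion.
  by exists 0; rewrite ?mem_head // => /xp.
have finC x : x \in sC -> finite_mod setT (divide_value x).
  move=> xC; have [cB hC] := cosets hB.
  apply: (@finite_mod_colour _ _ _ cB (fun (f : H) c => exists y, f x = y *+ p + c)).
    move=> f g c [y fy] [z gz]; exists (y - z).
    by rewrite chom_addE chom_oppE fy gz opprD addrACA subrr addr0 mulrnBl.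
  by move=> f _; have [c cC h] := hC (f x); exists c.
have [t ht] := finite_mod_meet (subgroup_all sT kill_torsion_subgroup)
  (subgroup_all sC divide_value_subgroup)
  (finite_mod_all kill_torsion_subgroup finT) (finite_mod_all divide_value_subgroup finC).
exists t => f; have [g gt [_ [fgT fgC]]] := ht f I.
by exists g => //; exact: hD.
Qed.

(** A homomorphism killed by [p] is determined by its values, which are torsion,
    on representatives of [A / p A]. *)
Lemma chom_mulrn_finite_kernel : finite_set [set f : H | f *+ p = 0].
Proof.
have [sC hC] := cosets hA; have [tB hT] := torsion hB.
pose S x : set H := [set f | f x = 0].
have SS x : subgroup (S x).
  by split=> // f g f0 g0; rewrite /S /= chom_addE chom_oppE f0 g0 subrr.
have fin x : x \in sC -> finite_mod [set f : H | f *+ p = 0] (S x).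
  move=> _; apply: (@finite_mod_colour _ _ _ tB (fun (f : H) c => f x = c)).
    by move=> f g c fc gc; rewrite /S /= chom_addE chom_oppE fc gc subrr.
  by move=> f fp; exists (f x) => //; apply: hT; rewrite -chom_mulrnE fp.
have [t ht] := finite_mod_all SS fin.
apply: (@sub_finite_set _ _ [set` t]); last exact: finite_seq.
move=> f fp; have [g gt [gp fg]] := ht f fp.
suff -> : f = g by [].
apply/chomP => x; have [c cC [y ->]] := hC x; rewrite !raddfD !raddfMn /= -!chom_mulrnE fp gp.
by have /eqP := fg c cC; rewrite /= chom_addE chom_oppE subr_eq0 => /eqP ->.
Qed.

(** The conditions of [chom_divide] are open: the [p]-torsion of [B] is finite,
    and the multiples of [p] in [B] form an open subgroup. *)
Lemma chom_divisible_nbhs : nbhs (0 : H) [set f : H | exists g : H, f = g *+ p].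
Proof.
have [sT [sC hD]] := chom_divideP; have [tB hT] := torsion hB.
have nT : nbhs 0 [set y : B | y *+ p = 0 -> y = 0].
  have : nbhs 0 [set y : B | forall c, c \in tB -> y = c -> y = 0].
    apply: filter_all_seq => c _; have [->|c0] := eqVneq c 0; first exact: filterE.
    have : nbhs 0 (~` [set c]).
      apply: open_nbhs_nbhs; split; last by move=> /= /esym/eqP; apply/negP.
      apply: closed_openC; apply: compact_closed; first by case: hB => -[].
      exact: compact_set1.
    by apply: filterS => y yc /yc.
  by apply: filterS => y h yp; apply: (h y) => //; exact: hT.
have nC : nbhs 0 [set y : B | exists z, y = z *+ p].
  by apply: filterS ((FLCAb_open_proper_mul hB p0).1 _ filterT) => y [z _ <-]; exists z.
have ev x (U : set B) : nbhs 0 U -> nbhs (0 : H) [set f : H | U (f x)].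
  by move=> U0; exact: (@chom_eval_continuous A B x (0 : chom A B) U U0).
have nkT : nbhs (0 : H) [set f | forall x, x \in sT -> kill_torsion x f].
  apply: filter_all_seq => x _.
  apply: (@filterS _ (nbhs (0 : H)) _ _ _ _ (ev x _ nT)) => f h xp.
  by apply: h; exact: values_torsion.
have ndC : nbhs (0 : H) [set f | forall x, x \in sC -> divide_value x f].
  by apply: filter_all_seq => x _; exact: (ev x _ nC).
by apply: filterS (filterI nkT ndC) => f [fT fC]; exact: hD.
Qed.

End PrimeDivision.
End HomBall.

(** * Local compactness and strictness *)

Definition hom_into {A B : topologicalZmodType} (V : set A) (W : set B) : set (chom A B) :=
  [set f | forall x, V x -> W (f x)].

Section HomBall.
Context {R : realType} {A B : topologicalZmodType}.
Hypotheses (hA : FLCAb R A) (hB : FLCAb R B).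
Let H : topologicalZmodType := chom A B.
Variables (V : set A) (W : set B).
Hypotheses (nV : nbhs 0 V) (cV : compact V) (genV : generates_mod_torsion V).
Hypotheses (nW : nbhs 0 W) (cW : compact W) (clW : closed W)
  (Wopp : forall x, W x -> W (- x)) (Wrat : rat_free W).

Lemma chom_hausdorffT : hausdorff_space H.
Proof. by apply: chom_hausdorff; case: hB => -[]. Qed.

Lemma hom_into_nbhs : nbhs (0 : H) (hom_into V W).
Proof. exact: nbhs0_chom. Qed.

Let hom_into_multiples_compact (n : nat) : (0 < n)%N ->
  compact (hom_into [set x *+ n | x in V] W).
Proof.
move=> n0; apply: chom_compact => //.
- by case: hB => -[].
- exact: (FLCAb_open_proper_mul hA n0).1.
- move=> z; have [m [m0 [s sV zE]]] := genV z; exists (m * n)%N; split; first by rewrite muln_gt0 m0.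
  exists [seq x *+ n | x <- s]; last by rewrite big_map mulrnA zE sumrMnl.
  by move=> _ /mapP[x /sV h ->]; rewrite -mulNrn; case: h => Vx; [left|right]; eexists; eauto.
- by move=> m U m0; exact: (FLCAb_open_proper_mul hA m0).1.
- by move=> m C m0; exact: (FLCAb_open_proper_mul hB m0).2.
Qed.

Lemma hom_into_compact : compact (hom_into V W).
Proof.
have -> : V = [set x *+ 1 | x in V] by rewrite -[LHS]image_id.
exact: hom_into_multiples_compact.
Qed.

(** If [p *: g] is small then [g] sends the neighbourhood [p *: V] to [W], so it
    stays in a compact set: a limit [g0] satisfies [p *: g0 = 0], and [g - g0]
    is a small element with the same multiple as [g]. *)
Lemma chom_mulrn_open p (N : set H) : prime p -> nbhs 0 N -> nbhs 0 [set f *+ p | f in N].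
Proof.
move=> p_pr N0; set S := [set _ | _ in N]; apply: contrapT => nS.
have p0 := prime_gt0 p_pr.
have FS : ProperFilter (within (~` S) (nbhs (0 : H))).
  apply: Build_ProperFilter_ex => X; rewrite /within /= => nX; apply: contrapT => noX.
  by apply: nS; apply: filterS nX => f; apply: contraPP => nSf /(_ nSf) Xf; apply: noX; exists f.
have [F [FU leF]] := ultraFilterLemma FS.
have FF : Filter F by exact: (@ultra_proper _ _ FU).
have F0 (X : set H) : nbhs 0 X -> F X.
  by move=> X0; apply: leF; apply: filterS X0 => x Xx _.
have FnS : F (~` S) by apply: leF; exact: withinT.
have /boolp.choice[g gP] f : exists g : H, (exists g : H, f = g *+ p) -> f = g *+ p.
  by have [[g h]|n] := pselect (exists g : H, f = g *+ p); [exists g|exists 0].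
have gW : \forall f \near F, hom_into [set x *+ p | x in V] W (g f).
  have FX := @filterI _ F FF _ _ (F0 _ hom_into_nbhs) (F0 _ (chom_divisible_nbhs hA hB p_pr)).
  apply: (@filterS _ F FF _ _ _ FX) => f [fW /gP fE] _ [x Vx <-].
  by have := fW x Vx; rewrite {1}fE chom_mulrnE raddfMn.
have [g0 _ gg0] := ultra_cvg_compact FU (hom_into_multiples_compact p0) gW.
have g0p : g0 *+ p = 0.
  have c1 : (fun f : H => g f *+ p) @ F --> g0 *+ p by exact: cvg_mulrng.
  have c2 : (fun f : H => g f *+ p) @ F --> (0 : H).
    move=> X /F0 FX; have FXD := @filterI _ F FF _ _ FX (F0 _ (chom_divisible_nbhs hA hB p_pr)).
    by apply: (@filterS _ F FF _ _ _ FXD) => f [Xf /gP]; rewrite /= => <-.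
  exact: (cvg_unique chom_hausdorffT c1 c2).
have gN : \forall f \near F, N (g f - g0) by exact: (gg0 _ (nbhs_subl g0 N0)).
have [f [[fS /gP fE] gfN]] := filter_ex (@filterI _ F FF _ _ (@filterI _ F FF _ _ FnS (F0 _ (chom_divisible_nbhs hA hB p_pr))) gN).
by apply: fS; exists (g f - g0) => //; rewrite mulrnBl g0p subr0.
Qed.

Lemma chom_prime_ranks p : prime p ->
  [/\ strict (chom_mulrn H p), finite_set [set` chom_ker (chom_mulrn H p)]
    & finite_set [set: cokernel (chom_mulrn H p)]].
Proof.
move=> p_pr; split.
- by apply: open_strict => N N0; exact: chom_mulrn_open.
- apply: sub_finite_set (chom_mulrn_finite_kernel hA hB p_pr) => f /eqP.
  by [].
- apply/finite_cokernelP; have [t ht] := chom_mulrn_finite_cokernel hA hB p_pr.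
  by exists t => f; have [g gt [h E]] := ht f; exists g => //; exists h.
Qed.

End HomBall.

(** * One-parameter groups of homomorphisms *)

Section Coordinates.
Context {R : realType} {G : topologicalZmodType} (d : nat) (P : 'rV[R]_d -> G).
Context (W : set G) (T r : R).
Hypothesis ls : local_structure P W T r.

Lemma ls_inj x y : (forall t, P (t *: x) = P (t *: y)) -> x = y.
Proof.
move=> xy; have W0 t : W (P (t *: (x - y))).
  rewrite scalerBr (ls_morph ls) xy subrr.
  exact: nbhs_singleton (ls_nbhs ls).
have T0 : 0 <= T.
  have := ls_bound ls ltr01 (fun t _ => W0 t); rewrite divr1.
  exact: le_trans.
apply/eqP; rewrite -subr_eq0; apply/eqP; apply: (@bounded_line_eq0 R G d P W T _ T0 _ W0) => s z s0.
exact: (ls_bound ls s0).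
Qed.

End Coordinates.

Section OneParam.
Context {R : realType} {A B : topologicalZmodType}.
Hypotheses (lcaA : LCA A) (fdA : finite_dimensional (chom A R^o)).
Context (d : nat) (P : 'rV[R]_d -> B) (W : set B) (T r : R).
Hypothesis ls : local_structure P W T r.
Let H : topologicalZmodType := chom A B.

(** By exchanging the variables, a one-parameter group of homomorphisms is a
    homomorphism from [A] to the one-parameter subgroups of [B]; it is continuous
    since, by [ls_bound], it is bounded on the neighbourhoods of [0] that [F t]
    sends to [W] for all small [t]. *)
Lemma one_param_chom (F : chom R H) : exists xi : 'I_d -> chom A R^o,
  forall t a, F t a = P (t *: \row_i xi i a).
Proof.
have Fc : continuous (F : R -> H) by exact: cts_fun.
have coord a : exists x, forall t, F t a = P (t *: x).
  have FaB : zmod_morphism (fun t => F t a) by move=> s t; rewrite raddfB.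
  have Fac : continuous (fun t => F t a).
    apply: (@continuous_comp2 _ _ _ (F : R -> H) (fun f : H => f a)) => //.
    exact: chom_eval_continuous.
  by have [x xP] := ls_coord ls (mk_chom FaB Fac); exists x.
have [xi xiP] := boolp.choice coord.
have xiB : zmod_morphism xi.
  move=> a b; apply: (ls_inj ls) => t.
  by rewrite -xiP (raddfB (F t : chom A B)) /= !xiP -(ls_morph ls) -scalerBr.
have [K [K0 _ cK _ _]] := lca_compact_nbhs lcaA filterT.
have [e e0 eK] : exists2 e : R, 0 < e & forall t a, `|t| <= e -> K a -> W (F t a).
  have nF : nbhs (0 : R) (F @^-1` hom_into K W).
    by apply: (Fc 0); rewrite raddf0; exact: nbhs0_chom (ls_nbhs ls).
  have /nbhs_ballP[e /= e0 eF] := nF; exists (e / 2); first by rewrite divr_gt0.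
  move=> t a te; apply: eF; rewrite -ball_normE /= sub0r normrN; apply: le_lt_trans te _.
  by rewrite ltr_pdivrMr // ltr_pMr // ltr1n.
have xiK a : K a -> `|xi a| <= T / e.
  by move=> Ka; apply: (ls_bound ls e0) => t te; rewrite -xiP; exact: eK.
have T0 : 0 <= T / e by have := xiK 0 (nbhs_singleton K0); exact: le_trans.
have xiBi i : zmod_morphism (fun a => xi a 0 i : R^o) by move=> a b; rewrite xiB !mxE.
have xici i : continuous (fun a => xi a 0 i : R^o).
  apply: (@additive_continuous A R^o) => // U /nbhs_ballP[eps /= eps0 epsU].
  pose n := Num.bound (T / e / eps).
  have nK : nbhs 0 [set a : A | K (a *+ n.+1)].
    have c : (fun a : A => a *+ n.+1) @ nbhs 0 --> 0 *+ n.+1 by apply: cvg_mulrng; exact: cvg_id.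
    by apply: c; rewrite mul0rn.
  apply: filterS nK => a Ka; apply: epsU; rewrite -ball_normE /= sub0r normrN.
  have le1 : `|xi a 0 i| <= `|xi a|.
    rewrite [leRHS]mx_normrE; apply: le_trans (le_bigmax _ _ (0, i)) => //=.
  apply: le_lt_trans le1 _.
  have := xiK _ Ka; rewrite (zmod_morphismMn xiB) normrMn -mulr_natl => h.
  have n0 : 0 < n.+1%:R :> R by rewrite ltr0n.
  rewrite -(ltr_pM2l n0); apply: le_lt_trans h _; rewrite -ltr_pdivrMr //.
  have hb : T / e / eps < n%:R by apply: archi_boundP; rewrite divr_ge0 // ltW.
  by rewrite (lt_trans hb) // ltr_nat.
exists (fun i => mk_chom (xiBi i) (xici i)) => t a; rewrite xiP; congr (P (_ *: _)).
by apply/rowP => i; rewrite mxE.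
Qed.

Lemma one_param_chom_finite_dimensional : finite_dimensional (one_param R H).
Proof.
have [n /unsquash[v2r lin [g gK _]]] := fdA.
have v2rB : zmod_morphism v2r by move=> x y; rewrite -scaleN1r addrC lin scaleN1r addrC.
have [xi xiP] := boolp.choice one_param_chom.
pose phi (F : one_param R H) : 'rV[R]_(d * n) := mxvec (\matrix_(i, j) v2r (xi F i) 0 j).
have xi_lin a (F F' : one_param R H) i : xi (a *: F + F') i = a *: xi F i + xi F' i.
  apply/chomP => x; have E : \row_i xi (a *: F + F') i x = \row_i (a *: xi F i + xi F' i) x.
    apply: (ls_inj ls) => t; rewrite -xiP.
    have -> : (a *: F + F') t x = (F : chom R H) (a * t) x + (F' : chom R H) t x by [].
    rewrite !xiP -(zmod_morphismD (ls_morph ls)) mulrC -scalerA -scalerDr.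
    by congr (P (_ *: _)); apply/rowP => j; rewrite !mxE.
  by have /rowP/(_ i) := E; rewrite !mxE.
apply: (@injective_finite_dimensional _ _ _ phi) => [a F F'|F F' E].
  rewrite /phi -linearP; congr mxvec; apply/matrixP => i j.
  by rewrite !mxE xi_lin lin !mxE.
apply/chomP => t; apply/chomP => x; rewrite !xiP; congr (P (_ *: _)).
apply/rowP => i; rewrite !mxE; congr ((_ : chom A R^o) x).
apply: (can_inj gK); apply/rowP => j.
by have /matrixP/(_ i j) := can_inj mxvecK E; rewrite !mxE.
Qed.

End OneParam.

(** * Real characters and Dirichlet approximation *)

(** A real character on a compact neighbourhood [C] of [0] is bounded, and once
    it vanishes on finitely many elements every value on [C] is half of another
    one. *)
Lemma finitely_many_detect {R : realType} {G : topologicalZmodType} (C : set G) :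
  compact C -> nbhs 0 C -> exists s : seq G, forall f : chom G R^o,
    (forall c, c \in s -> f c = 0) -> forall x, C x -> f x = 0.
Proof.
move=> cC nC; have [V [V0 _ _ VV]] := nbhs0_sum2 nC.
have [s _ sP] := compact_finite_translates cC V0; exists s => f f0 x Cx.
have fc : continuous (f : G -> R^o) by exact: cts_fun.
have [M M0 Mf] : exists2 M : R, 0 <= M & forall y, C y -> `|f y| <= M.
  have : compact (f @` C) by apply: continuous_compact => //; exact: continuous_subspaceT.
  move=> /compact_bounded[M0 [_ hM]]; exists (`|M0| + 1); first by rewrite addr_ge0.
  move=> y Cy; apply: (hM _ _ (f y)); last by exists y.
  by rewrite (le_lt_trans (ler_norm _)) // ltrDl.
have half y : C y -> exists2 z, C z & f z = f y *+ 2.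
  move=> Cy; have [c cs Vyc] := sP y Cy; exists ((y - c) + (y - c)); first exact: VV.
  rewrite raddfD raddfB /=; have -> : f c = 0 by exact: f0.
  by rewrite [f y - 0]subr0.
have pow n y : C y -> `|f y| *+ (2 ^ n) <= M.
  elim: n y => [|n IH] y Cy; first exact: Mf.
  have [z Cz fz] := half y Cy; have := IH z Cz.
  by rewrite fz normrMn -mulrnA expnS.
apply/eqP; rewrite -normr_le0 leNgt; apply/negP => fx0.
pose n := Num.bound (M / `|f x|).
have : M / `|f x| < n%:R by apply: archi_boundP; rewrite divr_ge0.
rewrite ltr_pdivrMr // => h; have := pow n x Cx; rewrite leNgt => /negP; apply.
apply: (lt_le_trans h); rewrite -[leRHS]mulr_natl; apply: ler_wpM2r; first exact: ltW.
rewrite ler_nat.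
exact/ltnW/ltn_expl.
Qed.

(** Dirichlet approximation: more than [#|I|] vectors of [R ^ I] are linearly
    dependent; approximating a multiple of the coefficients by integers gives
    small nonzero integer combinations. *)
Lemma small_integer_combination {R : realType} (I : finType) :
  exists N, forall (eps : R) (v : 'I_N -> I -> R), 0 < eps ->
    exists2 c : 'I_N -> int, (exists i, c i != 0) & forall j, `|\sum_i v i j *~ c i| <= eps.
Proof.
exists #|I|.+1 => eps v eps0; set N := #|I|.+1.
have [x [k0 xk0] xv] : exists2 x : 'I_N -> R, (exists k, x k = 1) &
    forall j, \sum_i x i * v i j = 0.
  pose Mx : 'M[R]_(N, #|I|) := \matrix_(i, j) v i (enum_val j).
  have kM : kermx Mx != 0.
    by rewrite -mxrank_eq0 -lt0n mxrank_ker subn_gt0 (leq_ltn_trans (rank_leq_col Mx)).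
  have [i [k ik]] : exists i k, kermx Mx i k != 0.
    apply: contrapT => none; move/eqP: kM; apply; apply/matrixP => i k; rewrite [RHS]mxE.
    by apply/eqP/negPn/negP => ik; apply: none; exists i, k.
  exists (fun l => kermx Mx i l / kermx Mx i k); first by exists k; rewrite divff.
  move=> j; have E : \sum_l kermx Mx i l * Mx l (enum_rank j) = 0.
    by have /matrixP/(_ i (enum_rank j)) := mulmx_ker Mx; rewrite [LHS]mxE [RHS]mxE.
  have MxE l : Mx l (enum_rank j) = v l j by rewrite mxE enum_rankK.
  transitivity ((\sum_l kermx Mx i l * Mx l (enum_rank j)) / kermx Mx i k).
    by rewrite mulr_suml; apply: eq_bigr => l _; rewrite MxE mulrAC.
  by rewrite E mul0r.
pose C : R := \sum_j \sum_i `|v i j|.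
have C0 : 0 <= C by apply: sumr_ge0 => j _; exact: sumr_ge0.
pose M := (Num.bound (C / eps)).+1.
have M0 : 0 < M%:R :> R by rewrite ltr0n.
(* By the pigeonhole principle two multiples [q *: x] and [q' *: x] have their
   fractional parts in the same box of width [1 / M]. *)
pose box (q : nat) : {ffun 'I_N -> 'I_M} :=
  [ffun i => inord `|Num.floor ((q%:R * x i - (Num.floor (q%:R * x i))%:~R) * M%:R)|%N].
have boxP (q : nat) i : (box q i)%:R <= (q%:R * x i - (Num.floor (q%:R * x i))%:~R) * M%:R
    < (box q i)%:R + 1.
  set f := q%:R * x i - _.
  have f01 : 0 <= f < 1.
    have := floor_itv (q%:R * x i); rewrite intrD => /andP[h1 h2].
    by rewrite /f; apply/andP; split; lra.
  have f0 : 0 <= f * M%:R by rewrite mulr_ge0 ?(ltW M0) //; case/andP: f01.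
  have fl0 : 0 <= Num.floor (f * M%:R) by rewrite floor_ge0.
  rewrite ffunE -/f inordK; last first.
    rewrite -(ltr_nat R) natr_absz ger0_norm //.
    apply: le_lt_trans (floor_le _) _.
    by rewrite gtr_pMl //; case/andP: f01.
  rewrite natr_absz ger0_norm //; have := floor_itv (f * M%:R); rewrite intrD.
  by [].
have [q [q' [qq' bq]]] : exists q q' : nat, (q < q')%N /\ box q = box q'.
  apply: contrapT => none.
  have : injective (fun q : 'I_#|{ffun 'I_N -> 'I_M}|.+1 => box q).
    move=> q q' E; apply/val_inj; case: (ltngtP q q') => // lt; case: none.
      by exists q, q'.
    by exists q', q.
  by move=> /leq_card; rewrite card_ord ltnn.
pose c i := Num.floor (q'%:R * x i) - Num.floor (q%:R * x i).
exists c.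
  (* The coordinate [x k0 = 1] is an integer, so it is not altered by rounding. *)
  exists k0; rewrite /c xk0 !mulr1 -[q'%:R]/(q'%:Z%:~R) -[q%:R]/(q%:Z%:~R) !intrKfloor.
  by rewrite subr_eq0 eqz_nat gt_eqF.
move=> j; have E : \sum_i v i j *~ c i = \sum_i ((c i)%:~R - (q'%:R - q%:R) * x i) * v i j.
  under [RHS]eq_bigr do rewrite mulrBl -mulrA; rewrite sumrB -mulr_sumr xv mulr0 subr0.
  by apply: eq_bigr => i _; rewrite mulrzl.
rewrite E; apply: le_trans (ler_norm_sum _ _ _) _.
apply: (@le_trans _ _ (\sum_i M%:R^-1 * `|v i j|)).
  apply: ler_sum => i _; rewrite normrM ler_wpM2r //.
  rewrite -[M%:R^-1]mul1r ler_pdivlMr // -[X in _ * X]ger0_norm ?(ltW M0) // -normrM.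
  have := boxP q i; have := boxP q' i; rewrite bq /c intrB ler_norml; lra.
rewrite -mulr_sumr ler_pdivrMl //; apply: (@le_trans _ _ C).
  rewrite /C (bigD1 j) //= lerDl; apply: sumr_ge0 => k _; exact: sumr_ge0.
rewrite -ler_pdivrMr //; apply: ltW.
apply: (@lt_le_trans _ _ (Num.bound (C / eps))%:R); last by rewrite ler_nat.
by apply: archi_boundP; rewrite divr_ge0 // ltW.
Qed.

(** * The rank of the group of homomorphisms *)

(** The multiplier is uniform over [Q] and over all further multiples: so is the
    one of [factorial_multiples_small] over [multiples_in W], and a product of
    multipliers serves finitely many sets at once. *)
Definition absorbed {G : zmodType} (U Q : set G) :=
  exists m : nat, (0 < m)%N /\ forall q (k : int), Q q -> U (q *~ (k * m)).

Lemma absorbed_bigcup {G : zmodType} (U : set G) (I : finType) (Q : I -> set G) :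
  (forall i, absorbed U (Q i)) -> absorbed U [set q | exists i, Q i q].
Proof.
move=> /boolp.choice[m mP]; exists (\prod_i m i)%N; split.
  by apply: prodn_gt0 => i; case: (mP i).
move=> q k [i Qiq]; rewrite (bigD1 i) //= mulnC PoszM mulrA.
by case: (mP i) => _; apply.
Qed.

Lemma finite_rank_preim {G G' : zmodType} (phi : G -> G') (Q : set G) (S : set G') :
  zmod_morphism phi -> subgroup Q -> finite_rank setT S ->
  finite_rank Q [set x | Q x /\ S (phi x)].
Proof.
move=> phiB QS [I hI]; exists I => x Qx; have [c c0 Sc] := hI (fun i => phi (x i)) (fun _ => Logic.I).
exists c => //; split; first by apply: subgroup_sum => // i; exact: subgroupMz.
rewrite (zmod_morphism_sum phiB); move: Sc; congr S; apply: eq_bigr => i _.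
by rewrite (zmod_morphismMz phiB).
Qed.

Section Absorb.
Context {R : realType} {G : topologicalZmodType} (d : nat) (P : 'rV[R]_d -> G).
Context (W : set G) (T r : R).
Hypotheses (hG : hausdorff_space G) (ls : local_structure P W T r).

(** [f] carries the small factorial multiples of the elements of [multiples_in W]
    to small elements, and all their further multiples are of the same kind. *)
Lemma multiples_in_absorbed (G' : topologicalZmodType) (f : chom G G') U :
  nbhs 0 U -> absorbed U (f @` multiples_in W).
Proof.
move=> U0; have fU : nbhs 0 (f @^-1` U).
  have fc : continuous (f : G -> G') by exact: cts_fun.
  by apply: (fc 0); rewrite raddf0.
have [n hn] := factorial_multiples_small hG (ls_compact ls) (ls_closed ls) (ls_rat_free ls) fU.
exists n`!; split; first exact: fact_gt0.
move=> _ k [w Ww <-]; rewrite -raddfMz mulrzA; apply: hn => l _.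
exact: multiples_inMz.
Qed.

Lemma sum_multiples_in_absorbed (s : seq G) U : nbhs 0 U ->
  (forall l, l \in s -> multiples_in W l) -> absorbed U [set \sum_(l <- s) l].
Proof.
move=> U0 sW; have [V [V0 _ VU]] := nbhs0_sum (size s) U0.
have [m [m0 mV]] := multiples_in_absorbed (chom_mulrn G 1) V0.
exists m; split => // _ k ->; have := VU [seq l *~ (k * m) | l <- s].
rewrite size_map big_map -mulrz_suml; apply=> // _ /mapP[l ls' ->].
by apply: mV; exists l => //; exact: sW.
Qed.

End Absorb.

Section FiniteRankHom.
Context {R : realType} {A B : topologicalZmodType}.
Hypotheses (hA : hausdorff_space A) (hB : hausdorff_space B).
Context (dA dB : nat) (PA : 'rV[R]_dA -> A) (PB : 'rV[R]_dB -> B).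
Context (WA : set A) (WB : set B) (TA rA TB rB : R).
Hypotheses (lA : local_structure PA WA TA rA) (lB : local_structure PB WB TB rB).
Variable s : seq A.
Let H : topologicalZmodType := chom A B.
Let V : set A := split_ball PA WA rA `|` [set x | x \in s].
Let split_values : set H := [set f | forall x, x \in s -> split_subgroup PB WB (f x)].

(** Requiring one more value to be in the open subgroup [split_subgroup] costs a
    finite rank. *)
Lemma finite_rank_split_values : finite_dimensional (chom B R^o) ->
  finite_rank setT split_values.
Proof.
move=> fdB; rewrite /split_values; have SB := split_subgroup_subgroup lB.
have fr := finite_rank_open fdB SB (split_subgroup_nbhs lB).
elim: s => [|a t IH].
  by exists unit => f _; exists (fun=> 1) => //; exists tt.
apply: finite_rank_trans IH _.
rewrite [X in finite_rank _ X](_ : _ = [set f : H |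
    [set f : H | forall x, x \in t -> split_subgroup PB WB (f x)] f /\
    split_subgroup PB WB (f a)]).
  apply: (@finite_rank_preim _ _ (fun f : H => f a)) => //.
  apply: (@subgroup_all H _ t (fun x f => split_subgroup PB WB (f x))) => x.
  by split=> [|f g]; [exact: SB.1|exact: SB.2].
apply/seteqP; split=> f /=.
  by move=> h; split=> [x xt|]; apply: h; rewrite inE ?eqxx // xt orbT.
by move=> [h ha] x; rewrite inE => /predU1P[->|/h].
Qed.

Let Z : finType := ('I_dA + 'I_(size s))%type.

(* The finitely many vectors of coordinates of [f]: those of its restrictions to
   the one-parameter subgroups of a basis, and those of its values on [s].  The
   set [Q] of the errors is absorbed by every neighbourhood of [0]. *)
Let chart (f : H) (Y : Z -> 'rV[R]_dB) (Q : set B) :=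
  [/\ forall v, f (PA v) = PB (\sum_k v 0 k *: Y (inl k)),
      forall j : 'I_(size s), Q (f s`_j - PB (Y (inr j))),
      forall w, multiples_in WA w -> Q (f w)
    & forall U, nbhs 0 U -> absorbed U Q].

Lemma exists_chart (f : H) : split_values f -> exists YQ, chart f YQ.1 YQ.2.
Proof.
move=> fs; have fc : continuous (f : A -> B) by exact: cts_fun.
have /boolp.choice[X XP] k : exists x, forall t, f (PA (t *: delta_mx 0 k)) = PB (t *: x).
  pose g t := f (PA (t *: delta_mx 0 k)).
  have gB : zmod_morphism g by move=> a b; rewrite /g scalerBl (ls_morph lA) raddfB.
  have gc : continuous (g : R -> B).
    apply: (@continuous_comp2 _ _ _ (fun t : R => PA (t *: delta_mx 0 k)) f) => //.
    apply: (@continuous_comp2 _ _ _ (fun t : R => t *: delta_mx 0 k) PA) => //.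
      exact: scalel_continuous.
    exact: ls_cont lA.
  by have [x xP] := ls_coord lB (mk_chom gB gc); exists x.
have /boolp.choice[ut utP] (j : 'I_(size s)) : exists ut : 'rV[R]_dB * seq B,
    (forall l, l \in ut.2 -> multiples_in WB l) /\ f s`_j = PB ut.1 + \sum_(l <- ut.2) l.
  have [u [t [tW E]]] := fs _ (mem_nth 0 (ltn_ord j)).
  by exists (u, t).
pose Q (z : option 'I_(size s)) := if z is Some j then [set \sum_(l <- (ut j).2) l]
  else f @` multiples_in WA.
exists ((fun z => match z with inl k => X k | inr j => (ut j).1 end), [set q | exists z, Q z q]).
split=> /= [v|j|w Ww|U U0].
- rewrite [in LHS](row_sum_delta v) (zmod_morphism_sum (ls_morph lA)) raddf_sum.
  rewrite (zmod_morphism_sum (ls_morph lB)); apply: eq_bigr => k _; exact: XP.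
- by exists (Some j); rewrite /= (utP j).2 addrAC subrr add0r.
- by exists None; exists w.
- apply: absorbed_bigcup => -[j|] /=.
    by apply: (sum_multiples_in_absorbed hB lB U0); case: (utP j).
  exact: (multiples_in_absorbed hA lA).
Qed.

(** The coordinates of the value of a homomorphism at [x] depend linearly, up to
    an error, on the coordinates of the homomorphism, with coefficients [b] that
    depend on [x] only. *)
Lemma chart_point x : V x -> exists2 b : Z -> R, (forall z, `|b z| <= rA + 1) &
  forall f Y Q, chart f Y Q -> Q (f x - PB (\sum_z b z *: Y z)).
Proof.
have r0 := ls_radius lA.
case=> [[v [vr Wxv]]|/= /(nthP 0)[j js <-]].
  exists (fun z => if z is inl k then v 0 k else 0) => [[k|j]|f Y Q [fP _ fW _]].
  - rewrite (@le_trans _ _ `|v|) //; last by rewrite (le_trans vr) // lerDl.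
    rewrite [leRHS]mx_normrE; exact: (le_bigmax _ (fun ij => `|v ij.1 ij.2|) (0, k)).
  - by rewrite normr0 addr_ge0 // ltW.
  - rewrite big_sumType /= [X in PB (_ + X)]big1 ?addr0 => [|j _]; last by rewrite scale0r.
    by rewrite -fP -raddfB; exact: fW.
exists (fun z => if z is inr i then (i == Ordinal js)%:R else 0) => [[k|i]|f Y Q [_ fs _ _]].
- by rewrite normr0 addr_ge0 // ltW.
- by case: eqP => _; rewrite ?normr0 ?normr1 ?lerDr ?addr_ge0 // ltW.
- rewrite big_sumType /= big1 ?add0r => [|k _]; last by rewrite scale0r.
  rewrite (bigD1 (Ordinal js)) //= eqxx scale1r big1 ?addr0 => [|i /negPf ->]; last first.
    by rewrite scale0r.
  exact: (fs (Ordinal js)).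
Qed.

(** More homomorphisms than coordinates have, by [small_integer_combination], an
    integer combination whose coordinates are as small as one wishes, even after
    multiplication by the integer [m] that makes the errors small. *)
Lemma finite_rank_hom_into : finite_rank split_values (hom_into V WB).
Proof.
have [N dirichlet] := @small_integer_combination R (Z * 'I_dB)%type.
exists 'I_N => f fs.
have /boolp.choice[YQ YQP] i := exists_chart (fs i).
have [U1 [U10 _ _ U1W]] := nbhs0_sum2 (ls_nbhs lB).
have [U2 [U20 _ U2U1]] := nbhs0_sum N U10.
have absQ i : absorbed U2 (YQ i).2 by case: (YQP i) => _ _ _; apply.
have [m [m0 mU2]] := absorbed_bigcup absQ.
have [e e0 eU1] : exists2 e : R, 0 < e & forall y, `|y| <= e -> U1 (PB y).
  have /nbhs_ballP[e /= e0 eF] : nbhs (0 : 'rV[R]_dB) (PB @^-1` U1).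
    have Pc := ls_cont lB; apply: (Pc 0).
    by rewrite (zmod_morphism0 (ls_morph lB)).
  exists (e / 2) => [|y ye]; first by rewrite divr_gt0.
  apply: eF; rewrite -ball_normE /= sub0r normrN; apply: le_lt_trans ye _.
  by rewrite ltr_pdivrMr // ltr_pMr // ltr1n.
(* [m * #|Z| * (rA + 1)] bounds the factor by which small coordinates of an
   integer combination are expanded on [V]. *)
pose D : R := m%:R * (#|Z|%:R * (rA + 1)) + 1.
have rA1 : 0 < rA + 1 by rewrite addr_gt0 // (ls_radius lA).
have D0 : 0 < D by rewrite ltr_wpDl // !mulr_ge0 // ltW.
have [c [i0 ci0] cP] := dirichlet (e / D) (fun i zl => (YQ i).1 zl.1 0 zl.2) (divr_gt0 e0 D0).
exists (fun i => c i * m%:Z); first by exists i0; rewrite mulf_neq0 // eqz_nat -lt0n.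
move=> x Vx; have [b bP bQ] := chart_point Vx.
pose y i : 'rV[R]_dB := \sum_z b z *: (YQ i).1 z; pose q i := f i x - PB (y i).
have -> : (\sum_i f i *~ (c i * m%:Z)) x =
    PB (\sum_i y i *~ (c i * m%:Z)) + \sum_i q i *~ (c i * m%:Z).
  rewrite chom_sumE (zmod_morphism_sum (ls_morph lB)) -big_split; apply: eq_bigr => i _.
  by rewrite /= chom_mulrzE (zmod_morphismMz (ls_morph lB)) -mulrzDl /q addrC subrK.
apply: U1W; last first.
  have := U2U1 [seq q i *~ (c i * m%:Z) | i <- enum 'I_N].
  rewrite size_map size_enum_ord big_map big_enum; apply=> // _ /mapP[i _ ->].
  by apply: mU2; exists i; exact: bQ.
apply: eU1; rewrite [leLHS]mx_normrE; apply: bigmax_le => [|[i' l] _]; first exact: ltW.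
rewrite (ord1 i') /= summxE.
have -> : \sum_i (y i *~ (c i * m%:Z)) 0 l =
    m%:R * \sum_z b z * \sum_i (YQ i).1 z 0 l *~ c i.
  under eq_bigr => i _.
    rewrite -scaler_int mxE summxE mulr_sumr; under eq_bigr do rewrite mxE.
    over.
  rewrite exchange_big mulr_sumr; apply: eq_bigr => z _.
  rewrite mulrA mulr_sumr; apply: eq_bigr => i _.
  by rewrite -mulrzl intrM -pmulrn; ring.
rewrite normrM normr_nat; apply: (@le_trans _ _ (m%:R * (#|Z|%:R * (rA + 1) * (e / D)))).
  rewrite ler_wpM2l //; apply: le_trans (ler_norm_sum _ _ _) _.
  apply: (@le_trans _ _ (\sum_(z : Z) (rA + 1) * (e / D))).
    apply: ler_sum => z _; rewrite normrM ler_pM // ?(bP z) //.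
    by have := cP (z, l).
  by rewrite sumr_const -[leLHS]mulr_natl !mulrA.
rewrite mulrA mulrCA ler_piMr ?(ltW e0) // ler_pdivrMr // mul1r.
by rewrite /D lerDl.
Qed.

End FiniteRankHom.

(** * Finite ranks *)

(** The elements [s] of [finitely_many_detect], together with a maximal family that
    is independent modulo the common zeros [S] of the characters vanishing on
    [s], determine a character by its values. *)
Lemma characters_finite_dimensional {R : realType} {G : topologicalZmodType} (C : set G) :
  compact C -> nbhs 0 C -> finite_rank setT C -> finite_dimensional (chom G R^o).
Proof.
move=> cC nC [I hI]; have [s sP] := @finitely_many_detect R G C cC nC.
pose S : set G := [set x | forall f : chom G R^o, (forall c, c \in s -> f c = 0) -> f x = 0].
have SS : subgroup S.
  split=> [f _|x y Sx Sy f f0]; first exact: raddf0.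
  by rewrite raddfB /= Sx // Sy // subrr.
have fr : finite_rank setT S.
  exists I => x _; have [c c0 Cc] := hI x (fun _ => Logic.I).
  by exists c => // f f0; exact: sP f0 _ Cc.
have [k [x [_ _ xP]]] := finite_rank_basis SS fr.
pose e : seq G := s ++ [seq x i | i <- iota 0 k].
pose phi (f : chom G R^o) : 'rV[R]_(size e) := \row_i f e`_i.
apply: (@injective_finite_dimensional _ _ _ phi) => [a f g|f g fg].
  by apply/rowP => i; rewrite !mxE.
suff key (h : chom G R^o) : (forall c, c \in e -> h c = 0) -> forall z, h z = 0.
  apply/chomP => z; apply/eqP; rewrite -subr_eq0; apply/eqP.
  apply: (key (f - g)) => _ /(nthP 0)[i ie <-]; have /rowP/(_ (Ordinal ie)) := fg.
  by rewrite !mxE /= chom_addE chom_oppE => ->; exact: subrr.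
move=> h0 z; have [n n0 [c Sc]] := xP z Logic.I.
have := Sc h; rewrite raddfB raddfMz raddf_sum /= big1 => [E|i _]; last first.
  rewrite raddfMz /= (h0 (x i)) ?mul0rz // mem_cat; apply/orP; right.
  by apply: map_f; rewrite mem_iota /= add0n.
have /eqP : h z *~ n - 0 = 0.
  by apply: E => b bs; apply: h0; rewrite mem_cat bs.
by rewrite subr0 mulrz_eq0 (negPf n0) /= => /eqP.
Qed.

Unset Implicit Arguments.

Theorem proposition3p12 (R : realType) (A B : topologicalZmodType)
  (hA : FLCAb R A) (hB : FLCAb R B) : FLCAb R (chom A B).
Proof.
have [[hausA _] [fdA fdRA _]] := hA; have [[hausB _] [fdB fdRB _]] := hB.
have [dA [PA [WA [TA [rA lA]]]]] := exists_local_structure hA.1 fdRA.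
have [dB [PB [WB [TB [rB lB]]]]] := exists_local_structure hB.1 fdRB.
have [s genV] := exists_generators lA fdA.
set V := _ `|` _ in genV.
have nV : nbhs 0 V by apply: filterS (ls_split lA) => x; left.
have cV : compact V.
  apply: compactU; first exact: split_ball_compact lA.
  by apply: finite_compact; exact: finite_seq.
have [nW cW] := (ls_nbhs lB, ls_compact lB).
have clW := ls_closed lB; have Wopp := ls_opp lB; have rfW := ls_rat_free lB.
have cO := hom_into_compact hA hB nV genV cW clW Wopp rfW.
have nO : nbhs (0 : chom A B) (hom_into V WB) by exact: hom_into_nbhs.
split; first exact: (lca_of_compact_nbhs (chom_hausdorff hausB) cO nO).
split.
- apply: (characters_finite_dimensional cO nO).
  have fr1 := finite_rank_split_values (A := A) lB s fdB.
  exact: finite_rank_trans fr1 (finite_rank_hom_into hausA hausB lA lB s).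
- exact: (one_param_chom_finite_dimensional hA.1 fdA lB).
- by move=> p p_pr; exact: (chom_prime_ranks hA hB nV cV genV nW cW clW Wopp rfW p_pr).
Qed.
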